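(* Assume $V=L[U]$, where $U$ is a normal measure on $\kappa$ and $\kappa$ is the unique measurable cardinal. Let $\mathbb{P}$ be the Easton support product defined in the context, let $G\subseteq\mathbb{P}$ be generic over $V$, and let $G^*$, $H_0,H_1$, $U_0,U_1$ in $V[G]$ be as described in the context. In $V[G]$, let $\mathcal{V}=U_0$, and let $\mathcal{W}=\{X\subseteq\kappa : j_U(\kappa)+\kappa\in j^{V[G]}_{(U_1)^2}(X)\}$ be the measure derived from $j^{V[G]}_{(U_1)^2}$ using the ordinal $j_U(\kappa)+\kappa$ as a seed. Then, in $V[G]$, $\mathcal{V}<_L\mathcal{W}$, but $\mathcal{V}$ and $\mathcal{W}$ are Ketonen incomparable, i.e. neither $\mathcal{V}<_k\mathcal{W}$ nor $\mathcal{W}<_k\mathcal{V}$.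
   Context: **Forcing.** Let $I=\{\alpha<\kappa : \alpha\text{ is inaccessible}\}$. A set $X\subseteq\kappa$ is an Easton set if $X\cap\lambda$ is bounded in $\lambda$ for every $\lambda\in I\cup\{\kappa\}$. Let $$\mathbb{P}=\{f\colon X\to 2 : X\subseteq I\text{ is an Easton set}\},$$ ordered by inclusion (larger functions are stronger conditions). Equivalently, $\mathbb{P}$ is the Easton support product over $\alpha\in I$ of copies of the poset $\mathbb{Q}=\{0_{\mathbb{Q}},0,1\}$, where $0_{\mathbb{Q}}$ is the weakest condition and $0,1$ are incompatible. **Generics and measures in $V[G]$.** $j_U\colon V\to M_U$ denotes the ultrapower embedding by $U$. The poset $j_U(\mathbb{P})$ factors as $\mathbb{P}\times\mathbb{Q}\times\big(j_U(\mathbb{P})\setminus(\kappa+1)\big)$ (the coordinates below $\kappa$, the coordinate $\kappa$, and the coordinates above $\kappa$), where $j_U(\mathbb{P})\setminus(\kappa+1)$ consists of the functions $f\colon X\to2$ in $M_U$ with $X\subseteq j_U(I)\setminus(\kappa+1)$ an Easton set in the sense of $M_U$ (relative to $j_U(\kappa)$, $j_U(I)$). It is a standard fact that there is $G^*\in V[G]$ such that, for each $i\in\{0,1\}$, $H_i=G\times\{i\}\times G^*$ (the filter on $j_U(\mathbb{P})$ determined by $G$ below $\kappa$, the value $i$ at coordinate $\kappa$, and $G^*$ above $\kappa$) is $j_U(\mathbb{P})$-generic over $M_U$; and that there are normal measures $U_0,U_1\in V[G]$ on $\kappa$ whose ultrapower embeddings $j^{V[G]}_{U_i}\colon V[G]\to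 M_U[H_i]$ extend $j_U$ and map $G$ to $H_i$. Fix such $G^*,U_0,U_1$. **Iterated ultrapower.** For a normal measure $D$ on $\kappa$, $j_{D^2}$ denotes the ultrapower embedding by the product measure $D^2$; equivalently the two-step iterated ultrapower embedding $j^{M_D}_{j_D(D)}\circ j_D$. $j^{V[G]}_{(U_1)^2}$ is this embedding computed in $V[G]$ with $D=U_1$. **Ketonen order.** Let $U',W'$ be $\sigma$-complete ultrafilters on ordinals, where $U'$ is on the ordinal $\kappa'$. $U'<_k W'$ means that there exist $J\in W'$ and a sequence $\langle U'_\xi : \xi\in J\rangle$ of $\sigma$-complete ultrafilters such that each $U'_\xi$ concentrates on $\xi$, and for every $X\subseteq\kappa'$, $X\in U' \iff \{\xi\in J : X\cap\xi\in U'_\xi\}\in W'$. **Lipschitz order.** A function $f\colon\mathcal{P}(\kappa)\to\mathcal{P}(\kappa)$ is super-Lipschitz if for every $\xi<\kappa$ and $A\subseteq\kappa$, $f(A)\cap(\xi+1)=f(A\cap\xi)\cap(\xi+1)$. For ultrafilters $U',W'$ on $\kappa$, $U'<_L W'$ means that there is a super-Lipschitz function $f\colon\mathcal{P}(\kappa)\to\mathcal{P}(\kappa)$ with $f^{-1}[W']=U'$. *)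

(* Defs.v *)
(** Set theory is done inside a structure [N] with a binary relation [mem];
    in the theorem [N] is an arbitrary model of ZFC playing the role of the
    generic extension, and the ground model, the ultrapower and its generic
    extensions are classes [C : N -> Prop] of [N].  No well-foundedness is
    assumed of [N], so recursions are carried out inside [N], by approximations
    that are elements of [N].

    Notions that are not absolute between transitive classes take the class [C]
    in which they are computed as an argument.  The others (pairs, functions,
    ordinals, ...) are used only for elements of transitive classes and are
    written without relativization.

    Only the Rocq prelude is used. *)

Set Implicit Arguments.
Unset Strict Implicit.

Class Membership (N : Type) := mem : N -> N -> Prop.

Notation "x '∈' y" := (mem x y) (at level 70).

Section SetTheory.

Context {N : Type} `{Membership N}.

Definition cls := N -> Prop.

Definition univ : cls := fun _ => True.

(** ** ZFC in a class *)

(** First-order formulas of the language of set theory, with de Bruijn indices,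
    are needed for the two axiom schemes. *)
Inductive form : Type :=
| FEq (i j : nat)
| FMem (i j : nat)
| FBot
| FImp (p q : form)
| FAll (p : form).

Definition scons (x : N) (env : nat -> N) (n : nat) : N :=
  match n with O => x | S m => env m end.

Fixpoint sat (C : cls) (env : nat -> N) (p : form) : Prop :=
  match p with
  | FEq i j => env i = env j
  | FMem i j => env i ∈ env j
  | FBot => False
  | FImp p q => sat C env p -> sat C env q
  | FAll p => forall x, C x -> sat C (scons x env) p
  end.

Definition extensionality (C : cls) : Prop :=
  forall x y, C x -> C y -> (forall z, C z -> (z ∈ x <-> z ∈ y)) -> x = y.

Definition foundation (C : cls) : Prop :=
  forall x, C x -> (exists y, C y /\ y ∈ x) ->
  exists y, C y /\ y ∈ x /\ ~ (exists z, C z /\ z ∈ x /\ z ∈ y).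

Definition pairing (C : cls) : Prop :=
  forall a b, C a -> C b -> exists c, C c /\ a ∈ c /\ b ∈ c.

Definition union (C : cls) : Prop :=
  forall x, C x ->
  exists u, C u /\ forall y z, C y -> C z -> y ∈ x -> z ∈ y -> z ∈ u.

Definition powerset (C : cls) : Prop :=
  forall x, C x ->
  exists p, C p /\
    forall z, C z -> (forall t, C t -> t ∈ z -> t ∈ x) -> z ∈ p.

Definition infinity (C : cls) : Prop :=
  exists w, C w /\
    (exists e, C e /\ e ∈ w /\ forall z, C z -> ~ z ∈ e) /\
    (forall x, C x -> x ∈ w ->
       exists y, C y /\ y ∈ w /\ forall z, C z -> (z ∈ y <-> z ∈ x \/ z = x)).

Definition choice (C : cls) : Prop :=
  forall x, C x ->
  (forall y, C y -> y ∈ x -> exists z, C z /\ z ∈ y) ->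
  (forall y y' z, C y -> C y' -> C z ->
     y ∈ x -> y' ∈ x -> z ∈ y -> z ∈ y' -> y = y') ->
  exists c, C c /\
    forall y, C y -> y ∈ x ->
    exists z, C z /\ z ∈ y /\ z ∈ c /\
      forall z', C z' -> z' ∈ y -> z' ∈ c -> z' = z.

Definition separation (C : cls) : Prop :=
  forall (p : form) (env : nat -> N), (forall n, C (env n)) ->
  forall a, C a ->
  exists b, C b /\ forall x, C x -> (x ∈ b <-> x ∈ a /\ sat C (scons x env) p).

Definition replacement (C : cls) : Prop :=
  forall (p : form) (env : nat -> N), (forall n, C (env n)) ->
  forall a, C a ->
  (forall x, C x -> x ∈ a ->
     exists y, C y /\ sat C (scons y (scons x env)) p /\
       forall y', C y' -> sat C (scons y' (scons x env)) p -> y' = y) ->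
  exists b, C b /\
    forall x, C x -> x ∈ a ->
    exists y, C y /\ y ∈ b /\ sat C (scons y (scons x env)) p.

Definition ZFC (C : cls) : Prop :=
  extensionality C /\ foundation C /\ pairing C /\ union C /\ powerset C /\
  infinity C /\ choice C /\ separation C /\ replacement C.

Definition transitive_class (C : cls) : Prop :=
  forall x y, C x -> y ∈ x -> C y.

(** ** Basic notions *)

Definition subset (x y : N) : Prop := forall z, z ∈ x -> z ∈ y.

(** [x] is the set [{z | Q z}]. *)
Definition is_setof (x : N) (Q : N -> Prop) : Prop := forall z, z ∈ x <-> Q z.

Definition is_empty (x : N) : Prop := forall z, ~ z ∈ x.

Definition is_upair (p a b : N) : Prop := is_setof p (fun z => z = a \/ z = b).

Definition is_opair (p a b : N) : Prop :=
  is_setof p (fun z => is_upair z a a \/ is_upair z a b).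

Definition app (f x y : N) : Prop := exists p, p ∈ f /\ is_opair p x y.

Definition is_fun (f d : N) : Prop :=
  (forall p, p ∈ f -> exists x y, x ∈ d /\ is_opair p x y) /\
  (forall x, x ∈ d -> exists y, app f x y) /\
  (forall x y y', app f x y -> app f x y' -> y = y').

(** [f] is a function from [d] to the class [Q]. *)
Definition is_map (f d : N) (Q : N -> Prop) : Prop :=
  is_fun f d /\ forall x y, app f x y -> Q y.

Definition is_transitive (x : N) : Prop := forall y, y ∈ x -> subset y x.

Definition is_ord (x : N) : Prop :=
  is_transitive x /\ forall y, y ∈ x -> is_transitive y.

Definition is_succ (b a : N) : Prop := is_setof b (fun z => z ∈ a \/ z = a).

Definition is_limit (a : N) : Prop :=
  is_ord a /\ (exists x, x ∈ a) /\ forall x, x ∈ a -> exists y, y ∈ a /\ x ∈ y.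

Definition is_omega (w : N) : Prop :=
  is_limit w /\ forall x, x ∈ w -> ~ is_limit x.

Definition uncountable_ord (a : N) : Prop :=
  is_ord a /\ exists w, is_omega w /\ w ∈ a.

(** [c] is the ordinal sum [a + b]: [h] is the map [x |-> a + x] on [b], and
    [a + x = a ∪ {a + y | y < x}]. *)
Definition is_ord_sum (a b c : N) : Prop :=
  exists h, is_fun h b /\
    (forall x s, app h x s ->
       is_setof s (fun z => z ∈ a \/ exists y, y ∈ x /\ app h y z)) /\
    is_setof c (fun z => z ∈ a \/ exists y, y ∈ b /\ app h y z).

(** Strongly inaccessible, in the sense of [C]. *)
Definition inaccessible (C : cls) (a : N) : Prop :=
  uncountable_ord a /\
  (forall b f, b ∈ a -> C f -> is_map f b (fun y => y ∈ a) ->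
     exists c, c ∈ a /\ forall x y, app f x y -> y ∈ c) /\
  (forall b, b ∈ a ->
     ~ exists f, C f /\ is_map f a (fun y => subset y b) /\
         forall x x' y, app f x y -> app f x' y -> x = x').

(** ** Ultrafilters and measures *)

(** The set [{z | Q z}] belongs to [D]. *)
Definition large (D : N) (Q : N -> Prop) : Prop :=
  exists A, A ∈ D /\ is_setof A Q.

(** [D] is, in [C], an ultrafilter (possibly principal) on the set [d]. *)
Definition ultrafilter (C : cls) (d D : N) : Prop :=
  C D /\
  (forall X, X ∈ D -> subset X d) /\
  d ∈ D /\
  (forall X, X ∈ D -> ~ is_empty X) /\
  (forall X Y, X ∈ D -> C Y -> subset X Y -> subset Y d -> Y ∈ D) /\
  (forall X Y, X ∈ D -> Y ∈ D -> large D (fun x => x ∈ X /\ x ∈ Y)) /\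
  (forall X, C X -> subset X d -> X ∈ D \/ large D (fun x => x ∈ d /\ ~ x ∈ X)).

(** [D] is closed under intersections of [g]-sequences in [C]. *)
Definition closed_under_seq (C : cls) (d D g : N) : Prop :=
  forall s, C s -> is_map s g (fun X => X ∈ D) ->
  large D (fun x => x ∈ d /\ forall i X, app s i X -> x ∈ X).

Definition sigma_complete (C : cls) (d D : N) : Prop :=
  forall w, is_omega w -> closed_under_seq C d D w.

Definition nonprincipal (D : N) : Prop := forall x, ~ large D (fun z => z = x).

(** Witnesses the measurability of [k], in [C]. *)
Definition measure (C : cls) (k D : N) : Prop :=
  ultrafilter C k D /\ nonprincipal D /\
  forall g, g ∈ k -> closed_under_seq C k D g.

Definition measurable (C : cls) (k : N) : Prop :=
  uncountable_ord k /\ exists D, measure C k D.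

Definition normal_measure (C : cls) (k D : N) : Prop :=
  uncountable_ord k /\ measure C k D /\
  forall s, C s -> is_map s k (fun X => X ∈ D) ->
  large D (fun x => x ∈ k /\ forall i X, i ∈ x -> app s i X -> x ∈ X).

Definition is_square (k k2 : N) : Prop :=
  is_setof k2 (fun p => exists a b, a ∈ k /\ b ∈ k /\ is_opair p a b).

(** [D2] is, in [N], the product measure of [D] with itself on [k2 = k × k]. *)
Definition is_product_measure (k2 D D2 : N) : Prop :=
  is_setof D2 (fun X =>
    subset X k2 /\
    large D (fun a =>
      large D (fun b => exists p, p ∈ X /\ is_opair p a b))).

(** ** The class L[U] *)

(** Definability over a structure [(A, ∈, U ∩ A)] is expressed through relations
    on [w]-sequences of elements of [A] ([w] being omega): the relations
    definable by first-order formulas without parameters are those in every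
    family that contains the atomic ones and is closed under complement,
    intersection and existential quantification of one coordinate. *)
Definition is_seq (C : cls) (w A s : N) : Prop :=
  C s /\ is_map s w (fun y => y ∈ A).

Definition agree_off (w i s s' : N) : Prop :=
  forall n y, n ∈ w -> n <> i -> (app s n y <-> app s' n y).

Definition definability_closed (C : cls) (U w A F : N) : Prop :=
  (forall i j R, i ∈ w -> j ∈ w -> C R ->
     is_setof R (fun s => is_seq C w A s /\
       exists a b, app s i a /\ app s j b /\ a ∈ b) -> R ∈ F) /\
  (forall i j R, i ∈ w -> j ∈ w -> C R ->
     is_setof R (fun s => is_seq C w A s /\
       exists a, app s i a /\ app s j a) -> R ∈ F) /\
  (forall i R, i ∈ w -> C R ->
     is_setof R (fun s => is_seq C w A s /\
       exists a, app s i a /\ a ∈ U) -> R ∈ F) /\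
  (forall R S, R ∈ F -> C S ->
     is_setof S (fun s => is_seq C w A s /\ ~ s ∈ R) -> S ∈ F) /\
  (forall R S T, R ∈ F -> S ∈ F -> C T ->
     is_setof T (fun s => s ∈ R /\ s ∈ S) -> T ∈ F) /\
  (forall i R S, i ∈ w -> R ∈ F -> C S ->
     is_setof S (fun s => is_seq C w A s /\
       exists s', s' ∈ R /\ agree_off w i s s') -> S ∈ F).

Definition definable_relation (C : cls) (U w A R : N) : Prop :=
  C R /\ forall F, C F -> definability_closed C U w A F -> R ∈ F.

(** [X] is a subset of [A] definable over [(A, ∈, U ∩ A)] with parameters from
    [A], the parameters being the coordinates of [s] other than the [i]-th.
    The empty set is listed separately because there is no sequence when [A] is
    empty. *)
Definition definable_subset (C : cls) (U A X : N) : Prop :=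
  C X /\ subset X A /\
  (is_empty X \/
   exists w R s i,
     is_omega w /\ definable_relation C U w A R /\ is_seq C w A s /\ i ∈ w /\
     forall a, a ∈ A ->
       (a ∈ X <-> exists s', s' ∈ R /\ agree_off w i s s' /\ app s' i a)).

(** [h] is, in [C], the sequence of the [L_b[U]] for [b < d]. *)
Definition L_hierarchy (C : cls) (U d h : N) : Prop :=
  is_ord d /\ C h /\ is_fun h d /\
  forall b Lb, app h b Lb ->
    (is_empty b -> is_empty Lb) /\
    (forall c Lc, is_succ b c -> app h c Lc ->
       is_setof Lb (definable_subset C U Lc)) /\
    (is_limit b ->
       is_setof Lb (fun y => exists c Lc, c ∈ b /\ app h c Lc /\ y ∈ Lc)).

Definition V_eq_L (C : cls) (U : N) : Prop :=
  forall x, C x ->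
  exists d h b Lb, L_hierarchy C U d h /\ app h b Lb /\ x ∈ Lb.

(** ** The Easton support product *)

Definition bounded_below (X a : N) : Prop :=
  exists b, b ∈ a /\ forall x, x ∈ X -> x ∈ a -> x ∈ b.

Definition easton_set (C : cls) (k X : N) : Prop :=
  subset X k /\
  forall l, (l ∈ k /\ inaccessible C l) \/ l = k -> bounded_below X l.

(** The element 0 (for [false]) or 1 (for [true]) of [2 = {0, 1}]. *)
Definition is_bit (i : bool) (y : N) : Prop :=
  if i then is_setof y is_empty else is_empty y.

Definition is_easton_product (C : cls) (k P : N) : Prop :=
  is_setof P (fun f => C f /\ exists X,
    easton_set C k X /\ (forall a, a ∈ X -> inaccessible C a) /\
    is_map f X (fun y => exists i, is_bit i y)).

(** For posets of functions ordered by reverse inclusion: [q] is stronger than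
    [p] when [subset p q]. *)
Definition dense (P D : N) : Prop :=
  subset D P /\ forall p, p ∈ P -> exists q, q ∈ D /\ subset p q.

Definition is_filter (P G : N) : Prop :=
  subset G P /\ ~ is_empty G /\
  (forall p q, p ∈ P -> q ∈ G -> subset p q -> p ∈ G) /\
  (forall p q, p ∈ G -> q ∈ G ->
     exists r, r ∈ G /\ subset p r /\ subset q r).

Definition generic (C : cls) (P G : N) : Prop :=
  is_filter P G /\
  forall D, C D -> dense P D -> exists p, p ∈ D /\ p ∈ G.

(** [x] is the value of the name [t]:
    [val t = {val r | (r, p) ∈ t for some p ∈ G}].  The function [h] is the
    restriction of [val] to a set [d] of names closed under subnames.  Elements
    of [t] that are not of the form [(r, p)] with [p ∈ G] are ignored, hence
    every set can serve as a name. *)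
Definition name_value (G t x : N) : Prop :=
  exists d h, is_fun h d /\
    (forall s r p q, s ∈ d -> q ∈ s -> is_opair q r p -> r ∈ d) /\
    (forall s y, app h s y ->
       is_setof y (fun z => exists r p q,
         p ∈ G /\ is_opair q r p /\ q ∈ s /\ app h r z)) /\
    app h t x.

(** The class [C[G]]. *)
Definition extension (C : cls) (G : N) : cls :=
  fun x => exists t, C t /\ name_value G t x.

(** ** Ultrapowers *)

(** Membership and equality modulo [D] of functions on [d]. *)
Definition ult_mem (d D f g : N) : Prop :=
  large D (fun i => i ∈ d /\ exists a b, app f i a /\ app g i b /\ a ∈ b).

Definition ult_eq (d D f g : N) : Prop :=
  large D (fun i => i ∈ d /\ exists a, app f i a /\ app g i a).

(** [y] is the element [[f]_D] of the transitive collapse of the ultrapower of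
    the class [C] by the ultrafilter [D] on [d].  The function [c] is the
    restriction of the collapsing map [g |-> [g]_D = {[h]_D | h ∈_D g}] to a set
    [F] of functions that is closed, modulo [D], under [∈_D]-predecessors. *)
Definition ult_value (C : cls) (d D f y : N) : Prop :=
  exists F c, C F /\ C c /\
    (forall g, g ∈ F -> is_fun g d) /\
    (forall g h, g ∈ F -> C h -> is_fun h d -> ult_mem d D h g ->
       exists h', h' ∈ F /\ ult_eq d D h h') /\
    is_fun c F /\
    (forall g z, app c g z ->
       is_setof z (fun t => exists h, h ∈ F /\ ult_mem d D h g /\ app c h t)) /\
    app c f y.

(** The transitive class isomorphic to the ultrapower. *)
Definition ult (C : cls) (d D : N) : cls :=
  fun y => exists f, C f /\ is_fun f d /\ ult_value C d D f y.

(** [y] is the image of [x] under the ultrapower embedding. *)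
Definition ult_embedding (C : cls) (d D x y : N) : Prop :=
  exists f, C f /\ is_map f d (fun z => z = x) /\ ult_value C d D f y.

(** ** The generics and measures of the extension *)

(** [Gs] is a set of conditions in [j(P)] all of whose coordinates are
    above [k]. *)
Definition on_tail (k jP Gs : N) : Prop :=
  forall f, f ∈ Gs -> f ∈ jP /\ forall x y, app f x y -> k ∈ x.

(** [g] is the restriction of [f] to the [x] satisfying [Q]. *)
Definition is_restriction (f : N) (Q : N -> Prop) (g : N) : Prop :=
  is_setof g (fun p => p ∈ f /\ exists x y, is_opair p x y /\ Q x).

(** [Hi = G × {i} × Gs], as a set of conditions of [j(P)].  On the one-coordinate
    poset, the filter given by [i] consists of the trivial condition and [i], so
    [k] may fail to be in the domain of a condition of [Hi]. *)
Definition is_product_filter (k jP G : N) (i : bool) (Gs Hi : N) : Prop :=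
  is_setof Hi (fun f => f ∈ jP /\
    (exists g, is_restriction f (fun x => x ∈ k) g /\ g ∈ G) /\
    (forall y, app f k y -> is_bit i y) /\
    (exists g, is_restriction f (fun x => k ∈ x) g /\ g ∈ Gs)).

(** ** The Ketonen and Lipschitz orders, in [N] *)

(** [U] is on the ordinal [k].  An ultrafilter on an ordinal concentrates on [x]
    when [x] belongs to it. *)
Definition ketonen (k U W : N) : Prop :=
  exists J S, J ∈ W /\ is_fun S J /\
    (forall x D, app S x D ->
       exists d, is_ord d /\ ultrafilter univ d D /\ sigma_complete univ d D /\
         x ∈ D) /\
    forall X, subset X k ->
      (X ∈ U <->
       large W (fun x => x ∈ J /\ exists D, app S x D /\
         large D (fun z => z ∈ X /\ z ∈ x))).

Definition super_lipschitz (k f : N) : Prop :=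
  (exists Pk, is_setof Pk (fun A => subset A k) /\
     is_map f Pk (fun B => subset B k)) /\
  forall x A A' B B', x ∈ k -> subset A k ->
    is_setof A' (fun z => z ∈ A /\ z ∈ x) ->
    app f A B -> app f A' B' ->
    forall z, z ∈ x \/ z = x -> (z ∈ B <-> z ∈ B').

Definition lipschitz (k U W : N) : Prop :=
  exists f, super_lipschitz k f /\
    forall A B, subset A k -> app f A B -> (A ∈ U <-> B ∈ W).

End SetTheory.

(* Main.v *)
(** Write U_i for [meas i] and "for U_i-almost all" as a quantifier, and let
    G^(a) be G with its value at the coordinate a replaced by 0.

    The seed j_U(κ) + κ is represented by (a, b) ↦ b + a, so X ∈ W iff for
    U_1-almost all a, for U_1-almost all b, b + a ∈ X.  A set X ⊆ κ of V[G] has a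
    nice name t ⊆ κ × P in V.  Since a ↦ G^(a) represents H_0 in the ultrapower
    by U_1, and j_{U_0}, j_{U_1} agree on V, X ∈ U_0 iff
    κ ∈ j_U(t) evaluated by H_0 iff for U_1-almost all a, a ∈ t evaluated by
    G^(a).  For U_1-almost all b, this can be read off a name chosen for X ∩ b:
    a sequence of names in V, of length κ, coheres U_1-almost everywhere with its
    U_1-limit, and this limit is in V because it is the trace on κ × P of an
    element of j_U(V).  Hence the super-Lipschitz map that puts b + a in f(X) when a
    belongs to the chosen name of X ∩ b evaluated by G^(a) reduces U_0 to W.

    No ultrafilter reduces to itself by a super-Lipschitz map h: the set Z with
    x ∈ Z iff x ∉ h(Z) exists by recursion.  As W <_k U_0 gives a super-Lipschitz
    reduction of W to U_0, composition refutes it.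

    If U_0 <_k W, then U_0 is an iterated U_1-limit of ultrafilters D_{b + a}.
    Normality and a diagonal intersection leave two cases.  Either
    U_0 = U_1, which is impossible because G(a) = i for U_i-almost all a; or U_0
    is in the ultrapower by U_1.  That ultrapower is M_U[H_1] = M_U[H_0], so U_0
    is in its own ultrapower, and X ↦ {b | X ∩ b ∈ E_b} is a self-reduction. *)

From Stdlib Require Import Classical ClassicalEpsilon ssreflect PeanoNat.
Require Import Defs.

Set Implicit Arguments.
Unset Strict Implicit.
Set SsrOldRewriteGoalsOrder.
Set Bullet Behavior "None".

(** The model is arbitrary, so induction, separation and choice are available only for predicates
    defined by a formula with parameters; the side conditions [dfn] and [dtm] carry this through the
    whole proof. Łoś's theorem is not stated for formulas: membership, equality, pairs and
    application are transferred, and quantifiers are handled by choosing witnesses. This suffices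
    for the Lipschitz reduction because of nice names: that [a] belongs to the value of such a name
    only says that some [p] in the filter has the pair of [a] and [p] in the name.

    The sum b + a serves both halves of the theorem. It lies at or above b, so a super-Lipschitz map
    may consult X ∩ b when deciding b + a; the offset a < b tells it which coordinate to change, and
    for additively closed b the pair can be recovered from the sum. On the other hand no additively
    closed ordinal lies strictly between b and b + a, so an ultrafilter concentrating on b + a gains
    nothing beyond b that would help the Ketonen order. *)

Structure zfc_model : Type := ZfcModel {
  carrier :> Type;
  carrier_mem :: Membership carrier;
  zfc_axioms : ZFC (N := carrier) univ }.

(** * Definability *)

Section Definability.

Context {N : Type} {HN : Membership N}.

Lemma sat_ext (C : N -> Prop) p : forall e e' : nat -> N,
  (forall n, e n = e' n) -> sat C e p <-> sat C e' p.
Proof.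
elim: p => [i j|i j||p IHp q IHq|p IHp] e e' ee /=.
- by rewrite !ee.
- by rewrite !ee.
- by [].
- by rewrite (IHp e e') // (IHq e e').
- split => h x Cx; move: (h x Cx).
    by apply (IHp (scons x e) (scons x e')) => -[|n] /=.
  by apply (IHp (scons x e) (scons x e')) => -[|n] /=.
Qed.

Fixpoint rename (r : nat -> nat) (p : form) : form :=
  match p with
  | FEq i j => FEq (r i) (r j)
  | FMem i j => FMem (r i) (r j)
  | FBot => FBot
  | FImp p q => FImp (rename r p) (rename r q)
  | FAll p => FAll (rename (fun n => match n with O => O | S m => S (r m) end) p)
  end.

Lemma sat_rename (C : N -> Prop) p : forall r e,
  sat C e (rename r p) <-> sat C (fun n => e (r n)) p.
Proof.
elim: p => [i j|i j||p IHp q IHq|p IHp] r e //=.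
  by rewrite IHp IHq.
split => h x Cx; move: (h x Cx); rewrite IHp;
  apply sat_ext => -[|n] //=.
Qed.

(** A free index of a formula stands for a variable ([inl]) or a parameter ([inr]). Keeping
    parameters in a separate assignment lets predicates be combined without shifting them. *)
Definition look (e : nat -> N) (s : nat + N) : N :=
  match s with inl m => e m | inr x => x end.

(** [Q] is first-order definable with parameters; its bound variables are
    [e 0], [e 1], ... *)
Definition dfn (Q : (nat -> N) -> Prop) : Prop :=
  exists p s, forall e, sat univ (fun n => look e (s n)) p <-> Q e.

Definition dtm (t : (nat -> N) -> N) : Prop :=
  dfn (fun e => e 0 = t (fun n => e (S n))).

Lemma dfn_ext (Q Q' : (nat -> N) -> Prop) :
  (forall e, Q e <-> Q' e) -> dfn Q -> dfn Q'.
Proof. by move=> QQ [p [s h]]; exists p, s => e; rewrite h QQ. Qed.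

(** By excluded middle, a statement that ignores the environment is equivalent to a true or a false
    formula, whatever it mentions. *)
Lemma dfn_prop (P : Prop) : dfn (fun _ => P).
Proof.
case: (classic P) => hP.
  by exists (FImp FBot FBot), (fun n => inl n) => e /=; split.
by exists FBot, (fun n => inl n) => e /=; split.
Qed.

Lemma dfn_subvar (r : nat -> nat) (Q : (nat -> N) -> Prop) :
  dfn Q -> dfn (fun e => Q (fun n => e (r n))).
Proof.
move=> [p [s h]].
exists p, (fun n => match s n with inl m => inl (r m) | inr x => inr x end) => e.
rewrite -h; apply sat_ext => n; by case: (s n).
Qed.

Lemma dfn_imp (Q R : (nat -> N) -> Prop) :
  dfn Q -> dfn R -> dfn (fun e => Q e -> R e).
Proof.
move=> [p [s hp]] [q [t hq]].
(* The two formulas come with independent assignments of their indices; sending one to the even and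
   the other to the odd indices merges them. *)
exists (FImp (rename (fun n => 2 * n) p) (rename (fun n => S (2 * n)) q)),
  (fun n => if Nat.even n then s (Nat.div2 n) else t (Nat.div2 n)) => e.
cbn [sat]; rewrite !sat_rename -hp -hq.
have e1 : forall n, look e (if Nat.even (2 * n) then s (Nat.div2 (2 * n)) else t (Nat.div2 (2 * n))) = look e (s n).
  by move=> n; rewrite Nat.even_even Nat.div2_even.
have e2 : forall n, look e (if Nat.even (S (2 * n)) then s (Nat.div2 (S (2 * n))) else t (Nat.div2 (S (2 * n)))) = look e (t n).
  by move=> n; rewrite -Nat.add_1_r Nat.even_odd Nat.div2_odd'.
by rewrite (sat_ext _ _ e1) (sat_ext _ _ e2).
Qed.

Lemma dfn_all (Q : (nat -> N) -> N -> Prop) :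
  dfn (fun e => Q (fun n => e (S n)) (e 0)) -> dfn (fun e => forall x, Q e x).
Proof.
move=> [p [s h]].
(* Every index assigned to variable 0 becomes the quantified index; the others are shifted and stay
   free. *)
exists (FAll (rename (fun n => match s n with inl 0 => 0 | _ => S n end) p)),
  (fun n => match s n with inl 0 => inl 0 | inl (S m) => inl m | inr x => inr x end) => e.
have key x : sat univ
    (scons x (fun n => look e (match s n with inl 0 => inl 0 | inl (S m) => inl m | inr x => inr x end)))
    (rename (fun n => match s n with inl 0 => 0 | _ => S n end) p) <-> Q e x.
  rewrite sat_rename -(h (scons x e)); apply sat_ext => n.
  by case E: (s n) => [[|m]|y] //=; rewrite E.
cbn [sat]; split => hh x; [apply/key/hh|move=> _; apply/key/hh] => //.
Qed.

Lemma dfn_not Q : dfn Q -> dfn (fun e => ~ Q e).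
Proof. move=> h; apply: (dfn_imp h); exact: dfn_prop. Qed.

Lemma dfn_or Q R : dfn Q -> dfn R -> dfn (fun e => Q e \/ R e).
Proof.
move=> h k; apply: (@dfn_ext (fun e => ~ Q e -> R e)); last by apply: dfn_imp => //; exact: dfn_not.
move=> e; case: (classic (Q e)); tauto.
Qed.

Lemma dfn_and Q R : dfn Q -> dfn R -> dfn (fun e => Q e /\ R e).
Proof.
move=> h k; apply: (@dfn_ext (fun e => ~ (Q e -> ~ R e))).
  by move=> e; case: (classic (Q e)); case: (classic (R e)); tauto.
by apply: dfn_not; apply: dfn_imp => //; exact: dfn_not.
Qed.

Lemma dfn_iff Q R : dfn Q -> dfn R -> dfn (fun e => Q e <-> R e).
Proof. move=> h k; apply: dfn_and; exact: dfn_imp. Qed.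

Lemma dfn_ex (Q : (nat -> N) -> N -> Prop) :
  dfn (fun e => Q (fun n => e (S n)) (e 0)) -> dfn (fun e => exists x, Q e x).
Proof.
move=> h; apply: (@dfn_ext (fun e => ~ forall x, ~ Q e x)).
  move=> e; split; first by move/not_all_not_ex.
  by move=> [x Qx] /(_ x).
apply: dfn_not; apply: dfn_all; exact: dfn_not.
Qed.

Lemma dtm_var n : dtm (fun e => e n).
Proof. by exists (FEq 0 1), (fun k => match k with 0 => inl 0 | _ => inl (S n) end). Qed.

Lemma dtm_const (x : N) : dtm (fun _ => x).
Proof. by exists (FEq 0 1), (fun k => match k with 0 => inl 0 | _ => inr x end). Qed.

Lemma dfn_subst (Q : (nat -> N) -> N -> Prop) t :
  dfn (fun e => Q (fun n => e (S n)) (e 0)) -> dtm t -> dfn (fun e => Q e (t e)).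
Proof.
move=> h k; apply: (@dfn_ext (fun e => exists x, x = t e /\ Q e x)).
  move=> e; split; first by move=> [x [-> ]].
  by move=> hQ; exists (t e).
by apply: dfn_ex; apply: dfn_and.
Qed.

Lemma dtm_subvar (r : nat -> nat) t : dtm t -> dtm (fun e => t (fun n => e (r n))).
Proof.
move=> h.
exact: (dfn_subvar (fun n => match n with 0 => 0 | S m => S (r m) end) h).
Qed.

Lemma dfn_rel2 (R : N -> N -> Prop) t u :
  dfn (fun e => R (e 0) (e 1)) -> dtm t -> dtm u -> dfn (fun e => R (t e) (u e)).
Proof.
move=> hR ht hu.
apply: (@dfn_subst (fun e x => R x (u e))) => //.
apply: (@dfn_subst (fun e y => R (e 0) y)).
  apply: (dfn_subvar (fun n => match n with 0 => 1 | _ => 0 end) hR).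
exact: (dtm_subvar S hu).
Qed.

Lemma dfn_rel1 (R : N -> Prop) t :
  dfn (fun e => R (e 0)) -> dtm t -> dfn (fun e => R (t e)).
Proof. by move=> hR ht; apply: (@dfn_subst (fun e x => R x)). Qed.

Lemma dtm_fun1 (F : N -> N) t :
  dtm (fun e => F (e 0)) -> dtm t -> dtm (fun e => F (t e)).
Proof.
move=> hF ht; apply: (@dfn_rel2 (fun x y => x = F y) (fun e => e 0) (fun e => t (fun n => e (S n)))) => //.
  exact: dtm_var.
exact: (dtm_subvar S ht).
Qed.

Lemma dtm_fun2 (F : N -> N -> N) t u :
  dtm (fun e => F (e 0) (e 1)) -> dtm t -> dtm u -> dtm (fun e => F (t e) (u e)).
Proof.
move=> hF ht hu.
apply: (@dfn_subst (fun e x => e 0 = F x (u (fun n => e (S n))))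
  (fun e => t (fun n => e (S n)))); last exact: (dtm_subvar S ht).
apply: (@dfn_subst (fun e x => e 1 = F (e 0) x)
  (fun e => u (fun n => e (S (S n))))); last exact: (dtm_subvar (fun n => S (S n)) hu).
exact: (dfn_subvar (fun n => match n with 0 => 2 | 1 => 1 | _ => 0 end) hF).
Qed.

Lemma dfn_mem t u : dtm t -> dtm u -> dfn (fun e => t e ∈ u e).
Proof.
move=> ht hu; apply: (dfn_rel2 (R := fun x y => x ∈ y)) => //.
by exists (FMem 0 1), (fun n => inl n).
Qed.

Lemma dfn_eq t u : dtm t -> dtm u -> dfn (fun e => t e = u e).
Proof.
move=> ht hu; apply: (dfn_rel2 (R := fun x y => x = y)) => //.
by exists (FEq 0 1), (fun n => inl n).
Qed.

(** The outer variables become parameters. Separation needs this form for a predicate that was shown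
    definable under a binder. *)
Lemma dfn_fix (Q : (nat -> N) -> N -> Prop) (a : nat -> N) :
  dfn (fun e => Q (fun n => e (S n)) (e 0)) -> dfn (fun e => Q a (e 0)).
Proof.
move=> [p [s h]].
exists p, (fun n => match s n with
  | inl 0 => inl 0 | inl (S m) => inr (a m) | inr x => inr x end) => e.
rewrite -(h (scons (e 0) a)); apply sat_ext => n.
by case: (s n) => [[|m]|x].
Qed.

Lemma dfn_fix2 (Q : (nat -> N) -> N -> N -> Prop) (a : nat -> N) :
  dfn (fun e => Q (fun n => e (S (S n))) (e 1) (e 0)) ->
  dfn (fun e => Q a (e 1) (e 0)).
Proof.
move=> [p [s h]].
exists p, (fun n => match s n with
  | inl 0 => inl 0 | inl 1 => inl 1 | inl (S (S m)) => inr (a m) | inr x => inr x end) => e.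
rewrite -(h (scons (e 0) (scons (e 1) a))); apply sat_ext => n.
by case: (s n) => [[|[|m]]|x].
Qed.

Lemma dfn_form (Q : N -> N -> Prop) (n0 : N) : dfn (fun e => Q (e 0) (e 1)) ->
  exists p env, forall x y, sat univ (scons y (scons x env)) p <-> Q y x.
Proof.
move=> [p [s h]].
exists (rename (fun n => match s n with inl 0 => 0 | inl 1 => 1 | _ => S (S n) end) p),
  (fun n => match s n with inl _ => n0 | inr z => z end) => x y.
rewrite sat_rename -(h (scons y (scons x (fun _ => n0)))); apply sat_ext => n.
by case E: (s n) => [[|[|m]]|z] //=; rewrite E.
Qed.

End Definability.

(** Extension points, redefined each time a new term or predicate former has been shown definable,
    so that [dfn_tac] follows. *)
Ltac dtm_lemma := fail.
Ltac dfn_lemma := fail.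

Ltac dfn_unfold := cbv beta delta [is_map is_fun is_seq is_omega is_limit is_succ
  is_ord is_transitive is_ord_sum uncountable_ord large ult_mem ult_eq ult_value
  ult_embedding name_value ultrafilter closed_under_seq inaccessible app is_opair is_upair
  is_empty subset is_setof univ sigma_complete nonprincipal is_bit is_restriction
  bounded_below].

Ltac dfn_step :=
  cbv beta;
  lazymatch goal with
  | |- dtm _ => first [ exact: dtm_var | exact: dtm_const | dtm_lemma ]
  | |- dfn (fun e => _ /\ _) => apply: dfn_and
  | |- dfn (fun e => _ \/ _) => apply: dfn_or
  | |- dfn (fun e => ~ _) => apply: dfn_not
  | |- dfn (fun e => _ <-> _) => apply: dfn_iff
  | |- dfn (fun e => _ ∈ _) => apply: dfn_mem
  | |- dfn (fun e => _ = _) => apply: dfn_eq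
  | |- dfn (fun e => exists x, _) => apply: dfn_ex
  | |- dfn (fun e => _ -> _) => first [exact: dfn_prop | apply: dfn_imp | apply: dfn_all]
  | |- dfn (fun e => forall x, _) => apply: dfn_all
  | |- dfn _ => first [ exact: dfn_prop | dfn_lemma ]
  end.

Ltac dfn_tac := dfn_unfold; repeat dfn_step; cbv beta; try done.

(** * Sets and functions *)

Section Sets.

Context {N : zfc_model}.

Implicit Types a b c d f g h k p q r s v w x y z A B D G S T X Y Z : N.

Lemma set_ext (x y : N) : (forall z, z ∈ x <-> z ∈ y) -> x = y.
Proof. move=> h; case: (zfc_axioms N) => E _; apply: E => // z _; exact: h. Qed.

Lemma foundation_ex (x : N) : (exists y, y ∈ x) ->
  exists y, y ∈ x /\ forall z, z ∈ x -> ~ z ∈ y.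
Proof.
move=> [y yx]; case: (zfc_axioms N) => _ [F _].
have [|z [_ [zx h]]] := F x I; first by exists y.
by exists z; split=> // t tx tz; apply: h; exists t.
Qed.

Lemma set_inh : inhabited N.
Proof. by case: (zfc_axioms N) => _ [_ [_ [_ [_ [[w _] _]]]]]. Qed.

(** A total set former, so that sets can be written as terms. When no such set exists the value is
    arbitrary. *)
Definition setof (Q : N -> Prop) : N := epsilon set_inh (fun b => is_setof b Q).

Lemma setof_spec Q : (exists b, is_setof b Q) -> is_setof (setof Q) Q.
Proof. exact: epsilon_spec. Qed.

Lemma is_setof_setof Q b : is_setof b Q -> b = setof Q.
Proof.
move=> h; apply: set_ext => z.
by rewrite (h z) (@setof_spec Q (ex_intro _ b h) z).
Qed.

Lemma setof_sub Q a : dfn (fun e => Q (e 0)) -> (forall x, Q x -> x ∈ a) ->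
  is_setof (setof Q) Q.
Proof.
move=> dQ Qa; apply: setof_spec.
have [p [env h]] : exists (p : form) env, forall x y, sat univ (scons y (scons x env)) p <-> Q y.
  by apply: (@dfn_form _ _ (fun y x => Q y) a).
case: (zfc_axioms N) => _ [_ [_ [_ [_ [_ [_ [S _]]]]]]].
have [|b [_ hb]] := S p (scons a env) _ a I; first by [].
exists b => z; rewrite (hb z I) h; split; [tauto|by move=> Qz; split=> //; exact: Qa].
Qed.

(** Existence is required at every environment: where it fails, [setof] is a value picked outside
    the model, which no formula need describe. *)
Lemma dtm_setof (Q : (nat -> N) -> N -> Prop) :
  (forall e, is_setof (setof (Q e)) (Q e)) ->
  dfn (fun e => Q (fun n => e (S n)) (e 0)) -> dtm (fun e => setof (Q e)).
Proof.
move=> h hQ; apply: (@dfn_ext _ _ (fun e => forall z, z ∈ e 0 <-> Q (fun n => e (S n)) z)).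
  move=> e; split; first by move=> hz; apply: is_setof_setof.
  by move=> -> z; exact: h.
apply: dfn_all; apply: dfn_iff; first by dfn_tac.
exact: (dfn_subvar (fun n => match n with 0 => 0 | S m => S (S m) end) hQ).
Qed.

Definition sep (a : N) (Q : N -> Prop) : N := setof (fun x => x ∈ a /\ Q x).

Lemma sepP a Q : dfn (fun e => Q (e 0)) -> forall x, x ∈ sep a Q <-> x ∈ a /\ Q x.
Proof.
move=> dQ; apply: (@setof_sub (fun x => x ∈ a /\ Q x) a); last by move=> x [].
by dfn_tac.
Qed.

Lemma dtm_sep (a : (nat -> N) -> N) (Q : (nat -> N) -> N -> Prop) :
  dtm a -> dfn (fun e => Q (fun n => e (S n)) (e 0)) -> dtm (fun e => sep (a e) (Q e)).
Proof.
move=> ha hQ; apply: dtm_setof.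
  by move=> e; apply: sepP; apply: (dfn_fix (Q := Q)).
by apply: dfn_and => //; apply: dfn_mem; [exact: dtm_var|exact: (dtm_subvar S ha)].
Qed.

Definition emp : N := setof (fun _ => False).
Definition up (a b : N) : N := setof (fun z => z = a \/ z = b).
Definition Un (x : N) : N := setof (fun z => exists y, y ∈ x /\ z ∈ y).
Definition pw (x : N) : N := setof (fun z => subset z x).

Lemma empP z : z ∈ emp <-> False.
Proof.
have [a] := set_inh.
have h := @setof_sub (fun _ => False) a (dfn_prop _) (fun x (f : False) => match f with end).
by exact: (h z).
Qed.

Lemma upP a b z : z ∈ up a b <-> z = a \/ z = b.
Proof.
case: (zfc_axioms N) => _ [_ [P _]]; have [c [_ [ac bc]]] := P a b I I.
apply: (@setof_sub (fun z => z = a \/ z = b) c); first by dfn_tac.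
by move=> x [->|->].
Qed.

Lemma UnP x z : z ∈ Un x <-> exists y, y ∈ x /\ z ∈ y.
Proof.
case: (zfc_axioms N) => _ [_ [_ [U _]]]; have [c [_ hc]] := U x I.
apply: (@setof_sub (fun z => exists y, y ∈ x /\ z ∈ y) c); first by dfn_tac.
by move=> y [t [tx yt]]; apply: (hc t y).
Qed.

Lemma pwP x z : z ∈ pw x <-> subset z x.
Proof.
case: (zfc_axioms N) => _ [_ [_ [_ [P _]]]]; have [c [_ hc]] := P x I.
apply: (@setof_sub (fun z => subset z x) c); first by dfn_tac.
by move=> y yx; apply: hc => // t _; exact: yx.
Qed.

Lemma dtm_up (a b : (nat -> N) -> N) : dtm a -> dtm b -> dtm (fun e => up (a e) (b e)).
Proof.
move=> ha hb; apply: (@dtm_setof (fun e z => z = a e \/ z = b e)).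
  by move=> e z; rewrite -/(up _ _) upP.
apply: dfn_or; apply: dfn_eq; try exact: dtm_var;
  [exact: (dtm_subvar S ha)|exact: (dtm_subvar S hb)].
Qed.

Lemma dtm_Un (a : (nat -> N) -> N) : dtm a -> dtm (fun e => Un (a e)).
Proof.
move=> ha; apply: (dtm_fun1 (F := Un)) => //.
apply: (@dtm_setof (fun e z => exists y, y ∈ e 0 /\ z ∈ y)); last by dfn_tac.
move=> e z; exact: UnP.
Qed.

Lemma dtm_pw (a : (nat -> N) -> N) : dtm a -> dtm (fun e => pw (a e)).
Proof.
move=> ha; apply: (dtm_fun1 (F := pw)) => //.
apply: (@dtm_setof (fun e z => subset z (e 0))); last by dfn_tac.
move=> e z; exact: pwP.
Qed.

Definition sg a := up a a.
Definition op a b := up (sg a) (up a b).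
Definition cup a b := Un (up a b).

Lemma sgP a z : z ∈ sg a <-> z = a.
Proof. rewrite upP; tauto. Qed.

Lemma cupP a b z : z ∈ cup a b <-> z ∈ a \/ z ∈ b.
Proof.
rewrite UnP; split.
  by move=> [y [/upP[->|->]]]; [left|right].
by case=> h; [exists a|exists b]; split=> //; apply/upP; [left|right].
Qed.

Lemma is_upair_up p a b : is_upair p a b <-> p = up a b.
Proof.
split; last by move=> -> z; exact: upP.
by move=> h; apply: set_ext => z; rewrite upP (h z).
Qed.

Lemma is_opair_op p a b : is_opair p a b <-> p = op a b.
Proof.
split.
  by move=> h; apply: set_ext => z; rewrite upP (h z) !is_upair_up.
by move=> -> z; rewrite upP !is_upair_up.
Qed.

Lemma up_inj a b c d : up a b = up c d -> (a = c /\ b = d) \/ (a = d /\ b = c).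
Proof.
move=> h.
have := upP c d a; have := upP c d b; have := upP a b c; have := upP a b d.
rewrite h !upP => h1 h2 h3 h4.
have {}h1 : d = a \/ d = b by tauto.
have {}h2 : c = a \/ c = b by tauto.
have {}h3 : b = c \/ b = d by rewrite -(upP c d) -h upP; tauto.
have {}h4 : a = c \/ a = d by rewrite -(upP c d) -h upP; tauto.
by case: h1 h2 h3 h4 => ?; case=> ?; case=> ?; case=> ?; subst; auto.
Qed.

Lemma op_inj a b c d : op a b = op c d <-> a = c /\ b = d.
Proof.
split; last by move=> [-> ->].
move=> /up_inj [[/up_inj h1 /up_inj h2]|[/up_inj h1 /up_inj h2]];
  intuition (subst; auto).
Qed.

Lemma dtm_op (a b : (nat -> N) -> N) : dtm a -> dtm b -> dtm (fun e => op (a e) (b e)).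
Proof. by move=> ha hb; repeat apply: dtm_up. Qed.

Lemma dtm_cup (a b : (nat -> N) -> N) : dtm a -> dtm b -> dtm (fun e => cup (a e) (b e)).
Proof. by move=> ha hb; apply: dtm_Un; apply: dtm_up. Qed.

Lemma app_op f x y : app f x y <-> op x y ∈ f.
Proof.
split; first by move=> [p [pf /is_opair_op <-]].
by move=> h; exists (op x y); split=> //; apply/is_opair_op.
Qed.

Lemma dfn_app (f x y : (nat -> N) -> N) : dtm f -> dtm x -> dtm y -> dfn (fun e => app (f e) (x e) (y e)).
Proof.
move=> hf hx hy; apply: (@dfn_ext _ _ (fun e => op (x e) (y e) ∈ f e)).
  by move=> e; rewrite app_op.
by apply: dfn_mem => //; exact: dtm_op.
Qed.

Lemma op_mem_Un f x y : op x y ∈ f -> x ∈ Un (Un f) /\ y ∈ Un (Un f).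
Proof.
move=> h.
have h2 : up x y ∈ Un f by apply/UnP; exists (op x y); rewrite !upP; auto.
by split; apply/UnP; exists (up x y); rewrite !upP; auto.
Qed.

(** Collecting the elements of the value, instead of choosing the value, makes application a
    definable total term; outside the domain it is empty. *)
Definition ap (f x : N) : N := setof (fun z => exists y, app f x y /\ z ∈ y).

Lemma apP0 f x z : z ∈ ap f x <-> exists y, app f x y /\ z ∈ y.
Proof.
apply: (@setof_sub (fun z => exists y, app f x y /\ z ∈ y) (Un (Un (Un f)))).
  apply: dfn_ex; apply: dfn_and; last by dfn_tac.
  by apply: dfn_app; try exact: dtm_var; exact: dtm_const.
by move=> y [t [/app_op/op_mem_Un[_ h] yt]]; apply/UnP; exists t.
Qed.

Lemma dtm_ap (f x : (nat -> N) -> N) : dtm f -> dtm x -> dtm (fun e => ap (f e) (x e)).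
Proof.
move=> hf hx; apply: (@dtm_setof (fun e z => exists y, app (f e) (x e) y /\ z ∈ y)).
  by move=> e z; exact: apP0.
apply: dfn_ex; apply: dfn_and; last by dfn_tac.
apply: dfn_app; last exact: dtm_var.
  exact: (dtm_subvar (fun n => S (S n)) hf).
exact: (dtm_subvar (fun n => S (S n)) hx).
Qed.

Lemma ap_app f d x y : is_fun f d -> app f x y -> ap f x = y.
Proof.
move=> [_ [_ hf]] h; apply: set_ext => z; rewrite apP0; split.
  by move=> [t [h' zt]]; rewrite (hf _ _ _ h h').
by exists y.
Qed.

Lemma app_ap f d x : is_fun f d -> x ∈ d -> app f x (ap f x).
Proof.
move=> h xd; have [y hy] := proj1 (proj2 h) x xd.
by rewrite (ap_app h hy).
Qed.

Lemma app_dom f d x y : is_fun f d -> app f x y -> x ∈ d.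
Proof.
move=> h [p [pf /is_opair_op e]]; have [x' [y' [x'd +]]] := proj1 h p pf; move/is_opair_op.
by rewrite e => /op_inj[-> _].
Qed.

Lemma appE f d x y : is_fun f d -> app f x y <-> x ∈ d /\ y = ap f x.
Proof.
move=> h; split; last by move=> [xd ->]; exact: (app_ap h xd).
by move=> a; split; [exact: (app_dom h a)|rewrite (ap_app h a)].
Qed.

Lemma fun_ext f g d : is_fun f d -> is_fun g d ->
  (forall x, x ∈ d -> ap f x = ap g x) -> f = g.
Proof.
have key f' g' : is_fun f' d -> is_fun g' d -> (forall x, x ∈ d -> ap f' x = ap g' x) ->
    forall p, p ∈ f' -> p ∈ g'.
  move=> hf hg e p pf; have [x [y [xd E]]] := proj1 hf p pf; move/is_opair_op: E => E.
  have a : app f' x y by apply/app_op; rewrite -E.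
  rewrite E -app_op; apply/(appE _ _ hg); split=> //.
  by rewrite -(e x xd) (ap_app hf a).
move=> hf hg e; apply: set_ext => p; split; apply: key => // x xd.
by rewrite e.
Qed.

Definition rep (d : N) (F : N -> N) : N := setof (fun y => exists x, x ∈ d /\ y = F x).

Lemma repP d F : dtm (fun e => F (e 0)) ->
  forall y, y ∈ rep d F <-> exists x, x ∈ d /\ y = F x.
Proof.
move=> hF.
have [p [env h]] : exists (p : form) env, forall x y, sat univ (scons y (scons x env)) p <-> y = F x.
  exact: (@dfn_form _ _ (fun y x => y = F x) d).
case: (zfc_axioms N) => _ [_ [_ [_ [_ [_ [_ [_ R]]]]]]].
have [//|x _ xd|b [_ hb]] := R p env _ d I.
  exists (F x); split=> //; split; first by apply/h.
  by move=> y' _ /h.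
apply: (@setof_sub (fun y => exists x, x ∈ d /\ y = F x) b).
  apply: dfn_ex; apply: dfn_and; first by dfn_tac.
  apply: dfn_eq; first exact: dtm_var.
  exact: (dtm_fun1 (F := F) hF (dtm_var 0)).
move=> y [x [xd ->]].
by have [y' [_ [y'b /h <-]]] := hb x I xd.
Qed.

Lemma dtm_rep (d : (nat -> N) -> N) (F : (nat -> N) -> N -> N) :
  dtm d -> dtm (fun e => F (fun n => e (S n)) (e 0)) -> dtm (fun e => rep (d e) (F e)).
Proof.
move=> hd hF; apply: (@dtm_setof (fun e y => exists x, x ∈ d e /\ y = F e x)).
  move=> e y; apply: repP.
  exact: (dfn_fix2 (Q := fun e x y => y = F e x) e hF).
apply: dfn_ex; apply: dfn_and.
  by apply: dfn_mem; [exact: dtm_var|exact: (dtm_subvar (fun n => S (S n)) hd)].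
apply: dfn_eq; first exact: dtm_var.
exact: (dtm_subvar (fun n => match n with 0 => 0 | S m => S (S m) end) hF).
Qed.

Definition fn (d : N) (F : N -> N) : N := rep d (fun x => op x (F x)).

Lemma dtm_fn (d : (nat -> N) -> N) (F : (nat -> N) -> N -> N) :
  dtm d -> dtm (fun e => F (fun n => e (S n)) (e 0)) -> dtm (fun e => fn (d e) (F e)).
Proof.
by move=> hd hF; apply: dtm_rep => //; apply: dtm_op => //; exact: dtm_var.
Qed.

Lemma fn_app d F : dtm (fun e => F (e 0)) -> forall x y,
  app (fn d F) x y <-> x ∈ d /\ y = F x.
Proof.
move=> hF x y; rewrite app_op repP; last first.
    by apply: (@dtm_op (fun e => e 0) (fun e => F (e 0))) => //; exact: dtm_var.
split; last by move=> [xd ->]; exists x.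
by move=> [z [zd /op_inj[-> ->]]].
Qed.

Lemma fn_fun d F : dtm (fun e => F (e 0)) -> is_fun (fn d F) d.
Proof.
move=> hF; split; [|split].
- move=> p; rewrite repP; last by apply: (@dtm_op (fun e => e 0) (fun e => F (e 0))) => //; exact: dtm_var.
  by move=> [x [xd ->]]; exists x, (F x); split=> //; apply/is_opair_op.
- by move=> x xd; exists (F x); apply/fn_app.
- by move=> x y y'; rewrite !fn_app // => -[_ ->] [_ ->].
Qed.

Lemma ap_fn d F x : dtm (fun e => F (e 0)) -> x ∈ d -> ap (fn d F) x = F x.
Proof.
move=> hF xd; apply: (ap_app (fn_fun d hF)); by apply/fn_app.
Qed.

Definition prod (a b : N) : N :=
  sep (pw (pw (cup a b))) (fun p => exists x y, x ∈ a /\ y ∈ b /\ p = op x y).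

Lemma prodP a b p : p ∈ prod a b <-> exists x y, x ∈ a /\ y ∈ b /\ p = op x y.
Proof.
rewrite sepP; last first.
  repeat dfn_step; apply: dtm_op; exact: dtm_var.
split; first by tauto.
move=> h; split=> //; move: h => [x [y [xa [yb ->]]]].
by apply/pwP => z /upP [] ->; apply/pwP => t /upP [] ->; apply/cupP; auto.
Qed.

Lemma op_prod a b x y : op x y ∈ prod a b <-> x ∈ a /\ y ∈ b.
Proof.
rewrite prodP; split; last by move=> [xa yb]; exists x, y.
by move=> [x' [y' [xa [yb /op_inj[-> ->]]]]].
Qed.

End Sets.

Ltac dtm_lemma ::= first [ apply: dtm_up | apply: dtm_Un | apply: dtm_pw
  | apply: dtm_op | apply: dtm_cup | apply: dtm_ap | apply: dtm_fn
  | apply: dtm_rep | apply: dtm_sep ].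
Ltac dfn_lemma ::= first [ apply: dfn_app ].
Arguments sepP {N a Q}.
Arguments repP {N d F}.
Arguments fn_app {N d F}.
Arguments fn_fun {N} d {F}.

(** * Recursion *)

Section Recursion.

Context {N : zfc_model}.

Implicit Types a b c d f g h k p q r s v w x y z A B D G S T X Y Z : N.

Lemma mem_irrefl (x : N) : ~ x ∈ x.
Proof.
move=> xx; have [|y [/sgP -> h]] := foundation_ex (x := sg x).
  by exists x; apply/sgP.
by apply: (h x) => //; apply/sgP.
Qed.

Lemma mem_asym (x y : N) : x ∈ y -> ~ y ∈ x.
Proof.
move=> xy yx; have [|z [/upP zz h]] := foundation_ex (x := up x y).
  by exists x; apply/upP; left.
by case: zz => ?; subst z; [apply: (h y)|apply: (h x)] => //; apply/upP; auto.
Qed.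

Section WfRec.

Variables (A : N) (lt : N -> N -> Prop) (Phi : N -> N -> N).
Hypothesis dlt : dfn (fun e => lt (e 0) (e 1)).
Hypothesis wf : forall S, subset S A -> (exists x, x ∈ S) ->
  exists x, x ∈ S /\ forall y, y ∈ S -> ~ lt y x.
Hypothesis dPhi : dtm (fun e => Phi (e 0) (e 1)).

Let below (x : N) := sep A (fun y => lt y x).
Let step (g x : N) := Phi x (fn (below x) (ap g)).
Let approx (g d : N) := subset d A /\ is_fun g d /\
  forall x, x ∈ d -> subset (below x) d /\ ap g x = step g x.

Let dlt2 (t u : (nat -> N) -> N) : dtm t -> dtm u -> dfn (fun e => lt (t e) (u e)).
Proof. exact: dfn_rel2. Qed.

Let dbelow (t : (nat -> N) -> N) : dtm t -> dtm (fun e => below (t e)).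
Proof.
move=> ht; apply: dtm_sep; first exact: dtm_const.
by apply: dlt2; [exact: dtm_var|exact: (dtm_subvar S ht)].
Qed.

Let belowP x y : y ∈ below x <-> y ∈ A /\ lt y x.
Proof. by apply: sepP; apply: dlt2; [exact: dtm_var|exact: dtm_const]. Qed.

Let dstep (t u : (nat -> N) -> N) : dtm t -> dtm u -> dtm (fun e => step (t e) (u e)).
Proof.
apply: dtm_fun2; apply: (dtm_fun2 dPhi (dtm_var 1)).
apply: dtm_fn; first by apply: dbelow; exact: dtm_var.
by apply: dtm_ap; exact: dtm_var.
Qed.

Let fn_ext d F F' : dtm (fun e => F (e 0)) -> dtm (fun e => F' (e 0)) ->
  (forall x, x ∈ d -> F x = F' x) -> fn d F = fn d F'.
Proof.
move=> h h' e; apply: (fun_ext (fn_fun d h) (fn_fun d h')) => x xd.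
by rewrite !ap_fn // e.
Qed.

Let step_ext g g' x : (forall y, y ∈ below x -> ap g y = ap g' y) -> step g x = step g' x.
Proof.
move=> h; rewrite /step; congr (Phi _ _); apply: fn_ext => //;
  by apply: dtm_ap; [exact: dtm_const|exact: dtm_var].
Qed.

Let approx_unique g d g' d' : approx g d -> approx g' d' ->
  forall x, x ∈ d -> x ∈ d' -> ap g x = ap g' x.
Proof.
move=> [dA [gf hg]] [d'A [g'f hg']] x xd xd'; apply: NNPP => ne.
have dS : dfn (fun e => e 0 ∈ d' /\ ap g (e 0) <> ap g' (e 0)) by dfn_tac.
have [||y [/(sepP dS) [yd [yd' ney]] ymin]] :=
  wf (S := sep d (fun x => x ∈ d' /\ ap g x <> ap g' x)).
- by move=> z /(sepP dS) [zd _]; exact: dA.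
- by exists x; apply/(sepP dS).
have [bd gy] := hg y yd; have [bd' g'y] := hg' y yd'.
apply: ney; rewrite gy g'y.
apply: step_ext => z zb; apply: NNPP => nez.
by apply: (ymin z); [apply/(sepP dS); split; auto|move/belowP: zb => []].
Qed.

Let good x := exists g d, approx g d /\ x ∈ d.
Let val x := setof (fun z => exists g d, approx g d /\ x ∈ d /\ z ∈ ap g x).

Let dapprox (t u : (nat -> N) -> N) : dtm t -> dtm u -> dfn (fun e => approx (t e) (u e)).
Proof.
apply: dfn_rel2; rewrite /approx; dfn_unfold.
repeat first [dfn_step | apply: dbelow | apply: dlt2 | apply: dstep | exact: dtm_var].
Qed.

Let valP g d x : approx g d -> x ∈ d -> val x = ap g x.
Proof.
move=> h xd; symmetry; apply: is_setof_setof => z; split; first by exists g, d.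
by move=> [g' [d' [h' [xd' zg]]]]; rewrite (approx_unique h h').
Qed.

Let val_setof x : is_setof (val x) (fun z => exists g d, approx g d /\ x ∈ d /\ z ∈ ap g x).
Proof.
case: (classic (good x)) => [[g [d [h xd]]]|no].
  rewrite (valP h xd) => z; split; first by exists g, d.
  by move=> [g' [d' [h' [xd' zg]]]]; rewrite (approx_unique h h').
apply: setof_spec; exists emp => z; split; first by move/empP.
by move=> [g' [d' [h' [xd' zg]]]]; case: no; exists g', d'.
Qed.

Let dval (t : (nat -> N) -> N) : dtm t -> dtm (fun e => val (t e)).
Proof.
apply: (dtm_fun1 (F := val)).
apply: (@dtm_setof _ (fun e z => exists g d, approx g d /\ e 0 ∈ d /\ z ∈ ap g (e 0))).
  by move=> e; exact: val_setof.
by repeat first [apply: dapprox | dfn_step].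
Qed.

Let dgood : dfn (fun e => good (e 0)).
Proof. by rewrite /good; repeat first [apply: dapprox | dfn_step]. Qed.

Let G := fn (sep A good) val.

Let dval0 : dtm (fun e => val (e 0)).
Proof. exact: dval (dtm_var 0). Qed.

Let G_approx : approx G (sep A good).
Proof.
split; first by move=> x /(sepP dgood) [].
split; first exact: fn_fun.
move=> x xg; move: (xg) => /(sepP dgood) [xA [g [d [h xd]]]].
have [dA [gf hg]] := h; have [bd gx] := hg x xd.
have sb : subset (below x) (sep A good).
  move=> y yb; apply/(sepP dgood); split; first by move/belowP: yb => [].
  by exists g, d; split=> //; exact: bd.
split=> //; rewrite ap_fn // (valP h xd) gx; apply: step_ext => y yb.
by rewrite ap_fn //; [rewrite (valP h)//; exact: bd|exact: sb].
Qed.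

(** Two approximations agree, by minimality of a point of disagreement, so they glue to a function
    [G] on the points they reach. A minimal point not reached would be reached by adding one value
    to [G]. Minimal elements are asked only of sets of the model, hence the definability of
    everything formed here. *)
Lemma wf_recursion : exists f, is_fun f A /\
  forall x, x ∈ A -> ap f x = Phi x (fn (sep A (fun y => lt y x)) (ap f)).
Proof.
have all_good : forall x, x ∈ A -> good x.
  move=> x0 x0A; apply: NNPP => ng.
  have dS : dfn (fun e => ~ good (e 0)) by apply: dfn_not.
  have [||x [/(sepP dS) [xA nx] xmin]] := wf (S := sep A (fun x => ~ good x)).
  - by move=> z /(sepP dS) [].
  - by exists x0; apply/(sepP dS).
  apply: (nx).
  have bg : subset (below x) (sep A good).
    move=> y /belowP [yA yx]; apply/(sepP dgood); split=> //.
    by apply: NNPP => h; apply: (xmin y) => //; apply/(sepP dS).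
  have xn : ~ lt x x.
    move=> xx; apply: nx; have xb : x ∈ below x by apply/belowP.
    by have /(sepP dgood) [] := bg x xb.
  set v := step G x; set G' := cup G (sg (op x v)); set d' := cup (sep A good) (sg x).
  have G'app y z : app G' y z <-> app G y z \/ (y = x /\ z = v).
    rewrite !app_op cupP sgP; split; last by move=> [|[-> ->]]; auto.
    by case=> h; [left|right; apply/op_inj].
  have G'fun : is_fun G' d'.
    split; [|split].
    - move=> p /cupP [pG|/sgP ->].
        have [y [z [yd e]]] := proj1 (fn_fun (sep A good) dval0) p pG.
        by exists y, z; split=> //; apply/cupP; left.
      by exists x, v; split; [apply/cupP; right; apply/sgP|apply/is_opair_op].
    - move=> y /cupP [yd|/sgP ->].
        have [z hz] := proj1 (proj2 (fn_fun (sep A good) dval0)) y yd.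
        by exists z; apply/G'app; left.
      by exists v; apply/G'app; right.
    - have nG z : ~ app G x z by move/(app_dom (fn_fun (sep A good) dval0))/(sepP dgood) => [].
      move=> y z z' /G'app [h|[-> ->]] /G'app [h'|[e ->]] //.
      + exact: (proj2 (proj2 (fn_fun (sep A good) dval0)) y z z').
      + by rewrite e in h; case: (nG z).
      + by case: (nG z').
  have G'ap y : y ∈ sep A good -> ap G' y = ap G y.
    move=> yd; apply: (ap_app G'fun); apply/G'app; left.
    exact: (app_ap (fn_fun (sep A good) dval0)).
  have G'x : ap G' x = v by apply: (ap_app G'fun); apply/G'app; right.
  exists G', d'; split; last by apply/cupP; right; apply/sgP.
  split; first by move=> y /cupP [/(sepP dgood) []|/sgP ->].
  split=> // y /cupP [yd|/sgP ->].
    have [sb e] := proj2 (proj2 G_approx) y yd.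
    split; first by move=> z /sb zd; apply/cupP; left.
    rewrite G'ap // e; apply: step_ext => z /sb zd; by rewrite G'ap.
  split; first by move=> z /bg zd; apply/cupP; left.
  by rewrite G'x; apply: step_ext => z /bg zd; rewrite G'ap.
have sA : sep A good = A.
  by apply: set_ext => x; rewrite (sepP dgood); split; [tauto|auto].
have [_ [Gf h]] := G_approx; rewrite sA in Gf h.
by exists G; split=> // x xA; have [_ ->] := h x xA.
Qed.

End WfRec.
End Recursion.

Section Induction.

Context {N : zfc_model}.

Implicit Types a b c d f g h k p q r s v w x y z A B D G S T X Y Z : N.

Lemma mem_wf (A S : N) : subset S A -> (exists x, x ∈ S) ->
  exists x, x ∈ S /\ forall y, y ∈ S -> ~ y ∈ x.
Proof. by move=> _; apply: foundation_ex. Qed.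

Lemma mem_recursion (A : N) (Phi : N -> N -> N) : dtm (fun e => Phi (e 0) (e 1)) ->
  exists f, is_fun f A /\
  forall x, x ∈ A -> ap f x = Phi x (fn (sep A (fun y => y ∈ x)) (ap f)).
Proof.
move=> h; apply: (@wf_recursion _ A (fun y x => y ∈ x)) => //; first by dfn_tac.
exact: mem_wf.
Qed.

(** The stages are indexed by any inductive set instead of omega. *)
Lemma transitive_superset (x : N) : exists T, is_transitive T /\ subset x T.
Proof.
have [w [[z0 z0w] hw]] : exists w : N, (exists z, z ∈ w) /\
    forall n, n ∈ w -> exists m, m ∈ w /\ n ∈ m.
  case: (zfc_axioms N) => _ [_ [_ [_ [_ [[w [_ [[z [_ [zw _]]] h]]] _]]]]].
  exists w; split; first by exists z.
  move=> n nw; have [m [_ [mw hm]]] := h n I nw.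
  by exists m; split=> //; apply/hm => //; right.
have [|s [sf hs]] := @mem_recursion w
    (fun n h => cup x (Un (Un (rep n (ap h))))).
  by dfn_tac.
have stP n z : n ∈ w -> z ∈ ap s n <->
    z ∈ x \/ exists m y, m ∈ w /\ m ∈ n /\ y ∈ ap s m /\ z ∈ y.
  move=> nw; rewrite (hs n nw) cupP UnP.
  set h := fn _ _.
  have dh : dtm (fun e => ap s (e 0)) by dfn_tac.
  have dm : dfn (fun e => e 0 ∈ n) by dfn_tac.
  have hap m : m ∈ w -> m ∈ n -> ap h m = ap s m.
    by move=> mw mn; rewrite /h ap_fn //; apply/(sepP dm).
  split.
    case; first by left.
    move=> [y [/UnP [t [/repP ht yt]] zy]]; right.
    have [|m [mn et]] := ht; first by dfn_tac.
    move: yt; rewrite et apP0 => -[u [/(fn_app dh) [/(sepP dm) [mw _] ->]] yt].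
    by exists m, y.
  case; first by left.
  move=> [m [y [mw [mn [ys zy]]]]]; right; exists y; split=> //.
  apply/UnP; exists (ap s m); split=> //; apply/repP; first by dfn_tac.
  by exists m; split=> //; rewrite hap.
exists (Un (rep w (ap s))); split.
  move=> y /UnP [t [/repP ht yt]] z zy.
  have [|n [nw et]] := ht; first by dfn_tac.
  subst t; have [m [mw nm]] := hw n nw.
  apply/UnP; exists (ap s m); split; first by apply/repP; [dfn_tac|exists m].
  by apply/stP => //; right; exists n, y.
move=> y yx; apply/UnP; exists (ap s z0); split.
  by apply/repP; [dfn_tac|exists z0].
by apply/stP => //; left.
Qed.

(** Foundation speaks of sets, while the counterexamples to [Q] may form a proper class; they are
    cut down to a transitive set containing one of them. *)
Lemma eps_ind (Q : N -> Prop) : dfn (fun e => Q (e 0)) ->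
  (forall x, (forall y, y ∈ x -> Q y) -> Q x) -> forall x, Q x.
Proof.
move=> dQ h x; apply: NNPP => nQ.
have [T [tT xT]] := transitive_superset (sg x).
have dn : dfn (fun e => ~ Q (e 0)) by apply: dfn_not.
have [|y [/(sepP dn) [yT nQy] ymin]] := foundation_ex (x := sep T (fun y => ~ Q y)).
  by exists x; apply/(sepP dn); split=> //; apply: xT; apply/sgP.
apply: nQy; apply: h => z zy; apply: NNPP => nQz.
by apply: (ymin z) => //; apply/(sepP dn); split=> //; exact: (tT y yT z zy).
Qed.

(** [op r p ∈ s] puts [r] three levels below [s]. *)
Lemma name_ind (Q : N -> Prop) : dfn (fun e => Q (e 0)) ->
  (forall s, (forall r p, op r p ∈ s -> Q r) -> Q s) -> forall s, Q s.
Proof.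
move=> dQ h s.
pose (R := fun x : N => Q x /\ (forall y, y ∈ x -> Q y) /\ forall y z, y ∈ x -> z ∈ y -> Q z).
suff : R s by case.
apply: (@eps_ind R).
  have dQ1 t : dtm t -> dfn (fun e => Q (t e)) by apply: dfn_rel1.
  by rewrite /R; repeat first [apply: dQ1 | dfn_step].
move=> x IH; split; last first.
  split; first by move=> y /IH [].
  by move=> y z /IH [_ [hy _]]; exact: hy.
apply: h => r p rx; have [_ [_ h2]] := IH _ rx.
by apply: (h2 (sg r) r); [apply/upP; left|apply/sgP].
Qed.

Lemma zfc_choice : choice (N := carrier N) univ.
Proof. by case: (zfc_axioms N) => _ [_ [_ [_ [_ [_ [C _]]]]]]. Qed.

Lemma choice_fn (R : N -> N -> Prop) (A B : N) :
  dfn (fun e => R (e 0) (e 1)) ->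
  (forall x, x ∈ A -> exists y, y ∈ B /\ R x y) ->
  exists f, is_fun f A /\ forall x, x ∈ A -> ap f x ∈ B /\ R x (ap f x).
Proof.
move=> dR h.
(* The axiom of choice is available for disjoint families only; tagging the candidates with [x]
   makes the family disjoint. *)
pose (K := fun x : N => sep (prod A B) (fun p => exists y, p = op x y /\ R x y)).
have dR2 (t u : (nat -> N) -> N) : dtm t -> dtm u -> dfn (fun e => R (t e) (u e)) by exact: dfn_rel2.
have dK1 x : dfn (fun e => exists y, e 0 = op x y /\ R x y).
  by repeat first [apply: dR2 | dfn_step].
have KP x p : p ∈ K x <-> exists y, x ∈ A /\ y ∈ B /\ p = op x y /\ R x y.
  rewrite (sepP (dK1 x)) prodP; split.
    by move=> [[x' [y' [xA [yB ->]]]] [y [/op_inj [? ?] r]]]; subst; exists y.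
  by move=> [y [xA [yB [-> r]]]]; split; [exists x, y|exists y].
have dK : dtm (fun e => K (e 0)).
  rewrite /K; apply: dtm_sep; first exact: dtm_const.
  by repeat first [apply: dR2 | dfn_step].
have [||c [_ hc]] := @zfc_choice (rep A K) I.
- move=> k _ /(repP dK) [x [xA ->]]; have [y [yB r]] := h x xA.
  by exists (op x y); split=> //; apply/KP; exists y.
- move=> k k' z _ _ _ /(repP dK) [x [xA ->]] /(repP dK) [x' [xA' ->]].
  by move=> /KP [y [_ [_ [-> _]]]] /KP [y' [_ [_ [/op_inj [-> _]]]]].
pose (f := sep (prod A B) (fun p => p ∈ c /\ exists x y, p = op x y /\ R x y)).
have df : dfn (fun e => e 0 ∈ c /\ exists x y, e 0 = op x y /\ R x y).
  by repeat first [apply: dR2 | dfn_step].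
have fP x y : app f x y <-> x ∈ A /\ y ∈ B /\ op x y ∈ c /\ R x y.
  rewrite app_op (sepP df) op_prod; split.
    by move=> [[xA yB] [xyc [x' [y' [/op_inj [? ?] r]]]]]; subst.
  by move=> [xA [yB [xyc r]]]; split=> //; split=> //; exists x, y.
have fex x : x ∈ A -> exists y, app f x y /\ forall y', app f x y' -> y' = y.
  move=> xA; have [|z [_ [zK [zc zu]]]] := hc (K x) I; first by apply/repP => //; exists x.
  move/KP: zK => [y [_ [yB [e r]]]]; subst z; exists y; split; first by apply/fP.
  move=> y' /fP [_ [y'B [y'c r']]].
  by have /op_inj [] : op x y' = op x y by apply: zu => //; apply/KP; exists y'.
have ff : is_fun f A.
  split; [|split].
  - move=> p pf; move: (pf) => /(sepP df) [/prodP [x [y [xA [yB e]]]] _].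
    by exists x, y; split=> //; apply/is_opair_op.
  - by move=> x /fex [y [a _]]; exists y.
  - move=> x y y' a a'; move: (a); rewrite fP => -[xA _].
    by have [y0 [_ u]] := fex x xA; rewrite (u _ a) (u _ a').
exists f; split=> // x xA.
by have := app_ap ff xA; rewrite fP => -[_ [? [_ ?]]].
Qed.

Lemma ord_mem (a x : N) : is_ord a -> x ∈ a -> is_ord x.
Proof.
move=> [ta h] xa; split; first exact: h.
by move=> y yx; apply: h; exact: ta yx.
Qed.

Lemma ord_trans (a x y : N) : is_ord a -> x ∈ y -> y ∈ a -> x ∈ a.
Proof. by move=> [ta _] xy ya; exact: ta xy. Qed.

Lemma dfn_ord (t : (nat -> N) -> N) : dtm t -> dfn (fun e => is_ord (t e)).
Proof. by apply: dfn_rel1; dfn_tac. Qed.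

Lemma ord_trich (a b : N) : is_ord a -> is_ord b -> a ∈ b \/ a = b \/ b ∈ a.
Proof.
move=> oa; move: b.
pose (Q := fun a : N => is_ord a -> forall b, is_ord b -> a ∈ b \/ a = b \/ b ∈ a).
suff : Q a by move/(_ oa).
apply: (@eps_ind Q) => {a oa}.
  by rewrite /Q; repeat first [apply: dfn_ord | dfn_step].
move=> a IHa oa.
pose (R := fun b : N => is_ord b -> a ∈ b \/ a = b \/ b ∈ a).
apply: (@eps_ind R) => [|b IHb ob].
  by rewrite /R; repeat first [apply: dfn_ord | dfn_step].
case: (classic (a ∈ b)) => [|nab]; first by left.
case: (classic (b ∈ a)) => [|nba]; first by right; right.
right; left; apply: set_ext => z; split=> hz.
  case: (IHa z hz (ord_mem oa hz) b ob) => [//|[e|bz]].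
    by subst z.
  by case: nba; exact: (proj1 oa z hz).
case: (IHb z hz (ord_mem ob hz)) => [az|[e|//]].
  by case: nab; exact: (proj1 ob z hz).
by subst z.
Qed.

Lemma ord_subset (a b : N) : is_ord a -> is_ord b -> subset a b -> a = b \/ a ∈ b.
Proof.
move=> oa ob ab; case: (ord_trich oa ob) => [|[|ba]]; auto.
by case: (@mem_irrefl _ b); exact: ab.
Qed.

Lemma name_value_unique (G s x x' : N) :
  name_value G s x -> name_value G s x' -> x = x'.
Proof.
move: x x'; pose (Q := fun s : N => forall x x', name_value G s x -> name_value G s x' -> x = x').
apply: (@name_ind Q) => [|{}s IH x x']; first by rewrite /Q; dfn_tac.
have key y y' : name_value G s y -> name_value G s y' -> subset y y'.
  move=> [d [h [hf [hd [hv ha]]]]] [d' [h' [hf' [hd' [hv' ha']]]]] z.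
  move/(hv s y ha) => [r [p [q [pG [e [qs a]]]]]].
  apply/(hv' s y' ha'); exists r, p, q; do 3 split=> //.
  have sd' := app_dom hf' ha'; have rd' := hd' s r p q sd' qs e.
  have a' := app_ap hf' rd'.
  suff -> : z = ap h' r by [].
  apply: (IH r p); first by move/is_opair_op: e => <-.
    by exists d, h.
  by exists d', h'.
by move=> h h'; apply: set_ext => z; split; apply: key.
Qed.

(** Recursion along the subname relation on a transitive set containing [s]. That a nonempty set has
    a minimal element for this relation is [name_ind] applied to non-membership. *)
Lemma name_value_ex (G s : N) : exists x, name_value G s x.
Proof.
have [T [tT sT]] := transitive_superset (sg s).
pose (lt := fun r s : N => exists p, op r p ∈ s).
have dlt : dfn (fun e => lt (e 0) (e 1)) by rewrite /lt; dfn_tac.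
have sub r p x : x ∈ T -> op r p ∈ x -> r ∈ T.
  move=> xT rx; apply: (tT (sg r)); last by apply/sgP.
  by apply: (tT (op r p)); [apply: (tT x)|apply/upP; left].
have [||f [ff hf]] := @wf_recursion _ T lt
   (fun x h => rep (sep (Un (Un x)) (fun r => exists p, p ∈ G /\ op r p ∈ x)) (ap h)) dlt.
- move=> S _ [x xS]; apply: NNPP => nex.
  have : forall x, ~ x ∈ S; last by move/(_ x).
  apply: (@name_ind (fun x => ~ x ∈ S)); first by dfn_tac.
  move=> y IH yS; apply: nex; exists y; split=> // z zS [p zy].
  exact: (IH z p).
- by dfn_tac.
exists (ap f s), T, f; split=> //; split.
  move=> x r p q xT qx /is_opair_op e; subst q; exact: (sub r p x).
have dr x : dfn (fun e => exists p, p ∈ G /\ op (e 0) p ∈ x) by dfn_tac.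
have dl x : dfn (fun e => lt (e 0) x) by rewrite /lt; dfn_tac.
have ds : dtm (fun e => ap f (e 0)) by dfn_tac.
split; last by apply: (app_ap ff); apply: sT; apply/sgP.
move=> x y a; have xT := app_dom ff a; rewrite -(ap_app ff a) (hf x xT) => z.
set h := fn _ _.
have hap r p : op r p ∈ x -> ap h r = ap f r.
  move=> rx; rewrite ap_fn //; apply/(sepP (dl x)); split; first exact: (sub r p x).
  by exists p.
have dh : dtm (fun e => ap h (e 0)) by dfn_tac.
rewrite (repP dh); split.
  move=> [r [/(sepP (dr x)) [_ [p [pG rx]]] ->]].
  exists r, p, (op r p); do 2 split=> //; first by apply/is_opair_op.
  split=> //; rewrite (hap r p rx); apply: (app_ap ff); exact: (sub r p x).
move=> [r [p [q [pG [/is_opair_op -> [qx ar]]]]]]; exists r; split; last first.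
  by rewrite (hap r p qx) (ap_app ff ar).
by apply/(sepP (dr x)); split; [case: (op_mem_Un qx)|exists p].
Qed.

Definition val (G s : N) : N := setof (fun z => exists x, name_value G s x /\ z ∈ x).

Lemma val_name_value (G s x : N) : name_value G s x <-> x = val G s.
Proof.
have [y hy] := name_value_ex G s.
have e : y = val G s.
  apply: is_setof_setof => z; split; first by exists y.
  by move=> [y' [h' zy]]; rewrite (name_value_unique hy h').
by rewrite -e; split=> [h|-> //]; exact: name_value_unique h hy.
Qed.

Lemma valP (G s z : N) : z ∈ val G s <-> exists r p, p ∈ G /\ op r p ∈ s /\ z = val G r.
Proof.
have [d [h [hf [hd [hv ha]]]]] : name_value G s (val G s) by apply/val_name_value.
rewrite (hv _ _ ha z); split.
  move=> [r [p [q [pG [/is_opair_op -> [rs a]]]]]]; exists r, p; do 2 split=> //.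
  by apply/val_name_value; exists d, h.
move=> [r [p [pG [rs ->]]]]; exists r, p, (op r p); do 2 split=> //; first by apply/is_opair_op.
split=> //.
have rd : r ∈ d by apply: (hd s r p (op r p)) => //; [exact: (app_dom hf ha)|apply/is_opair_op].
have a := app_ap hf rd; suff <- : ap h r = val G r by [].
by apply/val_name_value; exists d, h.
Qed.

Lemma dtm_val (G s : (nat -> N) -> N) : dtm G -> dtm s -> dtm (fun e => val (G e) (s e)).
Proof.
apply: (dtm_fun2 (F := val)).
apply: (@dtm_setof _ (fun e z => exists x, name_value (e 0) (e 1) x /\ z ∈ x)); last by dfn_tac.
move=> e z; split.
  by exists (val (e 0) (e 1)); split=> //; apply/val_name_value.
by move=> [x [/val_name_value -> ]].
Qed.

End Induction.

Ltac dtm_lemma ::= first [ apply: dtm_up | apply: dtm_Un | apply: dtm_pw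
  | apply: dtm_op | apply: dtm_cup | apply: dtm_ap | apply: dtm_fn
  | apply: dtm_rep | apply: dtm_sep | apply: dtm_val ].
Ltac dfn_lemma ::= first [ apply: dfn_app | apply: dfn_ord ].

(** * Ultrafilters and ultrapowers *)

Section Almost.

Context {N : zfc_model}.

Implicit Types a b c d f g h k p q r s v w x y z A B D G S T X Y Z : N.

Definition al d D (Q : N -> Prop) : Prop := large D (fun i => i ∈ d /\ Q i).

Lemma dfn_al (d D : (nat -> N) -> N) (Q : (nat -> N) -> N -> Prop) :
  dtm d -> dtm D -> dfn (fun e => Q (fun n => e (S n)) (e 0)) ->
  dfn (fun e => al (d e) (D e) (Q e)).
Proof.
move=> hd hD hQ; apply: dfn_ex; apply: dfn_and.
  by apply: dfn_mem; [exact: dtm_var|exact: (dtm_subvar S hD)].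
apply: dfn_all; apply: dfn_iff; first by dfn_tac.
apply: dfn_and; last exact: (dfn_subvar (fun n => match n with 0 => 0 | S m => S (S m) end) hQ).
by apply: dfn_mem; [exact: dtm_var|exact: (dtm_subvar (fun n => S (S n)) hd)].
Qed.

Section Filter.

Variables (d D : N).
Hypothesis hD : ultrafilter univ d D.

Lemma al_sep (Q : N -> Prop) : dfn (fun e => Q (e 0)) -> al d D Q <-> sep d Q ∈ D.
Proof.
move=> dQ; split.
  move=> [A [AD hA]]; suff <- : A = sep d Q by [].
  by apply: set_ext => z; rewrite (sepP dQ) (hA z).
by move=> h; exists (sep d Q); split=> // z; exact: sepP.
Qed.

Lemma al_ex (Q : N -> Prop) : al d D Q -> exists i, i ∈ d /\ Q i.
Proof.
move=> [A [AD hA]]; have [_ [_ [_ [ne _]]]] := hD.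
apply: NNPP => no; apply: (ne A AD) => z /hA h; apply: no; by exists z.
Qed.

Lemma al_mono (Q Q' : N -> Prop) : dfn (fun e => Q' (e 0)) ->
  (forall i, i ∈ d -> Q i -> Q' i) -> al d D Q -> al d D Q'.
Proof.
move=> dQ h [A [AD hA]]; have [_ [_ [_ [_ [up _]]]]] := hD.
apply/al_sep => //; apply: (up A) => //.
- by move=> z /hA [zd Qz]; apply/(sepP dQ); split; auto.
- by move=> z /(sepP dQ) [].
Qed.

Lemma al_and (Q Q' : N -> Prop) : al d D Q -> al d D Q' -> al d D (fun i => Q i /\ Q' i).
Proof.
move=> [A [AD hA]] [B [BD hB]]; have [_ [_ [_ [_ [_ [int _]]]]]] := hD.
have [I [ID hI]] := int A B AD BD.
by exists I; split=> // z; rewrite (hI z) (hA z) (hB z); tauto.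
Qed.

Lemma al_mono2 (Q R Q' : N -> Prop) : dfn (fun e => Q' (e 0)) ->
  al d D Q -> al d D R -> (forall i, i ∈ d -> Q i -> R i -> Q' i) -> al d D Q'.
Proof.
move=> dQ hQ hR h; apply: (al_mono dQ _ (al_and hQ hR)) => i id' [Qi Ri]; exact: h.
Qed.

Lemma al_iff (Q Q' : N -> Prop) : (forall i, i ∈ d -> (Q i <-> Q' i)) ->
  al d D Q <-> al d D Q'.
Proof.
by move=> h; split=> -[A [AD hA]]; exists A; split=> // z; rewrite (hA z);
  split=> -[zd hz]; split=> //; apply/(h z zd).
Qed.

Lemma al_true : al d D (fun _ => True).
Proof. by have [_ [_ [dD _]]] := hD; exists d; split=> // z; tauto. Qed.

Lemma al_all (Q : N -> Prop) : dfn (fun e => Q (e 0)) ->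
  (forall i, i ∈ d -> Q i) -> al d D Q.
Proof. by move=> dQ h; apply: (al_mono dQ _ al_true) => i id' _; exact: h. Qed.

Lemma al_not (Q : N -> Prop) : dfn (fun e => Q (e 0)) ->
  al d D (fun i => ~ Q i) <-> ~ al d D Q.
Proof.
move=> dQ; split.
  by move=> h h'; have [i [_ []]] := al_ex (al_and h h').
move=> h; have [_ [_ [_ [_ [_ [_ dec]]]]]] := hD.
have [|//|[A [AD hA]]] := dec (sep d Q) I; first by move=> z /(sepP dQ) [].
  by move/al_sep => /(_ dQ).
by exists A; split=> // z; rewrite (hA z) (sepP dQ); tauto.
Qed.

Lemma al_or (Q R : N -> Prop) : dfn (fun e => Q (e 0)) -> dfn (fun e => R (e 0)) ->
  al d D (fun i => Q i \/ R i) -> al d D Q \/ al d D R.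
Proof.
move=> dQ dR h; case: (classic (al d D Q)); first by left.
move/(al_not dQ) => h'; right; apply: (al_mono2 dR h h') => i _; tauto.
Qed.

Lemma al_contra (Q : N -> Prop) : al d D Q -> (forall i, i ∈ d -> ~ Q i) -> False.
Proof. by move/al_ex => [i [id' Qi]] /(_ i id'). Qed.

(** The existential step of Łoś's theorem; the bound [B] keeps the choice of witnesses inside a
    set. *)
Lemma al_choice (R : N -> N -> Prop) B : dfn (fun e => R (e 0) (e 1)) ->
  al d D (fun i => exists y, y ∈ B /\ R i y) ->
  exists h, is_fun h d /\ al d D (fun i => R i (ap h i)).
Proof.
move=> dR hR.
have dR2 (t u : (nat -> N) -> N) : dtm t -> dtm u -> dfn (fun e => R (t e) (u e)).
  exact: dfn_rel2.
pose (E := fun i => exists y, y ∈ B /\ R i y).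
(* [emp] is the default value at indices without a witness. *)
have [||h [hf hh]] := @choice_fn _ (fun i y => E i -> R i y) d (cup B (sg emp)).
- by rewrite /E; repeat first [apply: dR2 | dfn_step].
- move=> i id'; case: (classic (E i)) => [[y [yB r]]|no].
    by exists y; split=> //; apply/cupP; left.
  by exists emp; split=> //; apply/cupP; right; apply/sgP.
exists h; split=> //; apply: (al_mono _ _ hR).
  by repeat first [apply: dR2 | dfn_step].
by move=> i id' /(proj2 (hh i id')).
Qed.

End Filter.

End Almost.

Ltac dfn_lemma ::= first [ apply: dfn_app | apply: dfn_ord | apply: dfn_al ].

(** * Successors and the elements of omega *)

Section Omega.

Context {N : zfc_model}.

Implicit Types a b c d f g h k p q r s v w x y z A B D G S T X Y Z : N.

Definition succ a := cup a (sg a).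

Lemma succP a z : z ∈ succ a <-> z ∈ a \/ z = a.
Proof. by rewrite cupP sgP. Qed.

Lemma dtm_succ (a : (nat -> N) -> N) : dtm a -> dtm (fun e => succ (a e)).
Proof. by move=> h; rewrite /succ; dfn_tac. Qed.

Lemma succ_ord a : is_ord a -> is_ord (succ a).
Proof.
move=> oa; split.
  move=> y /succP [ya|->] z zy; apply/succP; left=> //; exact: (proj1 oa y ya).
by move=> y /succP [ya|->]; [exact: (proj2 oa)|exact: (proj1 oa)].
Qed.

Lemma limit_succ w a : is_limit w -> a ∈ w -> succ a ∈ w.
Proof.
move=> [ow [_ lw]] aw; have [y [yw ay]] := lw a aw.
have oy := ord_mem ow yw.
case: (@ord_subset _ (succ a) y) => //.
- exact: succ_ord (ord_mem ow aw).
- by move=> z /succP [za|->] //; exact: (proj1 oy a ay).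
- by move=> ->.
- by move=> h; exact: (proj1 ow y yw).
Qed.

Lemma Un_succ a : is_ord a -> Un (succ a) = a.
Proof.
move=> oa; apply: set_ext => z; rewrite UnP; split.
  by move=> [y [/succP [ya|->] zy]] //; exact: (proj1 oa y ya).
by move=> za; exists a; split=> //; apply/succP; right.
Qed.

Lemma omega_cases w n : is_omega w -> n ∈ w ->
  is_empty n \/ exists m, m ∈ w /\ n = succ m.
Proof.
move=> [[ow [ne lw]] hw] nw; case: (classic (is_empty n)); first by left.
move=> nn; right; have on := ord_mem ow nw.
apply: NNPP => no; apply: (hw n nw); split=> //; split.
  by apply: NNPP => h; apply: nn => z zn; apply: h; exists z.
move=> x xn; apply: NNPP => nx; apply: no; exists x; split; first exact: (proj1 ow n nw).
have ox := ord_mem on xn.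
apply: set_ext => z; rewrite succP; split.
  move=> zn; case: (ord_trich (ord_mem on zn) ox) => [|[|xz]]; auto.
  by case: nx; exists z.
by case=> [zx|->] //; exact: (proj1 on x xn).
Qed.

End Omega.

Ltac dtm_lemma ::= first [ apply: dtm_up | apply: dtm_Un | apply: dtm_pw
  | apply: dtm_op | apply: dtm_succ | apply: dtm_cup | apply: dtm_ap | apply: dtm_fn
  | apply: dtm_rep | apply: dtm_sep | apply: dtm_val ].

(** * The transitive collapse of an ultrapower by a countably complete ultrafilter *)

Section Collapse.

Context {N : zfc_model}.

Implicit Types a b c d f g h k p q r s v w x y z A B D G S T X Y Z : N.

Variables (d D w : N).
Hypothesis hD : ultrafilter univ d D.
Hypothesis hw : is_omega w.
Hypothesis hs : closed_under_seq univ d D w.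

Lemma ult_mem_al f g : is_fun f d -> is_fun g d ->
  ult_mem d D f g <-> al d D (fun i => ap f i ∈ ap g i).
Proof.
move=> hf hg; apply: al_iff => i id'; split.
  by move=> [a [b [/(ap_app hf) -> [/(ap_app hg) ->]]]].
by move=> h; exists (ap f i), (ap g i); split; [exact: (app_ap hf)|split=> //; exact: (app_ap hg)].
Qed.

Lemma ult_eq_al f g : is_fun f d -> is_fun g d ->
  ult_eq d D f g <-> al d D (fun i => ap f i = ap g i).
Proof.
move=> hf hg; apply: al_iff => i id'; split.
  by move=> [a [/(ap_app hf) -> /(ap_app hg) ->]].
by move=> h; exists (ap f i); split; [|rewrite h]; [exact: (app_ap hf)|exact: (app_ap hg)].
Qed.

(** Without a minimal element, choice gives an omega-sequence each step of which descends almost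
    everywhere. Countable completeness provides one index at which all steps descend, against
    foundation. *)
Lemma ult_wf B : (forall g, g ∈ B -> is_fun g d) -> (exists g, g ∈ B) ->
  exists g, g ∈ B /\ forall h, h ∈ B -> ~ al d D (fun i => ap h i ∈ ap g i).
Proof.
move=> Bf [g0 g0B]; apply: NNPP => no.
have [||ch [chf hch]] := @choice_fn _ (fun g h => al d D (fun i => ap h i ∈ ap g i)) B B.
- by dfn_tac.
- move=> g gB; apply: NNPP => no'; apply: no; exists g; split=> // h hB hh.
  by apply: no'; exists h.
(* Start at [g0] and apply [ch] at successors. The case distinction is expressed by a separation,
   and [Un n] is the predecessor of a successor [n]. *)
have [|s [sf hsr]] := @mem_recursion _ w (fun n h =>
   sep (cup g0 (ap ch (ap h (Un n)))) (fun z =>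
     (is_empty n /\ z ∈ g0) \/ (~ is_empty n /\ z ∈ ap ch (ap h (Un n))))).
  by dfn_tac.
have [limw _] := hw; have [ow _] := limw.
have sdP n h z : z ∈ sep (cup g0 (ap ch (ap h (Un n)))) (fun z =>
     (is_empty n /\ z ∈ g0) \/ (~ is_empty n /\ z ∈ ap ch (ap h (Un n)))) <->
     (is_empty n /\ z ∈ g0) \/ (~ is_empty n /\ z ∈ ap ch (ap h (Un n))).
  by rewrite sepP ?cupP; [tauto|dfn_tac].
have s0 n : n ∈ w -> is_empty n -> ap s n = g0.
  move=> nw ne; rewrite hsr //; apply: set_ext => z; rewrite sdP; tauto.
have sS n : n ∈ w -> ap s (succ n) = ap ch (ap s n).
  move=> nw; have nS := limit_succ limw nw.
  have ne : ~ is_empty (succ n) by move/(_ n); apply; apply/succP; right.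
  rewrite hsr //; apply: set_ext => z; rewrite sdP Un_succ; last exact: (ord_mem ow nw).
  rewrite ap_fn; [tauto|dfn_tac|].
  have dm : dfn (fun e => e 0 ∈ succ n) by dfn_tac.
  by apply/(sepP dm); split=> //; apply/succP; right.
have sB : forall n, n ∈ w -> ap s n ∈ B.
  move=> n nw; apply: NNPP => nB.
  have dm : dfn (fun e => ~ ap s (e 0) ∈ B) by dfn_tac.
  have [|m [/(sepP dm) [mw mB] mmin]] := foundation_ex (x := sep w (fun n => ~ ap s n ∈ B)).
    by exists n; apply/(sepP dm).
  case: (omega_cases hw mw) => [me|[k [kw e]]]; first by apply: mB; rewrite s0.
  apply: mB; rewrite e sS //; apply: (proj1 (hch _ _)).
  apply: NNPP => kB; apply: (mmin k); first by apply/(sepP dm).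
  by rewrite e; apply/succP; right.
pose (Q := fun n i => ap (ap s (succ n)) i ∈ ap (ap s n) i).
have dQ n : dfn (fun e => Q n (e 0)) by rewrite /Q; dfn_tac.
have alQ n : n ∈ w -> al d D (Q n).
  by move=> nw; rewrite /Q sS //; case: (hch (ap s n)); auto.
have dt : dtm (fun e => sep d (Q (e 0))) by rewrite /Q; dfn_tac.
have [|i [id' hi]] := al_ex hD (Q := fun i => forall n X, app (fn w (fun n => sep d (Q n))) n X -> i ∈ X).
  apply: hs => //; split; first exact: fn_fun.
  move=> n X /(fn_app dt) [nw ->]; apply/al_sep => //; exact: alQ.
have dr : dtm (fun e => ap (ap s (e 0)) i) by dfn_tac.
have [|y [/(repP dr) [n [nw ->]] ymin]] := foundation_ex (x := rep w (fun n => ap (ap s n) i)).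
  have [_ [[n nw] _]] := limw; exists (ap (ap s n) i); apply/(repP dr); by exists n.
apply: (ymin (ap (ap s (succ n)) i)).
  by apply/(repP dr); exists (succ n); split=> //; exact: limit_succ.
have : i ∈ sep d (Q n) by apply: (hi n); apply/(fn_app dt).
by move/(sepP (dQ n)) => [].
Qed.

(** The collapse is computed on the set [F] of functions into a transitive set containing the values
    of [f]. A predecessor of such a function takes its values there almost everywhere, so it only
    has to be corrected on a null set. *)
Lemma ult_value_ex f : is_fun f d -> exists y, ult_value univ d D f y.
Proof.
move=> ff.
have [T [tT sT]] := transitive_superset (cup (sg emp) (Un (Un f))).
have e0 : emp ∈ T by apply: sT; apply/cupP; left; apply/sgP.
have dfun : dfn (fun e => is_fun (e 0) d) by dfn_tac.
pose (F := sep (pw (prod d T)) (fun g => is_fun g d)).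
have FP g : g ∈ F <-> is_fun g d /\ forall i, i ∈ d -> ap g i ∈ T.
  rewrite (sepP dfun) pwP; split.
    move=> [sub gf]; split=> // i id'.
    by have /app_op/sub/op_prod [] := app_ap gf id'.
  move=> [gf gT]; split=> // p pg; have [i [y [id' +]]] := proj1 gf p pg.
  move/is_opair_op => e; subst p; move/app_op: pg => a.
  by apply/op_prod; split=> //; rewrite -(ap_app gf a); exact: gT.
pose (lt := fun h g => al d D (fun i => ap h i ∈ ap g i)).
have dlt : dfn (fun e => lt (e 0) (e 1)) by rewrite /lt; dfn_tac.
have [||c [cf hc]] := @wf_recursion _ F lt (fun g h => rep (sep F (fun k => lt k g)) (ap h)) dlt.
- by move=> S SF ne; apply: ult_wf => // g /SF /FP [].
- by rewrite /lt; dfn_tac.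
exists (ap c f), F, c; do 2 split=> //; split; first by move=> g /FP [].
split.
  move=> g h gF _ hf hg; have [gf gT] := proj1 (FP g) gF.
  have dh : dtm (fun e => sep (ap h (e 0)) (fun z => ap h (e 0) ∈ T)) by dfn_tac.
  (* The separation returns [ap h i] when this lies in [T] and [emp] otherwise; this is why [emp]
     was put into [T]. *)
  pose (h' := fn d (fun i => sep (ap h i) (fun z => ap h i ∈ T))).
  have h'f : is_fun h' d by exact: fn_fun.
  have dc i : dfn (fun _ : nat -> N => ap h i ∈ T) by exact: dfn_prop.
  have h'T i : ap h i ∈ T -> sep (ap h i) (fun z => ap h i ∈ T) = ap h i.
    by move=> hT; apply: set_ext => z; rewrite (sepP (dc i)); tauto.
  exists h'; split.
    apply/FP; split=> // i id'; rewrite ap_fn //.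
    case: (classic (ap h i ∈ T)) => hi; first by rewrite h'T.
    have -> // : sep (ap h i) (fun z => ap h i ∈ T) = emp.
    by apply: set_ext => z; rewrite (sepP (dc i)) empP; tauto.
  apply/ult_eq_al => //; move/(ult_mem_al hf gf): hg; apply: al_mono => //; first by dfn_tac.
  move=> i id' hi; rewrite ap_fn // h'T //; exact: (tT (ap g i) (gT i id')).
split=> //; split; last first.
  apply: (app_ap cf); apply/FP; split=> // i id'; apply: sT; apply/cupP; right.
  by have /app_op/op_mem_Un [] := app_ap ff id'.
move=> g z a t; have gF := app_dom cf a; have [gf gT] := proj1 (FP g) gF.
rewrite -(ap_app cf a) (hc g gF).
set k := fn _ _; have dk : dtm (fun e => ap k (e 0)) by dfn_tac.
have dl : dfn (fun e => lt (e 0) g) by rewrite /lt; dfn_tac.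
have dcc : dtm (fun e => ap c (e 0)) by dfn_tac.
have kE h : h ∈ sep F (fun k => lt k g) -> ap k h = ap c h by move=> hh; rewrite ap_fn.
rewrite (repP dk); split.
  move=> [h [hh ->]]; move/(sepP dl): (hh) => [hF hl]; exists h; split=> //.
  move/FP: (hF) => [hf _]; split; first by apply/ult_mem_al.
  rewrite kE //; exact: (app_ap cf).
move=> [h [hF [/ult_mem_al hl a']]]; have [hf _] := proj1 (FP h) hF.
have hh : h ∈ sep F (fun k => lt k g) by apply/(sepP dl); split=> //; exact: hl.
by exists h; split=> //; rewrite kE // (ap_app cf a').
Qed.

(** Collapses on different sets of functions agree, by induction on the value: a predecessor found
    in one set has an almost everywhere equal copy in the other. *)
Lemma ult_value_unique f g y y' : ult_value univ d D f y -> ult_value univ d D g y' ->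
  is_fun f d -> is_fun g d -> al d D (fun i => ap f i = ap g i) -> y = y'.
Proof.
move=> [F [c [_ [_ [Ff [Fd [cf [cv a]]]]]]]] [F' [c' [_ [_ [Ff' [Fd' [cf' [cv' a']]]]]]]] ff gf fg.
pose (Q := fun y => forall g g', app c g y -> g' ∈ F' -> al d D (fun i => ap g i = ap g' i) -> app c' g' y).
have hQ : Q y; last by rewrite -(ap_app cf' (hQ _ _ a (app_dom cf' a') fg)) (ap_app cf' a').
have meq h k k' : al d D (fun i => ap h i ∈ ap k i) -> al d D (fun i => ap k i = ap k' i) ->
   al d D (fun i => ap h i ∈ ap k' i).
  by move=> h1 h2; apply: (al_mono2 hD _ h1 h2); [dfn_tac|move=> i _ ? <-].
have meq2 h k h' : al d D (fun i => ap h i ∈ ap k i) -> al d D (fun i => ap h i = ap h' i) ->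
   al d D (fun i => ap h' i ∈ ap k i).
  by move=> h1 h2; apply: (al_mono2 hD _ h1 h2); [dfn_tac|move=> i _ ? <-].
have sym h h' : al d D (fun i => ap h i = ap h' i) -> al d D (fun i => ap h' i = ap h i).
  by apply: al_mono => //; dfn_tac.
apply: (@eps_ind _ Q); first by rewrite /Q; dfn_tac.
move=> {a fg} {}y IH k k' a kF' kk'.
have kF := app_dom cf a; have a2 := app_ap cf' kF'.
suff -> : y = ap c' k' by [].
have kf := Ff k kF; have kf' := Ff' k' kF'.
apply: set_ext => z; rewrite (cv k y a z) (cv' _ _ a2 z); split.
  move=> [h [hF [hk ah]]]; have hf := Ff h hF.
  have hk' : ult_mem d D h k' by apply/ult_mem_al => //; apply: meq kk'; apply/ult_mem_al.
  have [h' [hF' hh']] := Fd' k' h kF' I hf hk'; have hf' := Ff' h' hF'.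
  move/(ult_eq_al hf hf'): hh' => hh'.
  exists h'; split=> //; split.
    by apply/ult_mem_al => //; apply: meq2 hh'; apply/ult_mem_al.
  apply: (IH z _ h) => //; apply/(cv k y a z); by exists h.
move=> [h' [hF' [hk' ah']]]; have hf' := Ff' h' hF'.
have hk : ult_mem d D h' k.
  by apply/ult_mem_al => //; apply: meq (sym _ _ kk'); apply/ult_mem_al.
have [h [hF hh]] := Fd k h' kF I hf' hk; have hf := Ff h hF.
move/(ult_eq_al hf' hf): hh => hh.
have hk2 : ult_mem d D h k by apply/ult_mem_al => //; apply: meq2 hh; apply/ult_mem_al.
have ah := app_ap cf hF; exists h; split=> //; split=> //.
have e : app c' h' (ap c h); last by rewrite -(ap_app cf' ah') (ap_app cf' e).
apply: (IH _ _ h) => //; last exact: sym.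
apply/(cv k y a); by exists h.
Qed.

(** The element of the collapsed ultrapower represented by [f]. *)
Definition cls_of f : N := setof (fun t => exists y, ult_value univ d D f y /\ t ∈ y).

Lemma ult_value_fun f y : ult_value univ d D f y -> is_fun f d.
Proof. move=> [F [c [_ [_ [Ff [_ [cf [_ a]]]]]]]]; exact: Ff (app_dom cf a). Qed.

Lemma al_refl f : al d D (fun i => ap f i = ap f i).
Proof. by apply: al_all => //; dfn_tac. Qed.

Lemma cls_of_setof f :
  is_setof (cls_of f) (fun t => exists y, ult_value univ d D f y /\ t ∈ y).
Proof.
apply: setof_spec; case: (classic (is_fun f d)) => ff.
  have [y hy] := ult_value_ex ff; exists y => t; split; first by exists y.
  by move=> [y' [hy' ty]]; rewrite (ult_value_unique hy hy') //; exact: al_refl.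
by exists emp => t; rewrite empP; split=> // -[y [/ult_value_fun]].
Qed.

Lemma ult_value_cls f y : is_fun f d -> ult_value univ d D f y <-> y = cls_of f.
Proof.
move=> ff; have [y0 hy0] := ult_value_ex ff.
have key y1 : ult_value univ d D f y1 -> y1 = cls_of f.
  move=> h; apply: set_ext => t; rewrite (cls_of_setof f t); split; first by exists y1.
  by move=> [y' [hy' ty]]; rewrite (ult_value_unique h hy') //; exact: al_refl.
split; first exact: key.
by move=> ->; rewrite -(key _ hy0).
Qed.

Lemma dtm_cls_of (f : (nat -> N) -> N) : dtm f -> dtm (fun e => cls_of (f e)).
Proof.
apply: (dtm_fun1 (F := cls_of)).
apply: (@dtm_setof _ (fun e t => exists y, ult_value univ d D (e 0) y /\ t ∈ y)).
  by move=> e; exact: cls_of_setof.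
by dfn_tac.
Qed.

Lemma cls_ofP g t : is_fun g d ->
  t ∈ cls_of g <-> exists h, is_fun h d /\ al d D (fun i => ap h i ∈ ap g i) /\ t = cls_of h.
Proof.
move=> gf; have [F [c [_ [_ [Ff [Fd [cf [cv a]]]]]]]] : ult_value univ d D g (cls_of g).
  by apply/ult_value_cls.
have val k : k ∈ F -> ap c k = cls_of k.
  move=> kF; apply/ult_value_cls; first exact: Ff.
  by exists F, c; do 6 split=> //; exact: (app_ap cf).
rewrite (cv _ _ a t); split.
  move=> [h [hF [/ult_mem_al hg ah]]]; exists h; split; first exact: Ff.
  split; first by apply: hg => //; exact: Ff.
  by rewrite -val // (ap_app cf ah).
move=> [h [hf [hg ->]]].
have [|h' [hF' /ult_eq_al hh']] := Fd g h (app_dom cf a) I hf; first by apply/ult_mem_al.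
have {}hh' := hh' hf (Ff _ hF').
exists h'; split=> //; split.
  apply/ult_mem_al => //; first exact: Ff.
  by apply: (al_mono2 hD _ hg hh'); [dfn_tac|move=> i _ ? <-].
suff -> : cls_of h = ap c h' by exact: (app_ap cf).
rewrite val //; have h1 : ult_value univ d D h (cls_of h) by apply/ult_value_cls.
have h2 : ult_value univ d D h' (cls_of h') by apply/ult_value_cls => //; exact: Ff.
exact: (ult_value_unique h1 h2 hf (Ff _ hF') hh').
Qed.

(** Injectivity of the collapse goes by induction on the common value. If [f] and [g] differ almost
    everywhere, a chosen element of the difference represents a member of one class, hence of the
    other, and the induction hypothesis at this member gives a contradiction. *)
Lemma cls_of_eq f g : is_fun f d -> is_fun g d ->
  cls_of f = cls_of g <-> al d D (fun i => ap f i = ap g i).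
Proof.
move=> ff gf; split; last first.
  have h1 : ult_value univ d D f (cls_of f) by apply/ult_value_cls.
  have h2 : ult_value univ d D g (cls_of g) by apply/ult_value_cls.
  exact: (ult_value_unique h1 h2).
pose (Q := fun y => forall f g, is_fun f d -> is_fun g d -> cls_of f = y -> cls_of g = y ->
   al d D (fun i => ap f i = ap g i)).
have hQ : forall y, Q y; last by move=> e; exact: (hQ (cls_of g)).
apply: eps_ind; first by rewrite /Q; repeat first [apply: dtm_cls_of | dfn_unfold; dfn_step].
move=> y IH {}f {}g {}ff {}gf fy gy; apply: NNPP => no.
have half f1 g1 : is_fun f1 d -> is_fun g1 d -> cls_of f1 = y -> cls_of g1 = y ->
    ~ al d D (fun i => exists z, z ∈ ap f1 i /\ ~ z ∈ ap g1 i).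
  move=> ff1 gf1 e1 e2 hal.
  have [||h [hf hh]] := @al_choice _ d D hD (fun i z => z ∈ ap f1 i /\ ~ z ∈ ap g1 i) (Un (Un (Un f1))).
  - by dfn_tac.
  - apply: (al_mono hD _ _ hal); first by dfn_tac.
    move=> i id' [z [zf zg]]; exists z; split=> //.
    by apply/UnP; exists (ap f1 i); split=> //; have /app_op/op_mem_Un [] := app_ap ff1 id'.
  have hy : cls_of h ∈ y.
    rewrite -e1; apply/cls_ofP => //; exists h; do 2 split=> //.
    by apply: (al_mono hD _ _ hh); [dfn_tac|move=> i _ []].
  move: (hy); rewrite -e2 => /(cls_ofP _ gf1) [k [kf [kg e]]].
  have hk := IH _ hy h k hf kf eq_refl (eq_sym e).
  apply: (al_contra hD (al_and hD hh (al_and hD kg hk))) => i _ [[_ n] [m e']].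
  by apply: n; rewrite e'.
case: (al_or hD (Q := fun i => exists z, z ∈ ap f i /\ ~ z ∈ ap g i)
  (R := fun i => exists z, z ∈ ap g i /\ ~ z ∈ ap f i)).
- by dfn_tac.
- by dfn_tac.
- have dn : dfn (fun e => ap f (e 0) = ap g (e 0)) by dfn_tac.
  move/(al_not hD dn): no; apply: al_mono => //; first by dfn_tac.
  move=> i _ ne; apply: NNPP => no; apply: ne; apply: set_ext => z; split=> hz.
    by apply: NNPP => nz; apply: no; left; exists z.
  by apply: NNPP => nz; apply: no; right; exists z.
- exact: half.
- exact: half.
Qed.

Lemma cls_of_mem f g : is_fun f d -> is_fun g d ->
  cls_of f ∈ cls_of g <-> al d D (fun i => ap f i ∈ ap g i).
Proof.
move=> ff gf; rewrite cls_ofP //; split; last by exists f.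
move=> [h [hf [hg /(cls_of_eq ff hf) e]]].
by apply: (al_mono2 hD _ hg e); [dfn_tac|move=> i _ ? ->].
Qed.

End Collapse.

(** * Normal measures *)

Section Normal.

Context {N : zfc_model}.

Implicit Types a b c d f g h i j p q r s v w x y z A B G S T X Y Z : N.

Variables (k D : N).
Hypothesis hk : normal_measure univ k D.

Notation "∀* i , Q" := (al k D (fun i => Q)) (at level 200, i name).

Lemma nm_uf : ultrafilter univ k D.
Proof. by have [_ [[? _] _]] := hk. Qed.

Lemma nm_ord : is_ord k.
Proof. by have [[? _] _] := hk. Qed.

Lemma nm_omega : exists w, is_omega w /\ w ∈ k /\ closed_under_seq univ k D w.
Proof.
have [[_ [w [hw wk]]] [[_ [_ hc]] _]] := hk.
by exists w; do 2 split=> //; exact: hc.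
Qed.

Hint Resolve nm_uf : core.

Lemma nm_comp (Q : N -> N -> Prop) c : dfn (fun e => Q (e 0) (e 1)) -> c ∈ k ->
  (forall x, x ∈ c -> ∀* i, Q x i) -> ∀* i, forall x, x ∈ c -> Q x i.
Proof.
move=> dQ ck h; have [_ [[_ [_ hc]] _]] := hk.
have dQ1 x : dfn (fun e => Q x (e 0)) by apply: (dfn_rel2 (R := Q) dQ (dtm_const x) (dtm_var 0)).
have ds : dtm (fun e => sep k (Q (e 0))).
  by apply: dtm_sep; [exact: dtm_const|exact: (dfn_rel2 (R := Q) dQ (dtm_var 1) (dtm_var 0))].
have dQ' : dfn (fun e => forall x, x ∈ c -> Q x (e 0)).
  have dQv n m : dfn (fun e => Q (e n) (e m)) := dfn_rel2 (R := Q) dQ (dtm_var n) (dtm_var m).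
  by repeat first [exact: dQv | dfn_step].
have [|A [AD hA]] := hc c ck (fn c (fun x => sep k (Q x))) I.
  split; first exact: fn_fun.
  by move=> x y /(fn_app ds) [xc ->]; apply/(al_sep k D (dQ1 x)); exact: h.
apply: (al_mono nm_uf dQ' (Q := fun i => i ∈ A)); last first.
  by exists A; split=> // z; split=> [/[dup] /hA [? _] //|[]].
move=> i ik /hA [_ hi] x xc; have : i ∈ sep k (Q x) by apply: (hi x); apply/(fn_app ds).
by move/(sepP (dQ1 x)) => [].
Qed.

(** The diagonal intersection, read as an exchange of quantifiers. *)
Lemma nm_normal (Q : N -> N -> Prop) : dfn (fun e => Q (e 0) (e 1)) ->
  (forall x, x ∈ k -> ∀* i, Q x i) -> ∀* i, forall x, x ∈ i -> Q x i.
Proof.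
move=> dQ h; have [_ [_ hc]] := hk.
have dQ1 x : dfn (fun e => Q x (e 0)) by apply: (dfn_rel2 (R := Q) dQ (dtm_const x) (dtm_var 0)).
have ds : dtm (fun e => sep k (Q (e 0))).
  by apply: dtm_sep; [exact: dtm_const|exact: (dfn_rel2 (R := Q) dQ (dtm_var 1) (dtm_var 0))].
have dQ' : dfn (fun e => forall x, x ∈ e 0 -> Q x (e 0)).
  have dQv n m : dfn (fun e => Q (e n) (e m)) := dfn_rel2 (R := Q) dQ (dtm_var n) (dtm_var m).
  by repeat first [exact: dQv | dfn_step].
have [|A [AD hA]] := hc (fn k (fun x => sep k (Q x))) I.
  split; first exact: fn_fun.
  by move=> x y /(fn_app ds) [xc ->]; apply/(al_sep k D (dQ1 x)); exact: h.
apply: (al_mono nm_uf dQ' (Q := fun i => i ∈ A)); last first.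
  by exists A; split=> // z; split=> [/[dup] /hA [? _] //|[]].
move=> i ik /hA [_ hi] x xi; have : i ∈ sep k (Q x).
  by apply: (hi x) => //; apply/(fn_app ds); split=> //; exact: (ord_trans nm_ord xi).
by move/(sepP (dQ1 x)) => [].
Qed.

(** Fodor's principle for the measure, with a relation in place of a regressive function: the
    contrapositive of the diagonal intersection. *)
Lemma nm_regress (Q : N -> N -> Prop) : dfn (fun e => Q (e 0) (e 1)) ->
  (∀* i, exists x, x ∈ i /\ Q x i) -> exists x, x ∈ k /\ ∀* i, Q x i.
Proof.
move=> dQ h; apply: NNPP => no.
have dQ1 x : dfn (fun e => Q x (e 0)) by apply: (dfn_rel2 (R := Q) dQ (dtm_const x) (dtm_var 0)).
have := @nm_normal (fun x i => ~ Q x i) (dfn_not dQ).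
case=> [x xk|A [AD hA]].
  by apply/(al_not nm_uf (dQ1 x)) => hx; apply: no; exists x.
have hA' : al k D (fun i => forall x, x ∈ i -> ~ Q x i) by exists A.
by apply: (al_contra nm_uf (al_and nm_uf h hA')) => i _ [[x [xi Qx]] /(_ x xi)].
Qed.

Lemma nm_regress_c (Q : N -> N -> Prop) c : dfn (fun e => Q (e 0) (e 1)) -> c ∈ k ->
  (∀* i, exists x, x ∈ c /\ Q x i) -> exists x, x ∈ c /\ ∀* i, Q x i.
Proof.
move=> dQ ck h; apply: NNPP => no.
have dQ1 x : dfn (fun e => Q x (e 0)) by apply: (dfn_rel2 (R := Q) dQ (dtm_const x) (dtm_var 0)).
have := @nm_comp (fun x i => ~ Q x i) c (dfn_not dQ) ck.
case=> [x xc|A [AD hA]].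
  by apply/(al_not nm_uf (dQ1 x)) => hx; apply: no; exists x.
have hA' : al k D (fun i => forall x, x ∈ c -> ~ Q x i) by exists A.
by apply: (al_contra nm_uf (al_and nm_uf h hA')) => i _ [[x [xi Qx]] /(_ x xi)].
Qed.

Lemma nm_neq x : ∀* i, i <> x.
Proof.
have de : dfn (fun e => e 0 = x) by dfn_tac.
apply/(al_not nm_uf de) => -[A [AD hA]].
have [_ [[_ [np _]] _]] := hk; apply: (np x); exists A; split=> // z.
split; first by move/hA => [].
move=> ->; apply: NNPP => nx; have [_ [_ [_ [ne _]]]] := nm_uf.
by apply: (ne A AD) => t /[dup] tA /hA [_ e]; apply: nx; rewrite -e.
Qed.

Lemma nm_tail x : x ∈ k -> ∀* i, x ∈ i.
Proof.
move=> xk; have ox := ord_mem nm_ord xk.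
have h : ∀* i, forall y, y ∈ x -> i <> y.
  by apply: nm_comp => // [|y _]; [dfn_tac|exact: nm_neq].
apply: (al_mono2 nm_uf _ h (nm_neq x)); first by dfn_tac.
move=> i ik ni nx; case: (ord_trich ox (ord_mem nm_ord ik)) => [//|[e|ix]].
  by case: nx.
by case: (ni i ix).
Qed.

Lemma nm_limit : is_limit k.
Proof.
split; first exact: nm_ord.
have [w [_ [wk _]]] := nm_omega; split; first by exists w.
move=> x xk; have [i [ik xi]] := al_ex nm_uf (nm_tail xk); by exists i.
Qed.

Definition cls f := cls_of k D f.

Lemma dtm_cls (f : (nat -> N) -> N) : dtm f -> dtm (fun e => cls (f e)).
Proof. by have [w [hw [_ hc]]] := nm_omega; apply: (dtm_cls_of nm_uf hw hc). Qed.

Lemma clsP g t : is_fun g k ->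
  t ∈ cls g <-> exists h, is_fun h k /\ (∀* i, ap h i ∈ ap g i) /\ t = cls h.
Proof. by have [w [hw [_ hc]]] := nm_omega; apply: (cls_ofP nm_uf hw hc). Qed.

Lemma cls_eq f g : is_fun f k -> is_fun g k -> cls f = cls g <-> ∀* i, ap f i = ap g i.
Proof. by have [w [hw [_ hc]]] := nm_omega; apply: (cls_of_eq nm_uf hw hc). Qed.

Lemma cls_mem f g : is_fun f k -> is_fun g k -> cls f ∈ cls g <-> ∀* i, ap f i ∈ ap g i.
Proof. by have [w [hw [_ hc]]] := nm_omega; apply: (cls_of_mem nm_uf hw hc). Qed.

Lemma ult_value_E f y : is_fun f k -> ult_value univ k D f y <-> y = cls f.
Proof. by have [w [hw [_ hc]]] := nm_omega; apply: (ult_value_cls nm_uf hw hc). Qed.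

Definition const x := fn k (fun _ => x).
Definition idf := fn k (fun i => i).

Lemma const_fun x : is_fun (const x) k.
Proof. by apply: fn_fun; dfn_tac. Qed.

Lemma ap_const x i : i ∈ k -> ap (const x) i = x.
Proof. by move=> ik; rewrite ap_fn //; dfn_tac. Qed.

Lemma idf_fun : is_fun idf k.
Proof. by apply: fn_fun; dfn_tac. Qed.

Lemma ap_idf i : i ∈ k -> ap idf i = i.
Proof. by move=> ik; rewrite ap_fn //; dfn_tac. Qed.

Hint Resolve const_fun idf_fun : core.

Lemma const_map x f : is_map f k (fun z => z = x) <-> f = const x.
Proof.
split.
  move=> [ff fx]; apply: (fun_ext ff (const_fun x)) => i ik; rewrite ap_const //.
  exact: fx (app_ap ff ik).
move=> ->; split=> // i y; have dx : dtm (fun _ : nat -> N => x) by exact: dtm_const.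
by move/(fn_app dx) => [].
Qed.

Lemma ult_embedding_E x y : ult_embedding univ k D x y <-> y = cls (const x).
Proof.
split; first by move=> [f [_ [/const_map -> /ult_value_E]]]; apply.
by move=> ->; exists (const x); do 2 (split; first by [|apply/const_map]); apply/ult_value_E.
Qed.

Lemma cls_trans f y : is_fun f k -> y ∈ cls f -> exists g, is_fun g k /\ y = cls g.
Proof. by move=> ff /clsP [] // g [gf [_ ->]]; exists g. Qed.

Lemma al_fn (F : N -> N) (R : N -> N -> Prop) : dtm (fun e => F (e 0)) ->
  (∀* i, R (ap (fn k F) i) i) <-> ∀* i, R (F i) i.
Proof. by move=> dF; apply: al_iff => i ik; rewrite ap_fn. Qed.

Lemma cls_const_mem f A : is_fun f k -> cls f ∈ cls (const A) <-> ∀* i, ap f i ∈ A.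
Proof.
move=> ff; rewrite cls_mem //; apply: al_iff => i ik; by rewrite ap_const.
Qed.

Lemma cls_up f g : is_fun f k -> is_fun g k ->
  cls (fn k (fun i => up (ap f i) (ap g i))) = up (cls f) (cls g).
Proof.
move=> ff gf; have du : dtm (fun e => up (ap f (e 0)) (ap g (e 0))) by dfn_tac.
apply: set_ext => t; rewrite clsP; last exact: fn_fun.
rewrite upP; split.
  move=> [h [hf [/(al_fn (fun y i => ap h i ∈ y) du) hh ->]]].
  have {}hh : ∀* i, ap h i = ap f i \/ ap h i = ap g i.
    by apply: (al_mono nm_uf _ _ hh); [dfn_tac|move=> i _ /upP].
  case: (al_or nm_uf _ _ hh) => [||e|e]; [dfn_tac|dfn_tac|left|right]; exact/cls_eq.
case=> ->; [exists f|exists g]; split=> //; split=> //;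
  apply/(al_fn (fun y i => ap _ i ∈ y) du); apply: (al_all nm_uf); try dfn_tac;
  by move=> i _; apply/upP; auto.
Qed.

Lemma cls_op f g : is_fun f k -> is_fun g k ->
  cls (fn k (fun i => op (ap f i) (ap g i))) = op (cls f) (cls g).
Proof.
move=> ff gf.
have d1 : dtm (fun e => up (ap f (e 0)) (ap f (e 0))) by dfn_tac.
have d2 : dtm (fun e => up (ap f (e 0)) (ap g (e 0))) by dfn_tac.
have d3 : dtm (fun e => op (ap f (e 0)) (ap g (e 0))) by dfn_tac.
rewrite /op /sg -!cls_up //; try exact: fn_fun.
congr cls; apply: fun_ext; [exact: fn_fun|apply: fn_fun; dfn_tac|].
by move=> i ik; rewrite !ap_fn //; dfn_tac.
Qed.

Lemma cls_app p x y : is_fun p k -> is_fun x k -> is_fun y k ->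
  app (cls p) (cls x) (cls y) <-> ∀* i, app (ap p i) (ap x i) (ap y i).
Proof.
move=> pf xf yf; have d3 : dtm (fun e => op (ap x (e 0)) (ap y (e 0))) by dfn_tac.
rewrite app_op -cls_op // cls_mem //; last exact: fn_fun.
by apply: al_iff => i ik; rewrite ap_fn // app_op.
Qed.

Lemma cls_op_inv f x y : is_fun f k -> cls f = op x y ->
  exists g h, is_fun g k /\ is_fun h k /\ x = cls g /\ y = cls h.
Proof.
move=> ff e.
have [u [uf eu]] : exists u, is_fun u k /\ up x y = cls u.
  by apply: (cls_trans ff); rewrite e; apply/upP; right.
have [|g [gf ->]] := cls_trans uf (y := x); first by rewrite -eu; apply/upP; left.
have [|h [hf ->]] := cls_trans uf (y := y); first by rewrite -eu; apply/upP; right.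
by exists g, h.
Qed.

Lemma cls_app_inv p x y : is_fun p k -> app (cls p) x y ->
  exists g h, is_fun g k /\ is_fun h k /\ x = cls g /\ y = cls h /\
    ∀* i, app (ap p i) (ap g i) (ap h i).
Proof.
move=> pf a; have a' : op x y ∈ cls p by apply/app_op.
have [q [qf e]] := cls_trans pf a'.
have [g [h [gf [hf [eg eh]]]]] := cls_op_inv qf (eq_sym e).
by exists g, h; do 4 split=> //; apply/cls_app => //; rewrite -eg -eh.
Qed.

Lemma cls_const_op x y : cls (const (op x y)) = op (cls (const x)) (cls (const y)).
Proof.
rewrite -cls_op //; congr cls.
have d3 : dtm (fun e => op (ap (const x) (e 0)) (ap (const y) (e 0))) by dfn_tac.
apply: (fun_ext (const_fun _)); first exact: fn_fun.
by move=> i ik; rewrite ap_fn // !ap_const.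
Qed.

(** [x] is not moved as a set: [j(x) = j''x]. *)
Definition small x := forall h, is_fun h k -> (∀* i, ap h i ∈ x) ->
  exists y, y ∈ x /\ ∀* i, ap h i = y.

Definition fixed x := cls (const x) = x.

Lemma small_fixed x : small x -> (forall y, y ∈ x -> fixed y) -> fixed x.
Proof.
move=> sx hx; apply: set_ext => t; rewrite clsP //; split.
  move=> [h [hf [hh ->]]].
  have [|y [yx e]] := sx h hf.
    by apply: (al_mono nm_uf _ _ hh); [dfn_tac|move=> i ik; rewrite ap_const].
  have -> // : cls h = y; rewrite -(hx y yx); apply/cls_eq => //.
  by apply: (al_mono nm_uf _ _ e); [dfn_tac|move=> i ik; rewrite ap_const].
move=> tx; exists (const t); split=> //; split; last by rewrite (hx t tx).
by apply: (al_all nm_uf); [dfn_tac|move=> i ik; rewrite !ap_const].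
Qed.

Lemma small_ord c : c ∈ k -> small c.
Proof.
move=> ck h hf hh; apply: (@nm_regress_c (fun y i => ap h i = y)) => //; first by dfn_tac.
by apply: (al_mono nm_uf _ _ hh); [dfn_tac|move=> i ik hi; exists (ap h i)].
Qed.

Lemma small_up a b : small (up a b).
Proof.
move=> h hf hh; have {}hh : ∀* i, ap h i = a \/ ap h i = b.
  by apply: (al_mono nm_uf _ _ hh); [dfn_tac|move=> i _ /upP].
case: (al_or nm_uf _ _ hh) => [||e|e]; [dfn_tac|dfn_tac|exists a|exists b];
  split=> //; apply/upP; auto.
Qed.

Lemma fixed_ord c : c ∈ k -> fixed c.
Proof.
move: c; apply: (@eps_ind _ (fun c => c ∈ k -> fixed c)).
  by rewrite /fixed /const; repeat first [apply: dtm_cls | dfn_step].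
move=> c IH ck; apply: small_fixed; first exact: small_ord.
by move=> y yc; apply: IH => //; exact: (ord_trans nm_ord yc).
Qed.

Lemma fixed_up a b : fixed a -> fixed b -> fixed (up a b).
Proof.
move=> fa fb; apply: small_fixed; first exact: small_up.
by move=> y /upP [] ->.
Qed.

Lemma fixed_op a b : fixed a -> fixed b -> fixed (op a b).
Proof. by move=> fa fb; rewrite /fixed cls_const_op fa fb. Qed.

(** Members of the class of the identity are represented by regressive functions, which are constant
    by normality, and ordinals below [k] are not moved. *)
Lemma cls_idf : cls idf = k.
Proof.
apply: set_ext => t; rewrite clsP //; split.
  move=> [h [hf [hh ->]]].
  have [||x [xk e]] := @nm_regress (fun x i => ap h i = x).
    by dfn_tac.
    apply: (al_mono nm_uf _ _ hh); first by dfn_tac.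
    by move=> i ik; rewrite ap_idf // => hi; exists (ap h i).
  have -> // : cls h = x; rewrite -(fixed_ord xk); apply/cls_eq => //.
  by apply: (al_mono nm_uf _ _ e); [dfn_tac|move=> i ik; rewrite ap_const].
move=> tk; exists (const t); split=> //; split; last by rewrite (fixed_ord tk).
by apply: (al_mono nm_uf _ _ (nm_tail tk)); [dfn_tac|move=> i ik; rewrite ap_const // ap_idf].
Qed.

(** Otherwise a fixed [b] carries, for almost all [i], an unbounded map into [i]. Each of its values
    is regressive in [i], hence constant. As [b] is below [k], a single [c] in [k] bounds all these
    constants, and [c] lies below almost all [i]. *)
Lemma nm_regular : ∀* i, forall b f, b ∈ i -> is_map f b (fun y => y ∈ i) ->
  exists c, c ∈ i /\ forall x y, app f x y -> y ∈ c.
Proof.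
have dm : dfn (fun e => forall b f, b ∈ e 0 -> is_map f b (fun y => y ∈ e 0) ->
  exists c, c ∈ e 0 /\ forall x y, app f x y -> y ∈ c) by dfn_tac.
apply: NNPP => /(al_not nm_uf dm) h.
have [||b [bk {}h]] := @nm_regress (fun b i => exists f, f ∈ pw (prod k k) /\
  is_map f b (fun y => y ∈ i) /\ forall c, c ∈ i -> exists x y, app f x y /\ ~ y ∈ c).
- by dfn_tac.
- apply: (al_mono nm_uf _ _ h); first by dfn_tac.
  move=> i ik no; apply: NNPP => no'; apply: no => b f bi [ff fm].
  apply: NNPP => nc; apply: no'; exists b; split=> //; exists f; split.
    apply/pwP => p pf; have [x [y [xb +]]] := proj1 ff p pf; move/is_opair_op => e.
    move: pf; rewrite e -app_op => a; apply/op_prod.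
    have bk := ord_trans nm_ord bi ik.
    by split; [exact: (ord_trans nm_ord xb)|exact: (ord_trans nm_ord (fm _ _ a))].
  split; first by split.
  move=> c ci; apply: NNPP => nx; apply: nc; exists c; split=> // x y a.
  by apply: NNPP => ny; apply: nx; exists x, y.
have [||h0 [h0f hh]] := @al_choice _ k D nm_uf (fun i f => is_map f b (fun y => y ∈ i) /\
  forall c, c ∈ i -> exists x y, app f x y /\ ~ y ∈ c) (pw (prod k k)).
- by dfn_tac.
- exact: h.
have key x : x ∈ b -> ∀* j, ∀* i, ap (ap h0 i) x ∈ j.
  move=> xb.
  have [||v [vk hv]] := @nm_regress (fun v i => ap (ap h0 i) x = v); first by dfn_tac.
    apply: (al_mono nm_uf _ _ hh); first by dfn_tac.
    move=> i ik [[hf hm] _]; exists (ap (ap h0 i) x); split=> //.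
    exact: hm (app_ap hf xb).
  apply: (al_mono nm_uf _ _ (nm_tail vk)); first by dfn_tac.
  move=> j jk vj; apply: (al_mono nm_uf _ _ hv); first by dfn_tac.
  by move=> i _ ->.
have [|c [ck hc]] := al_ex nm_uf (nm_comp (Q := fun x j => ∀* i, ap (ap h0 i) x ∈ j) _ bk key).
  by dfn_tac.
have hc' : ∀* i, forall x, x ∈ b -> ap (ap h0 i) x ∈ c by apply: nm_comp => //; dfn_tac.
apply: (al_contra nm_uf (al_and nm_uf hh (al_and nm_uf hc' (nm_tail ck)))).
move=> i ik [[[hf hm] hn] [hi ci]]; have [x [y [a ny]]] := hn c ci.
by apply: ny; rewrite -(ap_app hf a); apply: hi; exact: (app_dom hf a).
Qed.

(** Otherwise, for almost all [i], there is an injection of [i] into the subsets of a fixed [b]. Its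
    limit [T] takes, by completeness, the same value on [b] at almost all [x]; two such points then
    have the same image under almost all of the injections. *)
Lemma nm_strong_limit : ∀* i, forall b, b ∈ i ->
  ~ exists f, is_map f i (fun y => subset y b) /\
      forall x x' y, app f x y -> app f x' y -> x = x'.
Proof.
have dm : dfn (fun e => forall b, b ∈ e 0 ->
  ~ exists f, is_map f (e 0) (fun y => subset y b) /\
      forall x x' y, app f x y -> app f x' y -> x = x') by dfn_tac.
apply: NNPP => /(al_not nm_uf dm) h.
have [||b [bk {}h]] := @nm_regress (fun b i => exists f, f ∈ pw (prod k (pw k)) /\
  is_map f i (fun y => subset y b) /\ forall x x' y, app f x y -> app f x' y -> x = x').
- by dfn_tac.
- apply: (al_mono nm_uf _ _ h); first by dfn_tac.
  move=> i ik no; apply: NNPP => no'; apply: no => b bi [f [[ff fm] fi]].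
  apply: no'; exists b; split=> //; exists f; split=> //.
  apply/pwP => p pf; have [x [y [xb +]]] := proj1 ff p pf; move/is_opair_op => e.
  move: pf; rewrite e -app_op => a; apply/op_prod; split; first exact: (ord_trans nm_ord xb).
  apply/pwP => z /(fm _ _ a) zb.
  by apply: (ord_trans nm_ord zb); exact: (ord_trans nm_ord bi).
have [||h0 [h0f hh]] := @al_choice _ k D nm_uf (fun i f => is_map f i (fun y => subset y b) /\
  forall x x' y, app f x y -> app f x' y -> x = x') (pw (prod k (pw k))).
- by dfn_tac.
- exact: h.
pose (T := fun x y => ∀* i, y ∈ ap (ap h0 i) x).
have hT : ∀* x, forall y, y ∈ b -> (T x y <-> ∀* x, T x y).
  apply: (@nm_comp (fun y x => T x y <-> ∀* x, T x y)) => //; first by rewrite /T; dfn_tac.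
  move=> y yb; have dT : dfn (fun e => T (e 0) y) by rewrite /T; dfn_tac.
  have dT' : dfn (fun e => T (e 0) y <-> ∀* x, T x y) by rewrite /T; dfn_tac.
  case: (classic (∀* x, T x y)) => hy.
    by apply: (al_mono nm_uf dT' _ hy) => x _ hx; split.
  by move/(al_not nm_uf dT): (hy); apply: (al_mono nm_uf dT') => x _ hx; split.
have [x [xk hx]] := al_ex nm_uf hT.
have [x' [x'k [hx' xx']]] := al_ex nm_uf (al_and nm_uf hT (nm_tail xk)).
have dec z : ∀* i, forall y, y ∈ b -> (y ∈ ap (ap h0 i) z <-> T z y).
  apply: (@nm_comp (fun y i => y ∈ ap (ap h0 i) z <-> T z y)) => //; first by rewrite /T; dfn_tac.
  move=> y yb; have dT : dfn (fun e => y ∈ ap (ap h0 (e 0)) z) by dfn_tac.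
  have dT' : dfn (fun e => y ∈ ap (ap h0 (e 0)) z <-> T z y) by rewrite /T; dfn_tac.
  case: (classic (T z y)) => hy.
    by apply: (al_mono nm_uf dT' _ hy) => i _ hi; split.
  by move/(al_not nm_uf dT): (hy); apply: (al_mono nm_uf dT') => i _ hi; split.
apply: (al_contra nm_uf (al_and nm_uf hh (al_and nm_uf (al_and nm_uf (dec x) (dec x'))
  (al_and nm_uf (nm_tail xk) (nm_tail x'k))))).
move=> i ik [[[hf hm] inj] [[d1 d2] [xi x'i]]].
have a := app_ap hf xi; have a' := app_ap hf x'i.
have e : ap (ap h0 i) x = ap (ap h0 i) x'.
  apply: set_ext => y; split=> hy.
    have yb := hm _ _ a y hy; apply/(d2 y yb)/(hx' y yb)/(hx y yb)/(d1 y yb) => //.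
  have yb := hm _ _ a' y hy; apply/(d1 y yb)/(hx y yb)/(hx' y yb)/(d2 y yb) => //.
have ex : x = x' by apply: (inj _ _ _ a); rewrite e.
by apply: (@mem_irrefl _ x); rewrite {2}ex.
Qed.

Lemma nm_inaccessible : ∀* i, inaccessible univ i.
Proof.
have [w [hw [wk _]]] := nm_omega.
apply: (al_mono nm_uf _ _ (al_and nm_uf (nm_tail wk) (al_and nm_uf nm_regular nm_strong_limit))).
  by dfn_tac.
move=> i ik [wi [hr hl]]; split; first by split; [exact: (ord_mem nm_ord)|exists w].
split; first by move=> b f bi _; exact: hr.
by move=> b bi [f [_ hf]]; apply: (hl b bi); exists f.
Qed.

End Normal.

(** * Self-reductions of ultrafilters *)

Section SelfReduction.

Context {N : zfc_model}.

Implicit Types a b c d f g h i j k p q r s v w x y z A B D G S T X Y Z : N.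

(** With [x ∈ h X <-> H X x], the map [h] is super-Lipschitz; the set
    [Z = {x | x ∉ h Z}] is defined by recursion. *)
Lemma no_self_reduction k D (H : N -> N -> Prop) :
  is_ord k -> ultrafilter univ k D -> dfn (fun e => H (e 0) (e 1)) ->
  (forall X x, subset X k -> x ∈ k -> H X x <-> H (sep X (fun z => z ∈ x)) x) ->
  ~ (forall X, subset X k -> X ∈ D <-> al k D (H X)).
Proof.
move=> ok uf dH lipH red.
have dHv (t u : (nat -> N) -> N) : dtm t -> dtm u -> dfn (fun e => H (t e) (u e)).
  exact: (dfn_rel2 (R := H)).
(* [ap f x] codes a truth value: it is [sg emp] when [x] belongs to [Z] and empty otherwise. *)
have [|f [ff hf]] := @mem_recursion _ k
    (fun x h => sep (sg emp) (fun _ => ~ H (sep x (fun y => emp ∈ ap h y)) x)).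
  by repeat first [apply: dHv | dfn_step].
have dz : dfn (fun e => emp ∈ ap f (e 0)) by dfn_tac.
pose (Z := sep k (fun x => emp ∈ ap f x)).
have Zk : subset Z k by move=> z /(sepP dz) [].
have sepc a (P : Prop) z : z ∈ sep a (fun _ => P) <-> z ∈ a /\ P.
  by exact: (sepP (Q := fun _ => P) (dfn_prop P) z).
have ZP x : x ∈ k -> x ∈ Z <-> ~ H Z x.
  move=> xk; rewrite (lipH Z x) // (sepP dz) hf //.
  set h := fn _ _; set X := sep x _; set Y := sep Z _.
  have e : X = Y.
    have d1 : dfn (fun e => emp ∈ ap h (e 0)) by dfn_tac.
    have d2 : dfn (fun e => e 0 ∈ x) by dfn_tac.
    apply: set_ext => z; rewrite (sepP d1) (sepP d2) (sepP dz); split.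
      move=> [zx]; have zk := ord_trans ok zx xk; rewrite ap_fn //; last first.
        by apply/(sepP d2).
      by dfn_tac.
    move=> [[zk hz] zx]; split=> //; rewrite ap_fn //; last by apply/(sepP d2).
    by dfn_tac.
  rewrite sepc sgP e; tauto.
(* By the reduction, [Z] is in [D] exactly when almost all [x] satisfy [H Z x]; by the choice of
   [Z], exactly when almost all fail it. *)
have h1 := red Z Zk; have dZ : dfn (fun e => H Z (e 0)) by apply: dHv; dfn_tac.
have h2 : Z ∈ D <-> al k D (fun x => ~ H Z x).
  have e : Z = sep k (fun x => ~ H Z x).
    by apply: set_ext => z; rewrite (sepP (dfn_not dZ)); split; [move=> hz; have zk := Zk z hz; split=> //; exact/(ZP z zk)|move=> [zk /(ZP z zk)]].
  by rewrite {1}e; symmetry; apply: al_sep; exact: dfn_not.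
move: h2; rewrite al_not //; tauto.
Qed.

End SelfReduction.

(** * Ordinal sums and the product measure *)

Section Plus.

Context {N : zfc_model}.

Implicit Types a b c d f g h i j k p q r s v w x y z A B D G S T X Y Z : N.

Variables (k D : N).
Hypothesis hk : normal_measure univ k D.

Notation "∀* i , Q" := (al k D (fun i => Q)) (at level 200, i name).

(** Ordinal addition as a definable term. The recursion equation is imposed below [k] only. *)
Definition is_plus (P : N -> N -> N) : Prop :=
  dtm (fun e => P (e 0) (e 1)) /\
  forall b y, b ∈ k -> y ∈ k -> forall z, z ∈ P b y <-> z ∈ b \/ exists x, x ∈ y /\ z = P b x.

(** Recursion on the second summand, the stage [y] being the whole map that sends [b] to [b + y]. *)
Lemma plus_ex : exists P, is_plus P.
Proof.
have [|f [ff hf]] := @mem_recursion _ k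
    (fun y h => fn k (fun b => cup b (rep y (fun x => ap (ap h x) b)))).
  by dfn_tac.
exists (fun b y => ap (ap f y) b); split; first by dfn_tac.
move=> b y bk yk z; rewrite {1}hf // ap_fn //; last by dfn_tac.
rewrite cupP repP; last by dfn_tac.
have d2 : dfn (fun e => e 0 ∈ y) by dfn_tac.
have e x : x ∈ y -> ap (fn (sep k (fun x => x ∈ y)) (ap f)) x = ap f x.
  move=> xy; rewrite ap_fn //; first by dfn_tac.
  by apply/(sepP d2); split=> //; exact: (ord_trans (nm_ord hk) xy).
split; case; auto; move=> [x [xy ->]]; right; exists x; split=> //; by rewrite e.
Qed.

Section PlusTheory.

Variable P : N -> N -> N.
Hypothesis hP : is_plus P.

Let dP : dtm (fun e => P (e 0) (e 1)) := proj1 hP.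

Lemma dtm_plus (t u : (nat -> N) -> N) : dtm t -> dtm u -> dtm (fun e => P (t e) (u e)).
Proof. exact: (dtm_fun2 dP). Qed.

Ltac plus_dfn := dfn_unfold; repeat first [apply: dtm_plus | dfn_step]; cbv beta; try done.

Let uf := nm_uf hk.
Let ok := nm_ord hk.

Lemma plusP b y : b ∈ k -> y ∈ k -> forall z, z ∈ P b y <-> z ∈ b \/ exists x, x ∈ y /\ z = P b x.
Proof. by move=> bk yk; exact: (proj2 hP). Qed.

(** The sum is an ordinal contained in [k]. Were it equal to [k], almost all [i] would be of the
    form [b + x] with [x] below [y]; by completeness one [x] would serve almost all [i], against
    nonprincipality. *)
Lemma plus_closed b y : b ∈ k -> y ∈ k -> P b y ∈ k.
Proof.
move=> bk; move: y; apply: (@eps_ind _ (fun y => y ∈ k -> P b y ∈ k)); first by plus_dfn.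
move=> y IH yk; have ob := ord_mem ok bk.
have IH' x : x ∈ y -> P b x ∈ k by move=> xy; apply: IH => //; exact: (ord_trans ok xy).
have sub : subset (P b y) k.
  by move=> z /(plusP bk yk) [zb|[x [xy ->]]]; [exact: (ord_trans ok zb)|exact: IH'].
have tr : is_transitive (P b y).
  move=> z /(plusP bk yk) [zb|[x [xy ->]]] t tz; apply/(plusP bk yk).
    by left; exact: (ord_trans ob tz).
  have xk := ord_trans ok xy yk.
  move/(plusP bk xk): tz => [|[x' [x'x ->]]]; first by left.
  by right; exists x'; split=> //; exact: (proj1 (ord_mem ok yk) x xy).
have oP : is_ord (P b y) by split=> // z /sub zk; exact: (proj1 (ord_mem ok zk)).
case: (ord_subset oP ok sub) => // e.
have h : ∀* i, exists x, x ∈ y /\ i = P b x.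
  apply: (al_mono uf _ _ (nm_tail hk bk)); first by plus_dfn.
  move=> i ik bi; move: (ik); rewrite -{1}e => /(plusP bk yk) [ib|//].
  by case: (@mem_asym _ b i).
have [|x [xy hx]] := nm_regress_c hk (Q := fun x i => i = P b x) _ yk h; first by plus_dfn.
by case: (al_contra uf (al_and uf hx (nm_neq hk (P b x)))) => i _ [].
Qed.

Definition additively_closed b := forall x y, x ∈ b -> y ∈ b -> P x y ∈ b.

Lemma dfn_additively_closed (t : (nat -> N) -> N) : dtm t -> dfn (fun e => additively_closed (t e)).
Proof. by move=> ht; apply: (dfn_rel1 (R := additively_closed)) => //; rewrite /additively_closed; plus_dfn. Qed.

Lemma al_additively_closed : ∀* i, additively_closed i.
Proof.
have h : ∀* i, forall x, x ∈ i -> forall y, y ∈ i -> P x y ∈ i.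
  apply: (nm_normal hk (Q := fun x i => forall y, y ∈ i -> P x y ∈ i)); first by plus_dfn.
  move=> x xk; apply: (nm_normal hk (Q := fun y i => P x y ∈ i)); first by plus_dfn.
  by move=> y yk; apply: nm_tail => //; exact: plus_closed.
apply: (al_mono uf _ _ h); first exact: dfn_additively_closed (dtm_var 0).
by move=> i _ hi x y xi; exact: hi.
Qed.

(** If [b] is below [b'], then so is [b + a], because [b'] is closed under sums. The Lipschitz
    reduction uses this to read [b] and [a] off their sum. *)
Lemma plus_decomp b a b' a' : b ∈ k -> b' ∈ k -> additively_closed b -> additively_closed b' ->
  a ∈ b -> a' ∈ b' -> P b a = P b' a' -> b = b' /\ a = a'.
Proof.
move=> bk b'k cb cb' ab ab' e.
have half c x c' x' : c' ∈ k -> additively_closed c' -> c ∈ c' -> x ∈ c -> x' ∈ c' -> P c x = P c' x' -> False.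
  move=> ck' hc' cc' xc xc' ee; apply: (@mem_irrefl _ (P c x)).
  rewrite {2}ee; apply/plusP => //; first exact: (ord_trans ok xc').
  left; apply: hc' => //; exact: (ord_trans (ord_mem ok ck') xc).
case: (ord_trich (ord_mem ok bk) (ord_mem ok b'k)) => [h|[h|h]].
- by case: (half b a b' a').
- subst b'; split=> //; have ak := ord_trans ok ab bk; have ak' := ord_trans ok ab' bk.
  case: (ord_trich (ord_mem ok ak) (ord_mem ok ak')) => [h|[//|h]].
    by case: (@mem_irrefl _ (P b a)); rewrite {2}e; apply/plusP => //; right; exists a.
  by case: (@mem_irrefl _ (P b a')); rewrite -{2}e; apply/plusP => //; right; exists a'.
- by case: (half b' a' b a).
Qed.

(** An ordinal strictly between [b] and [b + a] is [b + c] with [c] below [a], so closure under sums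
    would make it a member of itself. *)
Lemma plus_gap b a x : b ∈ k -> a ∈ b -> additively_closed x -> x ∈ P b a -> x ∈ b \/ x = b.
Proof.
move=> bk ab cx xP; have ak := ord_trans ok ab bk.
have xk := ord_trans ok xP (plus_closed bk ak).
case: (ord_trich (ord_mem ok xk) (ord_mem ok bk)) => [h|[h|bx]]; auto.
move/(plusP bk ak): (xP) => [|[c [ca e]]]; first by left.
case: (@mem_irrefl _ x); rewrite {1}e; apply: cx => //.
apply: (ord_trans (ord_mem ok xk) _ bx); exact: (ord_trans (ord_mem ok bk) ca).
Qed.

End PlusTheory.

(** * The product measure and its ultrapower *)

Section Product.

Variables (k2 D2 : N).
Hypothesis hk2 : is_square k k2.
Hypothesis hD2 : is_product_measure k2 D D2.

Let uf := nm_uf hk.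
Let ok := nm_ord hk.

Lemma squareP p : p ∈ k2 <-> exists a b, a ∈ k /\ b ∈ k /\ p = op a b.
Proof.
rewrite (hk2 p); split=> -[a [b [ak [bk e]]]]; exists a, b; do 2 split=> //; exact/is_opair_op.
Qed.

Lemma op_square a b : op a b ∈ k2 <-> a ∈ k /\ b ∈ k.
Proof.
rewrite squareP; split; last by move=> [ak bk]; exists a, b.
by move=> [a' [b' [ak [bk /op_inj [-> ->]]]]].
Qed.

Lemma product_large X : subset X k2 -> (X ∈ D2 <-> ∀* a, ∀* b, op a b ∈ X).
Proof.
move=> Xk; rewrite (hD2 X).
have e a b : (exists p, p ∈ X /\ is_opair p a b) <-> op a b ∈ X.
  split; first by move=> [p [pX /is_opair_op <-]].
  by exists (op a b); split=> //; apply/is_opair_op.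
have e1 a : large D (fun b => exists p, p ∈ X /\ is_opair p a b) <-> ∀* b, op a b ∈ X.
  split=> -[A [AD hA]]; exists A; split=> // z; rewrite (hA z) e;
    split; first [by case | by move=> h; split=> //; have /op_square [] := Xk _ h].

split.
  move=> [_ [A [AD hA]]]; exists A; split=> // z; rewrite (hA z) e1; split; last by case.
  by move=> h; split=> //; have [b [bk /Xk /op_square []]] := al_ex uf h.
move=> [A [AD hA]]; split=> //; exists A; split=> // z; rewrite (hA z) e1; split; first by case.
by move=> h; split=> //; have [b [bk /Xk /op_square []]] := al_ex uf h.
Qed.

Lemma al2_iff (Q : N -> Prop) : dfn (fun e => Q (e 0)) ->
  al k2 D2 Q <-> ∀* a, ∀* b, Q (op a b).
Proof.
move=> dQ; have dQo (t : (nat -> N) -> N) : dtm t -> dfn (fun e => Q (t e)) by exact: dfn_rel1.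
have sub : subset (sep k2 Q) k2 by move=> z /(sepP dQ) [].
have e : sep k2 Q ∈ D2 <-> ∀* a, ∀* b, Q (op a b).
  rewrite (product_large sub); apply: al_iff => a ak; apply: al_iff => b bk.
  by rewrite (sepP dQ) op_square; tauto.
rewrite -e; split.
  move=> [A [AD hA]]; have -> // : sep k2 Q = A.
  by apply: set_ext => z; rewrite (sepP dQ) (hA z).
by move=> h; exists (sep k2 Q); split=> // z; exact: sepP.
Qed.

Lemma product_sub X : X ∈ D2 -> subset X k2.
Proof. by move/(hD2 X) => []. Qed.

Lemma product_uf : ultrafilter univ k2 D2.
Proof.
have dX X : dfn (fun e => al k D (fun b => op (e 0) b ∈ X)) by dfn_tac.
have dX' X a : dfn (fun e => op a (e 0) ∈ X) by dfn_tac.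
split; first by [].
split; first by move=> X; exact: product_sub.
split.
  apply/product_large; first by move=> z.
  apply: (al_all uf) => // a ak; apply: (al_all uf) => // b bk; exact/op_square.
split.
  move=> X XD e; move/(product_large (product_sub XD)): XD => h.
  by have [a [_ ha]] := al_ex uf h; have [b [_ /e]] := al_ex uf ha.
split.
  move=> X Y XD _ XY Yk; move/(product_large (product_sub XD)): XD => h.
  apply/(product_large Yk); apply: (al_mono uf _ _ h) => // a _; apply: (al_mono uf) => // b _; exact: XY.
split.
  move=> X Y XD YD; pose (Z := sep X (fun z => z ∈ Y)).
  have dz : dfn (fun e => e 0 ∈ Y) by dfn_tac.
  exists Z; split; last by move=> z; exact: (sepP dz).
  have Zk : subset Z k2 by move=> z /(sepP dz) [/(product_sub XD)].
  apply/(product_large Zk).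
  move/(product_large (product_sub XD)): XD => h; move/(product_large (product_sub YD)): YD => h'.
  apply: (al_mono2 uf _ h h') => // a _ h1 h2; apply: (al_mono2 uf _ h1 h2) => // b _ ? ?.
  exact/(sepP dz).
move=> X _ Xk; case: (classic (X ∈ D2)); first by left.
move=> nX; right; have dz : dfn (fun e => ~ e 0 ∈ X) by dfn_tac.
exists (sep k2 (fun z => ~ z ∈ X)); split; last by move=> z; exact: (sepP dz).
apply/product_large; first by move=> z /(sepP dz) [].
move/(product_large Xk): nX => /(al_not uf (dX X)); apply: (al_mono uf) => // a ak.
move/(al_not uf (dX' X a)); apply: (al_mono uf) => // b bk nb.
by apply/(sepP dz); split=> //; exact/op_square.
Qed.

Lemma product_seq w : w ∈ k -> closed_under_seq univ k2 D2 w.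
Proof.
move=> wk s _ [sf sD].
have dQ : dfn (fun e => forall i X, app s i X -> e 0 ∈ X) by dfn_tac.
apply/(al2_iff dQ).
have h : ∀* a, forall n, n ∈ w -> ∀* b, op a b ∈ ap s n.
  apply: (nm_comp hk) => //; first by dfn_tac.
  move=> n nw; have XD := sD _ _ (app_ap sf nw).
  exact/(product_large (product_sub XD)).
apply: (al_mono uf _ _ h); first by dfn_tac.
move=> a ak ha.
have {}ha : ∀* b, forall n, n ∈ w -> op a b ∈ ap s n by apply: (nm_comp hk) => //; dfn_tac.
apply: (al_mono uf _ _ ha); first by dfn_tac.
by move=> b bk hb i X /[dup] /(app_dom sf) iw /(ap_app sf) <-; exact: hb.
Qed.

Definition cls2 f := cls_of k2 D2 f.

Lemma dtm_cls2 (f : (nat -> N) -> N) : dtm f -> dtm (fun e => cls2 (f e)).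
Proof. have [w [hw [wk _]]] := nm_omega hk; exact: (dtm_cls_of product_uf hw (product_seq wk)). Qed.

Lemma cls2P g t : is_fun g k2 ->
  t ∈ cls2 g <-> exists h, is_fun h k2 /\ al k2 D2 (fun i => ap h i ∈ ap g i) /\ t = cls2 h.
Proof. have [w [hw [wk _]]] := nm_omega hk; exact: (cls_ofP product_uf hw (product_seq wk)). Qed.

Lemma cls2_eq f g : is_fun f k2 -> is_fun g k2 ->
  cls2 f = cls2 g <-> al k2 D2 (fun i => ap f i = ap g i).
Proof. have [w [hw [wk _]]] := nm_omega hk; exact: (cls_of_eq product_uf hw (product_seq wk)). Qed.

Lemma cls2_mem f g : is_fun f k2 -> is_fun g k2 ->
  cls2 f ∈ cls2 g <-> al k2 D2 (fun i => ap f i ∈ ap g i).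
Proof. have [w [hw [wk _]]] := nm_omega hk; exact: (cls_of_mem product_uf hw (product_seq wk)). Qed.

Lemma ult_value_E2 f y : is_fun f k2 -> ult_value univ k2 D2 f y <-> y = cls2 f.
Proof. have [w [hw [wk _]]] := nm_omega hk; exact: (ult_value_cls product_uf hw (product_seq wk)). Qed.

End Product.

End Plus.

Section Projections.

Context {N : zfc_model}.

Implicit Types a b c d f g h i j k p q r s v w x y z A B D G S T X Y Z : N.

Definition fst p := setof (fun z => exists a b, p = op a b /\ z ∈ a).
Definition snd p := setof (fun z => exists a b, p = op a b /\ z ∈ b).

Lemma fstP p : is_setof (fst p) (fun z => exists a b, p = op a b /\ z ∈ a).
Proof.
apply: (@setof_sub _ _ (Un (Un (Un (sg p))))) => [|z [a [b [-> za]]]]; first by dfn_tac.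
have [h _] : a ∈ Un (Un (sg (op a b))) /\ b ∈ Un (Un (sg (op a b))).
  by apply: op_mem_Un; apply/sgP.
by apply/UnP; exists a.
Qed.

Lemma sndP p : is_setof (snd p) (fun z => exists a b, p = op a b /\ z ∈ b).
Proof.
apply: (@setof_sub _ _ (Un (Un (Un (sg p))))) => [|z [a [b [-> za]]]]; first by dfn_tac.
have [_ h] : a ∈ Un (Un (sg (op a b))) /\ b ∈ Un (Un (sg (op a b))).
  by apply: op_mem_Un; apply/sgP.
by apply/UnP; exists b.
Qed.

Lemma fst_op a b : fst (op a b) = a.
Proof.
apply: set_ext => z; rewrite (fstP _ z); split; last by exists a, b.
by move=> [a' [b' [/op_inj [-> _] ]]].
Qed.

Lemma snd_op a b : snd (op a b) = b.
Proof.
apply: set_ext => z; rewrite (sndP _ z); split; last by exists a, b.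
by move=> [a' [b' [/op_inj [_ ->] ]]].
Qed.

Lemma dtm_fst (p : (nat -> N) -> N) : dtm p -> dtm (fun e => fst (p e)).
Proof.
apply: (dtm_fun1 (F := fst)).
apply: (@dtm_setof _ (fun e z => exists a b, e 0 = op a b /\ z ∈ a)); last by dfn_tac.
by move=> e; exact: fstP.
Qed.

Lemma dtm_snd (p : (nat -> N) -> N) : dtm p -> dtm (fun e => snd (p e)).
Proof.
apply: (dtm_fun1 (F := snd)).
apply: (@dtm_setof _ (fun e z => exists a b, e 0 = op a b /\ z ∈ b)); last by dfn_tac.
by move=> e; exact: sndP.
Qed.

End Projections.

Ltac dtm_lemma ::= first [ apply: dtm_up | apply: dtm_Un | apply: dtm_pw
  | apply: dtm_op | apply: dtm_succ | apply: dtm_cup | apply: dtm_ap | apply: dtm_fn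
  | apply: dtm_rep | apply: dtm_sep | apply: dtm_val | apply: dtm_fst | apply: dtm_snd ].

(** * The seed [j(κ) + κ] in the ultrapower by the product measure *)

Section Seed.

Context {N : zfc_model}.

Implicit Types a b c d f g h i j k p q r s v w x y z A B D G S T X Y Z : N.

Variables (k D : N).
Hypothesis hk : normal_measure univ k D.

Notation "∀* i , Q" := (al k D (fun i => Q)) (at level 200, i name).

Variables (k2 D2 : N).
Hypothesis hk2 : is_square k k2.
Hypothesis hD2 : is_product_measure k2 D D2.

Variable P : N -> N -> N.
Hypothesis hP : is_plus k P.

Let uf := nm_uf hk.
Let ok := nm_ord hk.

Ltac plus_dfn := dfn_unfold; repeat first [apply: (dtm_plus hP) | apply: (dtm_cls hk) |
  apply: (dtm_cls2 hk hk2 hD2) | dfn_step]; cbv beta; try done.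

Lemma al2_fn (F : N -> N -> N) (R : N -> N -> Prop) :
  dtm (fun e => F (fst (e 0)) (snd (e 0))) -> dfn (fun e => R (e 0) (e 1)) ->
  al k2 D2 (fun p => R (ap (fn k2 (fun p => F (fst p) (snd p))) p) p) <->
  ∀* a, ∀* b, R (F a b) (op a b).
Proof.
move=> dF dR.
rewrite (al2_iff hk hk2 hD2); last first.
  apply: (dfn_rel2 (R := R)) => //; first by plus_dfn.
  exact: dtm_var.
apply: al_iff => a ak; apply: al_iff => b bk.
rewrite ap_fn //; first by rewrite fst_op snd_op.
exact/(op_square hk2).
Qed.

Definition lift1 h := fn k2 (fun p => ap h (fst p)).

Lemma lift1_fun h : is_fun (lift1 h) k2.
Proof. by apply: fn_fun; plus_dfn. Qed.

Definition fnp (F : N -> N -> N) := fn k2 (fun p => F (fst p) (snd p)).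

Lemma cls2_fnp_mem (F : N -> N -> N) t : dtm (fun e => F (fst (e 0)) (snd (e 0))) ->
  t ∈ cls2 k2 D2 (fnp F) <->
  exists g, is_fun g k2 /\ (∀* a, ∀* b, ap g (op a b) ∈ F a b) /\ t = cls2 k2 D2 g.
Proof.
move=> dF; rewrite (cls2P hk hk2 hD2); last exact: fn_fun.
have e g : al k2 D2 (fun i => ap g i ∈ ap (fnp F) i) <-> ∀* a, ∀* b, ap g (op a b) ∈ F a b.
  by apply: (al2_fn (F := F) (R := fun y p => ap g p ∈ y)) => //; plus_dfn.
by split=> -[g [gf [/e h ->]]]; exists g.
Qed.

Lemma cls2_fnp_eq (F : N -> N -> N) g : dtm (fun e => F (fst (e 0)) (snd (e 0))) ->
  is_fun g k2 -> (∀* a, ∀* b, ap g (op a b) = F a b) -> cls2 k2 D2 g = cls2 k2 D2 (fnp F).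
Proof.
move=> dF gf h; apply/(cls2_eq hk hk2 hD2) => //; first exact: fn_fun.
by apply/(al2_fn (F := F) (R := fun y p => ap g p = y)) => //; plus_dfn.
Qed.

Let dl h : dtm (fun e => ap h (fst (e 0))).
Proof. by plus_dfn. Qed.

(** Recognises the elements of the second ultrapower that come from the first: those represented by
    functions which, almost everywhere, depend on [a] only. *)
Lemma cls2_reduct B g : is_fun g k2 ->
  (∀* a, exists x, x ∈ B /\ ∀* b, ap g (op a b) = x) ->
  exists h, is_fun h k /\ (∀* a, ap h a ∈ B /\ ∀* b, ap g (op a b) = ap h a) /\
    cls2 k2 D2 g = cls2 k2 D2 (lift1 h).
Proof.
move=> gf hg.
have [||h [hf hh]] := @al_choice _ k D uf (fun a x => x ∈ B /\ ∀* b, ap g (op a b) = x) B.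
- by plus_dfn.
- apply: (al_mono uf _ _ hg); first by plus_dfn.
  by move=> a ak [x [xB e]]; exists x.
exists h; do 2 split=> //.
apply: (cls2_fnp_eq (F := fun a _ => ap h a)) => //.
by apply: (al_mono uf _ _ hh); [plus_dfn|move=> a ak []].
Qed.

(** The second step of the iteration does not move ordinals below [j(κ)]: for fixed [a], a function
    of [b] with values below [ap h a] is constant by completeness. *)
Lemma cls2_lift1 h : is_fun h k -> (∀* a, ap h a ∈ k) -> cls2 k2 D2 (lift1 h) = cls k D h.
Proof.
move: h; have key : forall y h, is_fun h k -> (∀* a, ap h a ∈ k) -> cls k D h = y ->
    cls2 k2 D2 (lift1 h) = y; last by move=> h hf hh; exact: (key (cls k D h) h).
apply: (@eps_ind _ (fun y => forall h, is_fun h k -> (∀* a, ap h a ∈ k) -> cls k D h = y ->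
    cls2 k2 D2 (lift1 h) = y)); first by rewrite /lift1; plus_dfn.
move=> y IH h hf hh e; apply: set_ext => t.
rewrite (cls2_fnp_mem (F := fun a _ => ap h a)) // -e (clsP hk) //; split.
  move=> [g [gf [hg ->]]].
  have [|h' [h'f [hh' ->]]] := @cls2_reduct k g gf.
    apply: (al_mono2 uf _ hg hh); first by plus_dfn.
    move=> a ak ha hak.
    have [||x [xh hx]] := @nm_regress_c _ _ _ hk (fun x b => ap g (op a b) = x) (ap h a) _ hak.
    - by plus_dfn.
    - apply: (al_mono uf _ _ ha); first by plus_dfn.
      by move=> b bk hb; exists (ap g (op a b)).
    by exists x; split=> //; exact: (ord_trans ok xh hak).
  have h'h : ∀* a, ap h' a ∈ ap h a.
    apply: (al_mono2 uf _ hg hh'); first by plus_dfn.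
    move=> a ak h1 [_ h2]; have [b [_ [h3 <-]]] := al_ex uf (al_and uf h1 h2).
    exact: h3.
  exists h'; do 2 split=> //; apply: (IH (cls k D h')) => //.
    by rewrite -e; apply/(clsP hk) => //; exists h'.
  by apply: (al_mono uf _ _ hh'); [plus_dfn|move=> a ak []].
move=> [h' [h'f [h'h ->]]]; exists (lift1 h'); split; first exact: lift1_fun.
have h'k : ∀* a, ap h' a ∈ k.
  apply: (al_mono2 uf _ h'h hh); first by plus_dfn.
  by move=> a _ h1 h2; exact: (ord_trans ok h1 h2).
split; last first.
  by symmetry; apply: (IH (cls k D h')) => //; rewrite -e; apply/(clsP hk) => //; exists h'.
apply: (al_mono uf _ _ h'h); first by rewrite /lift1; plus_dfn.
move=> a ak hha; apply: (al_all uf); first by rewrite /lift1; plus_dfn.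
by move=> b bk; rewrite ap_fn // ?fst_op //; apply/(op_square hk2).
Qed.

Let d2 : dtm (fun e : nat -> N => snd (e 0)).
Proof. by plus_dfn. Qed.

Let dPy y : dtm (fun e : nat -> N => P (snd (e 0)) y).
Proof. by plus_dfn. Qed.

Let dP2 : dtm (fun e : nat -> N => P (snd (e 0)) (fst (e 0))).
Proof. by plus_dfn. Qed.

(** The second coordinate plays the identity of the second step, so it represents the critical point
    of that step. Its members are regressive in [b] and therefore depend on [a] alone. *)
Lemma cls2_snd : cls2 k2 D2 (fnp (fun _ b => b)) = cls k D (const k k).
Proof.
apply: set_ext => t.
rewrite (cls2_fnp_mem (F := fun _ b => b)) // (clsP hk) //; last exact: const_fun.
split.
  move=> [g [gf [hg ->]]].
  have [|h [hf [hh ->]]] := @cls2_reduct k g gf.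
    apply: (al_mono uf _ _ hg); first by plus_dfn.
    move=> a ak ha; apply: (nm_regress hk); first by plus_dfn.
    apply: (al_mono uf _ _ ha); first by plus_dfn.
    by move=> b bk hb; exists (ap g (op a b)).
  have hk' : ∀* a, ap h a ∈ k by apply: (al_mono uf _ _ hh); [plus_dfn|move=> a ak []].
  exists h; split=> //; split; last exact: cls2_lift1.
  by apply: (al_mono uf _ _ hk'); [rewrite /const; plus_dfn|move=> a ak; rewrite ap_const].
move=> [h [hf [hh ->]]]; exists (lift1 h); split; first exact: lift1_fun.
have hk' : ∀* a, ap h a ∈ k.
  by apply: (al_mono uf _ _ hh); [plus_dfn|move=> a ak; rewrite ap_const].
split; last by rewrite cls2_lift1.
apply: (al_mono uf _ _ hk'); first by rewrite /lift1; plus_dfn.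
move=> a ak ha; apply: (al_mono uf _ _ (nm_tail hk ha)); first by rewrite /lift1; plus_dfn.
by move=> b bk; rewrite ap_fn // ?fst_op //; apply/(op_square hk2).
Qed.

(** This turns out to be [j(κ) + y]. *)
Let pt y := cls2 k2 D2 (fnp (fun _ b => P b y)).

Lemma cls2_below g : is_fun g k2 ->
  cls2 k2 D2 g ∈ cls k D (const k k) <-> ∀* a, ∀* b, ap g (op a b) ∈ b.
Proof.
move=> gf; rewrite -cls2_snd (cls2_mem hk hk2 hD2) //; last exact: fn_fun.
by apply: (al2_fn (F := fun _ b => b) (R := fun y p => ap g p ∈ y)) => //; plus_dfn.
Qed.

(** An element of [b + F a] is below [b] or equal to [b + x] with [x] below [F a]; in the second
    case completeness makes [x] independent of [b]. Constant [F] serves for the sums [j(κ) + y], the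
    identity for the seed. *)
Lemma cls2_plus_cases g (F : N -> N) : is_fun g k2 -> dtm (fun e => F (e 0)) ->
  (forall a, a ∈ k -> F a ∈ k) ->
  (∀* a, ∀* b, ap g (op a b) ∈ P b (F a)) ->
  cls2 k2 D2 g ∈ cls k D (const k k) \/
  ∀* a, exists x, x ∈ F a /\ ∀* b, ap g (op a b) = P b x.
Proof.
move=> gf dF Fk hg.
have dFv (t : (nat -> N) -> N) : dtm t -> dtm (fun e => F (t e)) by exact: dtm_fun1.
have hg' : (∀* a, (∀* b, ap g (op a b) ∈ b) \/ ∀* b, exists x, x ∈ F a /\ ap g (op a b) = P b x).
  apply: (al_mono uf _ _ hg); first by repeat first [apply: dFv | apply: (dtm_plus hP) | dfn_step].
  move=> a ak ha; apply: (al_or uf); [by plus_dfn|by plus_dfn|].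
  apply: (al_mono uf _ _ ha); first by plus_dfn.
  by move=> b bk /(plusP hP bk (Fk a ak)).
case: (al_or uf _ _ hg').
- by plus_dfn.
- by repeat first [apply: dFv | apply: (dtm_plus hP) | dfn_step].
- by move=> h; left; apply/cls2_below.
move=> h; right; apply: (al_mono uf _ _ h).
  by repeat first [apply: dFv | apply: (dtm_plus hP) | dfn_step].
move=> a ak ha; apply: (nm_regress_c hk) => //; first by plus_dfn.
exact: Fk.
Qed.

Lemma cls2_plusP y t : y ∈ k ->
  t ∈ pt y <-> t ∈ cls k D (const k k) \/ exists x, x ∈ y /\ t = pt x.
Proof.
move=> yk; rewrite /pt (cls2_fnp_mem (F := fun _ b => P b y)) //; split.
  move=> [g [gf [hg ->]]].
  have [||//|h] := cls2_plus_cases (F := fun _ => y) gf _ _ hg; first by plus_dfn.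
  - by [].
  - by left.
  have [|x [xy hx]] := @nm_regress_c _ _ _ hk (fun x a => ∀* b, ap g (op a b) = P b x) y _ yk h.
    by plus_dfn.
  right; exists x; split=> //; exact: (cls2_fnp_eq (F := fun _ b => P b x)).
case.
  move=> /[dup]; rewrite {1}(clsP hk); last exact: const_fun.
  move=> [h [hf [hh e]]]; have hk' : ∀* a, ap h a ∈ k.
    by apply: (al_mono uf _ _ hh); [plus_dfn|move=> a ak; rewrite ap_const].
  rewrite e -cls2_lift1 //; move/(cls2_below (lift1_fun h)) => hl.
  exists (lift1 h); split; first exact: lift1_fun.
  split=> //; apply: (al_mono uf _ _ hl); first by plus_dfn.
  move=> a ak ha; apply: (al_mono uf _ _ ha); first by plus_dfn.
  by move=> b bk hb; apply/(plusP hP bk yk); left.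
move=> [x [xy ->]]; exists (fnp (fun _ b => P b x)); split; first exact: fn_fun.
split=> //; apply: (al_all uf); first by rewrite /fnp; plus_dfn.
move=> a ak; apply: (al_all uf); first by rewrite /fnp; plus_dfn.
move=> b bk; rewrite ap_fn ?snd_op //; last exact/(op_square hk2).
by apply/(plusP hP bk yk); right; exists x.
Qed.

(** By the case distinction above, a point below the class of [b + a] is below [j(κ)] or is
    represented by [b + x] with [x] below [a]. Normality in [a] makes [x] constant, so the point is
    some [j(κ) + x]. *)
Lemma seed_represented seed : is_ord_sum (cls k D (const k k)) k seed ->
  seed = cls2 k2 D2 (fnp (fun a b => P b a)).
Proof.
move=> [h [hf [hs hseed]]].
have hpt : forall y, y ∈ k -> ap h y = pt y.
  apply: (@eps_ind _ (fun y => y ∈ k -> ap h y = pt y)); first by rewrite /pt /fnp; plus_dfn.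
  move=> y IH yk; apply: set_ext => t; rewrite (hs _ _ (app_ap hf yk) t) cls2_plusP //.
  split; case; auto; move=> [x [xy e]]; right; exists x; split=> //; have xk := ord_trans ok xy yk.
    by rewrite -(IH x) // (ap_app hf e).
  by rewrite e -(IH x) //; exact: (app_ap hf).
apply: set_ext => t; rewrite (hseed t) (cls2_fnp_mem (F := fun a b => P b a)) //; split.
  case=> [tj|[y [yk]]].
    move: (tj); rewrite {1}(clsP hk); last exact: const_fun.
    move=> [h' [h'f [hh e]]]; have hk' : ∀* a, ap h' a ∈ k.
      by apply: (al_mono uf _ _ hh); [plus_dfn|move=> a ak; rewrite ap_const].
    move: tj; rewrite e -cls2_lift1 //; move/(cls2_below (lift1_fun h')) => hl.
    exists (lift1 h'); split; first exact: lift1_fun.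
    split=> //; apply: (al_mono uf _ _ hl); first by plus_dfn.
    move=> a ak ha; apply: (al_mono uf _ _ ha); first by plus_dfn.
    by move=> b bk hb; apply/(plusP hP bk ak); left.
  move/(ap_app hf) => <-; rewrite hpt //; exists (fnp (fun _ b => P b y)); split; first exact: fn_fun.
  split=> //; apply: (al_mono uf _ _ (nm_tail hk yk)); first by rewrite /fnp; plus_dfn.
  move=> a ak ya; apply: (al_all uf); first by rewrite /fnp; plus_dfn.
  move=> b bk; rewrite ap_fn ?snd_op //; last exact/(op_square hk2).
  by apply/(plusP hP bk ak); right; exists y.
move=> [g [gf [hg ->]]].
have [||//|h1] := cls2_plus_cases (F := fun a => a) gf _ _ hg; first by plus_dfn.
- by [].
- by left.
have [|x [xk hx]] := @nm_regress _ _ _ hk (fun x a => ∀* b, ap g (op a b) = P b x) _ h1.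
  by plus_dfn.
right; exists x; split=> //.
have -> : cls2 k2 D2 g = ap h x by rewrite hpt //; exact: (cls2_fnp_eq (F := fun _ b => P b x)).
exact: (app_ap hf).
Qed.

Lemma derived_measureE seed W : is_ord_sum (cls k D (const k k)) k seed ->
  is_setof W (fun X => subset X k /\
     exists Y, ult_embedding univ k2 D2 X Y /\ seed ∈ Y) ->
  forall X, X ∈ W <-> subset X k /\ ∀* a, ∀* b, P b a ∈ X.
Proof.
move=> hseed hW X; rewrite (hW X).
have dX : dtm (fun _ : nat -> N => X) by exact: dtm_const.
have e Y : ult_embedding univ k2 D2 X Y <-> Y = cls2 k2 D2 (fn k2 (fun _ => X)).
  split.
    move=> [f [_ [[ff fX] /(ult_value_E2 hk hk2 hD2 _ ff) ->]]]; congr cls_of.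
    apply: (fun_ext ff (fn_fun _ dX)) => p pk; rewrite ap_fn //; exact: fX (app_ap ff pk).
  move=> ->; exists (fn k2 (fun _ => X)); split=> //; split.
    split; first exact: fn_fun.
    by move=> x y /(fn_app dX) [].
  by apply/(ult_value_E2 hk hk2 hD2) => //; exact: fn_fun.
have e2 : seed ∈ cls2 k2 D2 (fn k2 (fun _ => X)) <-> ∀* a, ∀* b, P b a ∈ X.
  rewrite (seed_represented hseed) (cls2_mem hk hk2 hD2); try exact: fn_fun.
  have dQ : dfn (fun e => ap (fnp (fun a b => P b a)) (e 0) ∈ ap (fn k2 (fun _ => X)) (e 0)).
    by rewrite /fnp; plus_dfn.
  rewrite (al2_iff hk hk2 hD2 dQ); apply: al_iff => a ak; apply: al_iff => b bk.
  have ab : op a b ∈ k2 by apply/(op_square hk2).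
  by rewrite !ap_fn // fst_op snd_op.
rewrite -e2; split=> -[Xk h]; split=> //.
  by move: h => [Y [/e -> ]].
by exists (cls2 k2 D2 (fn k2 (fun _ => X))); split=> //; apply/e.
Qed.

End Seed.

(** * Inner models *)

(** [V] is turned into a model on a sigma type, so that what is proved of all
    models applies to it. *)

Section InnerModel.

Context {N : Type} {HN : Membership N}.

Variable V : N -> Prop.
Hypothesis hVt : transitive_class V.
Hypothesis hV : ZFC V.

Definition inner_carrier := {x : N | V x}.

#[local] Instance inner_mem : Membership inner_carrier := fun x y => proj1_sig x ∈ proj1_sig y.

Notation M := inner_carrier.

Definition inner_val (x : M) : N := proj1_sig x.

Notation v := inner_val.

Lemma in_V (x : M) : V (v x).
Proof. exact: proj2_sig. Qed.

Lemma v_inj (x y : M) : v x = v y -> x = y.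
Proof.
case: x y => [x hx] [y hy] /= e; subst y; congr exist; exact: proof_irrelevance.
Qed.

Lemma inner_sat p : forall e : nat -> M, sat univ e p <-> sat V (fun n => v (e n)) p.
Proof.
elim: p => [i j|i j||p IHp q IHq|p IHp] e /=.
- by split=> [->|/v_inj].
- by [].
- by [].
- by rewrite IHp IHq.
- have key (x : M) : sat univ (scons x e) p <-> sat V (scons (v x) (fun n => v (e n))) p.
    by rewrite IHp; apply: sat_ext => -[|n].
  split=> h x Vx; first by apply/(key (exist _ x Vx))/h.
  by apply/key/h; exact: in_V.
Qed.

Lemma inner_ZFC : ZFC (N := M) univ.
Proof.
have [E [F [P [U [W [Inf [C [S R]]]]]]]] := hV.
split; [|split; [|split; [|split; [|split; [|split; [|split; [|split]]]]]]].
- move=> x y _ _ h; apply: v_inj; apply: E; try exact: in_V.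
  by move=> z Vz; exact: (h (exist _ z Vz) I).
- move=> x _ [y [_ yx]]; have [|z [Vz [zx h]]] := F (v x) (in_V x).
    by exists (v y); split=> //; exact: in_V.
  exists (exist _ z Vz); do 2 split=> //; move=> [t [_ [tx tz]]]; apply: h.
  by exists (v t); split=> //; exact: in_V.
- move=> a b _ _; have [c [Vc [h1 h2]]] := P (v a) (v b) (in_V a) (in_V b).
  by exists (exist _ c Vc).
- move=> x _; have [u [Vu h]] := U (v x) (in_V x); exists (exist _ u Vu); split=> // y z _ _.
  apply: h; exact: in_V.
- move=> x _; have [p [Vp h]] := W (v x) (in_V x); exists (exist _ p Vp); split=> // z _ hz.
  apply: (h (v z) (in_V z)) => t Vt; exact: (hz (exist _ t Vt) I).
- have [w [Vw [[e [Ve [ew he]]] hs]]] := Inf.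
  exists (exist _ w Vw); split=> //; split.
    exists (exist _ e Ve); do 2 split=> //; move=> z _; apply: (he (v z)); exact: in_V.
  move=> x _ xw; have [y [Vy [yw hy]]] := hs (v x) (in_V x) xw.
  exists (exist _ y Vy); split=> //; split=> // z _; split.
    move=> zy; case: (proj1 (hy (v z) (in_V z)) zy); first by left.
    by move/v_inj; right.
  by move=> hz; apply/(hy (v z) (in_V z)); case: hz => [|->]; auto.
- move=> x _ ne dj; have [||c [Vc hc]] := C (v x) (in_V x).
  + move=> y Vy yx; have [z [_ zy]] := ne (exist _ y Vy) I yx.
    by exists (v z); split=> //; exact: in_V.
  + move=> y y' z Vy Vy' Vz yx yx' zy zy'.
    by have := dj (exist _ y Vy) (exist _ y' Vy') (exist _ z Vz) I I I yx yx' zy zy'; case.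
  exists (exist _ c Vc); split=> // y _ yx; have [z [Vz [zy [zc hz]]]] := hc (v y) (in_V y) yx.
  exists (exist _ z Vz); do 3 split=> //; move=> z' _ h1 h2; apply: v_inj.
  exact: (hz (v z') (in_V z')).
- move=> p env _ a _; have [|b [Vb hb]] := S p (fun n => v (env n)) _ (v a) (in_V a).
    by move=> n; exact: in_V.
  exists (exist _ b Vb); split=> // x _; rewrite inner_sat.
  have -> : (x ∈ exist _ b Vb) = (v x ∈ b) by [].
  rewrite (hb (v x) (in_V x)); apply: and_iff_compat_l; apply: sat_ext => -[|n] //.
- move=> p env _ a _ h; have [||b [Vb hb]] := R p (fun n => v (env n)) _ (v a) (in_V a).
  + by move=> n; exact: in_V.
  + move=> x Vx xa; have [y [_ [hy hu]]] := h (exist _ x Vx) I xa.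
    have e (u : M) : sat univ (scons u (scons (exist _ x Vx) env)) p <->
        sat V (scons (v u) (scons x (fun n => v (env n)))) p.
      by rewrite inner_sat; apply: sat_ext => -[|[|n]].
    exists (v y); split; first exact: in_V.
    split; first by apply/e.
    by move=> y' Vy' hy'; have <- := hu (exist _ y' Vy') I (proj2 (e (exist _ y' Vy')) hy').
  exists (exist _ b Vb); split=> // x _ xa.
  have [y [Vy [yb hy]]] := hb (v x) (in_V x) xa.
  exists (exist _ y Vy); do 2 split=> //; apply/inner_sat.
  by move: hy; apply (sat_ext V) => -[|[|n]].
Qed.

End InnerModel.

Definition inner_model (N : zfc_model) (V : N -> Prop) (hV : ZFC V) : zfc_model :=
  @ZfcModel (inner_carrier V) (inner_mem (V := V)) (inner_ZFC hV).

(** * Absoluteness between [V] as a model and [V] as a class of [N] *)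

Section Transport.

Context {N : zfc_model}.
Variable V : N -> Prop.
Hypothesis hVt : transitive_class V.
Hypothesis hV : ZFC V.

Notation M := (inner_model hV).

Definition emb (x : M) : N := inner_val x.

Notation v := emb.

Implicit Types x y z a b p f d D k g X : M.

Lemma emb_V x : V (v x).
Proof. exact: in_V. Qed.

Lemma emb_lift (z : N) : V z -> exists x, v x = z.
Proof. by move=> Vz; exists (exist _ z Vz). Qed.

Lemma emb_inj x y : v x = v y -> x = y.
Proof. exact: v_inj. Qed.

Lemma emb_lift_mem (z : N) x : z ∈ v x -> exists y, v y = z /\ y ∈ x.
Proof.
move=> zx; have [y e] := emb_lift (hVt (emb_V x) zx).
by exists y; split=> //; rewrite -e in zx.
Qed.

(** A condition stated in [N] may hold of elements outside [V]; the second hypothesis excludes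
    this. *)
Lemma emb_setof x (Q : M -> Prop) (Q' : N -> Prop) : (forall z, Q z <-> Q' (v z)) ->
  (forall t, Q' t -> V t) -> is_setof x Q <-> is_setof (v x) Q'.
Proof.
move=> QQ QV; split=> h z.
  split; first by move=> /emb_lift_mem [y [<- /h /QQ]].
  by move=> /[dup] /QV /emb_lift [y <-] /QQ /h.
by rewrite QQ -(h (v z)).
Qed.

Lemma emb_eq x y : v x = v y <-> x = y.
Proof. by split=> [/emb_inj|->]. Qed.

Lemma emb_upair p a b : is_upair p a b <-> is_upair (v p) (v a) (v b).
Proof.
apply: emb_setof => [z|t [->|->]]; try exact: emb_V.
by rewrite !emb_eq.
Qed.

Lemma emb_up a b : v (up a b) = up (v a) (v b).
Proof. by apply/is_upair_up/emb_upair/is_upair_up. Qed.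

Lemma emb_op a b : v (op a b) = op (v a) (v b).
Proof. by rewrite /op /sg !emb_up. Qed.

Lemma V_op_inv (x y : N) : V (op x y) -> V x /\ V y.
Proof.
move=> h; have hu : V (up x y) by apply: (hVt h); apply/upP; right.
by split; apply: (hVt hu); apply/upP; auto.
Qed.

Lemma emb_app f x y : app f x y <-> app (v f) (v x) (v y).
Proof. by rewrite !app_op -emb_op. Qed.

Lemma emb_app_inv f (x y : N) : app (v f) x y ->
  exists a b, v a = x /\ v b = y /\ app f a b.
Proof.
move=> /[dup] h /app_op h'; have [/emb_lift [a ea] /emb_lift [b eb]] := V_op_inv (hVt (emb_V f) h').
by exists a, b; do 2 split=> //; apply/emb_app; rewrite ea eb.
Qed.

Lemma emb_fun f d : is_fun f d <-> is_fun (v f) (v d).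
Proof.
split=> -[h1 [h2 h3]]; split.
- move=> q /emb_lift_mem [p [<- pf]]; have [x [y [xd +]]] := h1 p pf; move/is_opair_op => ->.
  by exists (v x), (v y); split=> //; apply/is_opair_op; rewrite emb_op.
- split.
    move=> x0 /emb_lift_mem [x [<- xd]]; have [y a] := h2 x xd.
    by exists (v y); apply/emb_app.
  move=> x0 y0 y1 /emb_app_inv [x [y [<- [<- a]]]] /emb_app_inv [x' [y' [/emb_inj e [<- a']]]].
  by subst x'; congr v; exact: (h3 x).
- move=> p pf; have [x0 [y0 [xd +]]] := h1 (v p) pf; move/is_opair_op => e.
  have [/emb_lift [x ex] /emb_lift [y ey]] : V x0 /\ V y0 by apply: V_op_inv; rewrite -e; exact: emb_V.
  exists x, y; split; first by rewrite -ex in xd.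
  by apply/is_opair_op; apply: emb_inj; rewrite emb_op ex ey.
- split.
    move=> x xd; have [y0 a] := h2 (v x) xd.
    have [x' [y [/emb_inj <- [_ a']]]] := emb_app_inv a; by exists y.
  move=> x y y' /emb_app a /emb_app a'; apply: emb_inj; exact: (h3 _ _ _ a a').
Qed.

Lemma emb_subset x y : subset x y <-> subset (v x) (v y).
Proof.
split=> h z; first by move/emb_lift_mem => [t [<- /h]].
exact: (h (v z)).
Qed.

Lemma emb_empty x : is_empty x <-> is_empty (v x).
Proof.
split=> h z; first by move/emb_lift_mem => [t [_ /h]].
exact: (h (v z)).
Qed.

Lemma emb_large D (Q : M -> Prop) (Q' : N -> Prop) : (forall z, Q z <-> Q' (v z)) ->
  (forall t, Q' t -> V t) -> large D Q <-> large (v D) Q'.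
Proof.
move=> QQ QV; split.
  by move=> [A [AD hA]]; exists (v A); split=> //; apply/(emb_setof _ QQ QV).
move=> [A0 [/emb_lift_mem [A [<- AD]] hA]]; exists A; split=> //; exact/(emb_setof _ QQ QV).
Qed.

Lemma emb_large_intro D (Q : M -> Prop) (Q' : N -> Prop) : (forall z, Q z <-> Q' (v z)) ->
  (forall t, Q' t -> V t) -> large (v D) Q' -> large D Q.
Proof. by move=> QQ QV; rewrite (emb_large _ QQ QV). Qed.

Lemma emb_transitive x : is_transitive x <-> is_transitive (v x).
Proof.
split; first by move=> h y0 /emb_lift_mem [y [<- yx]]; apply/emb_subset; exact: h.
by move=> h y yx; apply/emb_subset; exact: h.
Qed.

Lemma emb_ord x : is_ord x <-> is_ord (v x).
Proof.
rewrite /is_ord emb_transitive; apply: and_iff_compat_l; split.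
  by move=> h y0 /emb_lift_mem [y [<- yx]]; apply/emb_transitive; exact: h.
by move=> h y yx; apply/emb_transitive; exact: h.
Qed.

Lemma emb_limit x : is_limit x <-> is_limit (v x).
Proof.
rewrite /is_limit emb_ord; apply: and_iff_compat_l; split=> -[[z zx] h]; split.
- by exists (v z).
- move=> y0 /emb_lift_mem [y [<- yx]]; have [t [tx yt]] := h y yx; by exists (v t).
- by have [t [_ tx]] := emb_lift_mem zx; exists t.
- move=> y yx; have [t0 [tx yt]] := h (v y) yx.
  have [t [e tx']] := emb_lift_mem tx; exists t; split=> //; by rewrite -e in yt.
Qed.

Lemma emb_omega x : is_omega x <-> is_omega (v x).
Proof.
rewrite /is_omega emb_limit; apply: and_iff_compat_l; split.
  by move=> h y0 /emb_lift_mem [y [<- yx]]; rewrite -emb_limit; exact: h.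
by move=> h y yx; rewrite emb_limit; exact: h.
Qed.

Lemma emb_map f d (Q : M -> Prop) (Q' : N -> Prop) : (forall z, Q z <-> Q' (v z)) ->
  is_map f d Q <-> is_map (v f) (v d) Q'.
Proof.
move=> QQ; rewrite /is_map emb_fun; apply: and_iff_compat_l; split=> h x y.
  by move/emb_app_inv => [a [b [_ [<- /h /QQ]]]].
by move/emb_app => /h /QQ.
Qed.

Lemma emb_ultrafilter d D : ultrafilter V (v d) (v D) -> ultrafilter univ d D.
Proof.
move=> [_ [h1 [h2 [h3 [h4 [h5 h6]]]]]]; split=> //; split.
  by move=> X XD; apply/emb_subset; exact: h1.
split=> //; split; first by move=> X XD; rewrite emb_empty; exact: h3.
split.
  move=> X Y XD _ /emb_subset XY /emb_subset Yd; exact: (h4 (v X) (v Y) XD (emb_V Y)).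
split.
  move=> X Y XD YD.
  apply: (@emb_large_intro D _ (fun z : N => z ∈ v X /\ z ∈ v Y)); try done; last exact: h5.
  by move=> t [tX _]; exact: (hVt (emb_V X) tX).
move=> X _ /emb_subset Xd; case: (h6 (v X) (emb_V X) Xd); first by left.
move=> h; right; apply: (@emb_large_intro D _ (fun z : N => z ∈ v d /\ ~ z ∈ v X)); try done.
by move=> t [td _]; exact: (hVt (emb_V d) td).
Qed.

Lemma emb_closed d D g : closed_under_seq V (v d) (v D) (v g) -> closed_under_seq univ d D g.
Proof.
move=> h s _ sm.
apply: (@emb_large_intro D _ (fun z : N => z ∈ v d /\ forall (i X : N), app (v s) i X -> z ∈ X)).
- move=> z; apply: and_iff_compat_l; split=> h' i X.
    by move/emb_app_inv => [a [b [_ [<- /h']]]].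
  by move/emb_app/h'.
- by move=> t [td _]; exact: (hVt (emb_V d) td).
- apply: h; first exact: emb_V.
  by move: sm; rewrite (emb_map _ _ (Q' := fun X : N => X ∈ v D)).
Qed.

Lemma emb_normal_measure k D : normal_measure V (v k) (v D) -> normal_measure univ k D.
Proof.
move=> [[ok [w0 [hw wk]]] [[hu [np hc]] hn]]; split.
  split; first exact/emb_ord.
  have [w [e wk']] := emb_lift_mem wk; exists w; split=> //; apply/emb_omega; by rewrite e.
split.
  split; first exact: emb_ultrafilter.
  split; last by move=> g gk; apply: emb_closed; exact: hc.
  move=> x; rewrite (emb_large _ (Q' := fun z : N => z = v x)); first exact: np.
    by move=> z; rewrite emb_eq.
  by move=> t ->; exact: emb_V.
move=> s _ sm.
apply: (@emb_large_intro D _ (fun z : N => z ∈ v k /\ forall (i X : N), i ∈ z -> app (v s) i X -> z ∈ X)).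
- move=> z; apply: and_iff_compat_l; split=> h' i X.
    by move=> iz /emb_app_inv [a [b [e [<-]]]]; apply: h'; rewrite -e in iz.
  by move=> iz /emb_app; exact: h'.
- by move=> t [td _]; exact: (hVt (emb_V k) td).
- apply: hn; first exact: emb_V.
  by move: sm; rewrite (emb_map _ _ (Q' := fun X : N => X ∈ v D)).
Qed.

Lemma emb_ult_mem d D f g : ult_mem d D f g <-> ult_mem (v d) (v D) (v f) (v g).
Proof.
apply: emb_large; last by move=> t [td _]; exact: (hVt (emb_V d) td).
move=> z; apply: and_iff_compat_l; split.
  by move=> [a [b [/emb_app h1 [/emb_app h2 ab]]]]; exists (v a), (v b).
move=> [a0 [b0 [/emb_app_inv [z1 [a [/emb_inj e1 [ea h1]]]] [/emb_app_inv [z2 [b [/emb_inj e2 [eb h2]]]] ab]]]].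
by subst; exists a, b.
Qed.

Lemma emb_ult_eq d D f g : ult_eq d D f g <-> ult_eq (v d) (v D) (v f) (v g).
Proof.
apply: emb_large; last by move=> t [td _]; exact: (hVt (emb_V d) td).
move=> z; apply: and_iff_compat_l; split.
  by move=> [a [/emb_app h1 /emb_app h2]]; exists (v a).
move=> [a0 [/emb_app_inv [z1 [a [/emb_inj e1 [ea h1]]]] /emb_app_inv [z2 [b [/emb_inj e2 [+ h2]]]]]].
by rewrite -ea => /emb_inj eb; subst; exists a.
Qed.

Lemma emb_ult_value d D f y : ult_value univ d D f y <-> ult_value V (v d) (v D) (v f) (v y).
Proof.
split; last first.
  move=> [F0 [c0 [VF [Vc [h1 [h2 [h3 [h4 h5]]]]]]]].
  have [F eF] := emb_lift VF; have [c ec] := emb_lift Vc; subst F0 c0.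
  exists F, c; do 2 split=> //; split; first by move=> g gF; apply/emb_fun; exact: h1.
  split.
    move=> g h gF _ /emb_fun hf /emb_ult_mem hg.
    have [h' [+ e]] := h2 (v g) (v h) gF (emb_V h) hf hg.
    move/emb_lift_mem => [h'' [eh hF]]; exists h''; split=> //; apply/emb_ult_eq; by rewrite eh.
  split; first exact/emb_fun.
  split; last exact/emb_app.
  move=> g z /emb_app a; apply/(emb_setof _ (Q' := fun t : N => exists h : N, h ∈ v F /\ ult_mem (v d) (v D) h (v g) /\ app (v c) h t)).
  - move=> t; split.
      by move=> [h [hF [/emb_ult_mem hm /emb_app ha]]]; exists (v h).
    move=> [h0 [/emb_lift_mem [h [<- hF]] [/emb_ult_mem hm /emb_app ha]]]; by exists h.
  - by move=> t [h [_ [_ /emb_app_inv [a' [b' [_ [<- _]]]]]]]; exact: emb_V.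
  - exact: h4.
move=> [F [c [_ [_ [h1 [h2 [h3 [h4 h5]]]]]]]].
exists (v F), (v c); do 2 (split; first exact: emb_V).
split; first by move=> g0 /emb_lift_mem [g [<- gF]]; apply/emb_fun; exact: h1.
split.
  move=> g0 h0 /emb_lift_mem [g [<- gF]] /emb_lift [h <-] /emb_fun hf /emb_ult_mem hg.
  have [h' [hF e]] := h2 g h gF I hf hg; exists (v h'); split=> //; exact/emb_ult_eq.
split; first exact/emb_fun.
split; last exact/emb_app.
move=> g0 z0 /emb_app_inv [g [z [<- [<- a]]]].
apply/(emb_setof _ (Q := fun t : M => exists h : M, h ∈ F /\ ult_mem d D h g /\ app c h t)).
- move=> t; split.
    by move=> [h [hF [/emb_ult_mem hm /emb_app ha]]]; exists (v h).
  move=> [h0 [/emb_lift_mem [h [<- hF]] [/emb_ult_mem hm /emb_app ha]]]; by exists h.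
- by move=> t [h [_ [_ /emb_app_inv [a' [b' [_ [<- _]]]]]]]; exact: emb_V.
- exact: h4.
Qed.

End Transport.

(** * Nice names *)

Section ForcingRelation.

Context {N : zfc_model}.

Implicit Types a b c d f g h i j k p q r s v w x y z A B D E S X Y Z : N.

(** [N] stands for the ground model in this section, so the generic filter is given as a predicate
    instead of an element. *)
Variables (P T K : N) (G : N -> Prop).
Hypothesis hT : is_transitive T.
Hypothesis hK : is_transitive K.
Hypothesis GP : forall p, G p -> p ∈ P.
Hypothesis Gup : forall p q, p ∈ P -> G q -> subset p q -> G p.
Hypothesis Gdir : forall p q, G p -> G q -> exists r, G r /\ subset p r /\ subset q r.
Hypothesis Ggen : forall D, dense P D -> exists p, p ∈ D /\ G p.

Let sub_trans p q r : subset p q -> subset q r -> subset p r.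
Proof. by move=> h1 h2 z zp; exact: (h2 z (h1 z zp)). Qed.

Lemma generic_below p (Q : N -> Prop) : dfn (fun e => Q (e 0)) -> G p ->
  (forall p', p' ∈ P -> subset p p' -> exists q, q ∈ P /\ subset p' q /\ Q q) ->
  exists q, G q /\ Q q.
Proof.
move=> dQ Gp h.
have dD : dfn (fun e => Q (e 0) \/ forall q, q ∈ P -> subset (e 0) q -> ~ subset p q).
  by apply: dfn_or => //; dfn_tac.
have [|s [/(sepP dD) [sP [Qs|no]] Gs]] :=
  Ggen (D := sep P (fun s => Q s \/ forall q, q ∈ P -> subset s q -> ~ subset p q)).
- split; first by move=> z /(sepP dD) [].
  move=> s sP; case: (classic (exists q, q ∈ P /\ subset s q /\ subset p q)).
    move=> [q [qP [sq pq]]]; have [q' [q'P [qq' Qq']]] := h q qP pq.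
    by exists q'; split; [apply/(sepP dD); split=> //; left|exact: sub_trans qq'].
  move=> no; exists s; split=> //; apply/(sepP dD); split=> //; right=> q qP sq pq.
  by apply: no; exists q.
- by exists s.
- by have [r [Gr [pr sr]]] := Gdir Gp Gs; case: (no r (GP Gr) sr pr).
Qed.

(** [E p r x] reads "[p] forces that the value of the name [r] is [x]". *)
Definition forces_mem (E : N -> N -> N -> Prop) p r x : Prop :=
  forall r' q p', op r' q ∈ r -> q ∈ P -> p' ∈ P -> subset p p' -> subset q p' ->
  exists p'', p'' ∈ P /\ subset p' p'' /\ exists y, y ∈ x /\ E p'' r' y.

Definition forces_onto (E : N -> N -> N -> Prop) p r x : Prop :=
  forall y p', y ∈ x -> p' ∈ P -> subset p p' ->
  exists p'', p'' ∈ P /\ subset p' p'' /\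
    exists r' q, op r' q ∈ r /\ q ∈ P /\ subset q p'' /\ E p'' r' y.

Definition in_rel E p r x := op p (op r x) ∈ E.

(** The forcing relation for ground-model values is obtained as the largest relation closed under
    the two clauses. A union of sets thus replaces a recursion on names. *)
Definition bisimulation E : Prop := forall p r x, op p (op r x) ∈ E ->
  p ∈ P /\ r ∈ T /\ x ∈ K /\ forces_mem (in_rel E) p r x /\ forces_onto (in_rel E) p r x.

Definition max_bisimulation : N :=
  sep (prod P (prod T K)) (fun e => exists E, bisimulation E /\ e ∈ E).

Let dbis : dfn (fun e => exists E, bisimulation E /\ e 0 ∈ E).
Proof. by rewrite /bisimulation /forces_mem /forces_onto /in_rel; dfn_tac. Qed.

Notation F := (in_rel max_bisimulation).

Let forces_mono (E E' : N -> N -> N -> Prop) p r x : (forall p r x, E p r x -> E' p r x) ->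
  forces_mem E p r x -> forces_mem E' p r x.
Proof.
move=> h H r' q p' h1 h2 h3 h4 h5; have [p'' [p''P [s [y [yx e]]]]] := H r' q p' h1 h2 h3 h4 h5.
by exists p''; do 2 split=> //; exists y; split=> //; exact: h.
Qed.

Let onto_mono (E E' : N -> N -> N -> Prop) p r x : (forall p r x, E p r x -> E' p r x) ->
  forces_onto E p r x -> forces_onto E' p r x.
Proof.
move=> h H y p' h1 h2 h3; have [p'' [p''P [s [r' [q [h4 [h5 [h6 e]]]]]]]] := H y p' h1 h2 h3.
by exists p''; do 2 split=> //; exists r', q; do 3 split=> //; exact: h.
Qed.

Let sub_max E : bisimulation E -> forall p r x, in_rel E p r x -> F p r x.
Proof.
move=> bE p r x e; apply/(sepP dbis); split; last by exists E.
by have [pP [rT [xK _]]] := bE p r x e; rewrite !op_prod.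
Qed.

Lemma max_bisimulationP : bisimulation max_bisimulation.
Proof.
move=> p r x /(sepP dbis) [_ [E [bE e]]]; have [h1 [h2 [h3 [h4 h5]]]] := bE p r x e.
do 3 split=> //; split; [exact: forces_mono (sub_max bE) h4|exact: onto_mono (sub_max bE) h5].
Qed.

(** By maximality: the largest bisimulation stays a bisimulation when the triple, with all stronger
    conditions, is added. *)
Lemma forces_intro p r x : p ∈ P -> r ∈ T -> x ∈ K ->
  forces_mem F p r x -> forces_onto F p r x -> F p r x.
Proof.
move=> pP rT xK hm ho.
have dc : dfn (fun e => exists p1, subset p p1 /\ e 0 = op p1 (op r x)) by dfn_tac.
pose (E := cup max_bisimulation (sep (prod P (prod T K))
   (fun e => exists p1, subset p p1 /\ e = op p1 (op r x)))).
have FE p1 r1 x1 : F p1 r1 x1 -> in_rel E p1 r1 x1 by move=> h; apply/cupP; left.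
apply: (@sub_max E); last first.
  by apply/cupP; right; apply/(sepP dc); rewrite !op_prod; split; [do 2 split=> //|exists p; split].
move=> p1 r1 x1 /cupP [h|/(sepP dc) []].
  have [h1 [h2 [h3 [h4 h5]]]] := max_bisimulationP h.
  do 3 split=> //; split; [exact: forces_mono FE h4|exact: onto_mono FE h5].
rewrite !op_prod => -[h1 [h2 h3]] [p1' [s /op_inj [e1 /op_inj [e2 e3]]]]; subst p1' r1 x1.
do 3 split=> //; split.
  apply: forces_mono FE _ => r' q p' h4 h5 h6 h7 h8; exact: (hm r' q p' h4 h5 h6 (sub_trans s h7) h8).
by apply: onto_mono FE _ => y p' h4 h5 h6; exact: (ho y p' h4 h5 (sub_trans s h6)).
Qed.

Lemma forces_strengthen p p1 r x : F p r x -> p1 ∈ P -> subset p p1 -> F p1 r x.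
Proof.
move=> /max_bisimulationP [h1 [h2 [h3 [hm ho]]]] p1P s; apply: forces_intro => //.
  by move=> r' q p' h4 h5 h6 h7 h8; exact: (hm r' q p' h4 h5 h6 (sub_trans s h7) h8).
by move=> y p' h4 h5 h6; exact: (ho y p' h4 h5 (sub_trans s h6)).
Qed.

Lemma generic_forces_mem p r x r' q : F p r x -> G p -> op r' q ∈ r -> G q ->
  exists p'' y, G p'' /\ y ∈ x /\ F p'' r' y.
Proof.
move=> /max_bisimulationP [h1 [h2 [h3 [hm ho]]]] Gp rq Gq.
have [p0 [Gp0 [s1 s2]]] := Gdir Gp Gq.
have [||p'' [Gp'' [y [yx e]]]] := generic_below (p := p0) (Q := fun p'' => exists y, y ∈ x /\ F p'' r' y) _ Gp0.
- by rewrite /in_rel; dfn_tac.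
- move=> p' p'P s; apply: (hm r' q p') => //; first exact: GP.
    exact: sub_trans s.
  exact: sub_trans s.
- by exists p'', y.
Qed.

Lemma generic_forces_onto p r x y : F p r x -> G p -> y ∈ x ->
  exists p'' r' q, G p'' /\ op r' q ∈ r /\ G q /\ F p'' r' y.
Proof.
move=> /max_bisimulationP [h1 [h2 [h3 [hm ho]]]] Gp yx.
have [||p'' [Gp'' [r' [q [rq [qP [s e]]]]]]] := generic_below (p := p)
  (Q := fun p'' => exists r' q, op r' q ∈ r /\ q ∈ P /\ subset q p'' /\ F p'' r' y) _ Gp.
- by rewrite /in_rel; dfn_tac.
- by move=> p' p'P s; exact: (ho y p').
- by exists p'', r', q; do 3 split=> //; exact: (Gup qP Gp'' s).
Qed.

(** The three kinds of conditions are dense together: if nothing stronger than [p] is of the second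
    or third kind, then [p] satisfies both clauses and forces the value to be [x]. The second kind
    provides an element of the value outside [x], the third an element of [x] that the value
    misses. *)
Lemma generic_decides r x : r ∈ T -> x ∈ K ->
  (exists p, G p /\ F p r x) \/
  (exists p r' q, G p /\ op r' q ∈ r /\ G q /\
     forall y p'', y ∈ x -> p'' ∈ P -> subset p p'' -> ~ F p'' r' y) \/
  (exists p y, G p /\ y ∈ x /\
     forall p'' r' q, p'' ∈ P -> subset p p'' -> op r' q ∈ r -> q ∈ P -> subset q p'' -> ~ F p'' r' y).
Proof.
move=> rT xK.
pose (A := fun p => exists r' q, op r' q ∈ r /\ q ∈ P /\ subset q p /\
     forall y p'', y ∈ x -> p'' ∈ P -> subset p p'' -> ~ F p'' r' y).
pose (B := fun p => exists y, y ∈ x /\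
     forall p'' r' q, p'' ∈ P -> subset p p'' -> op r' q ∈ r -> q ∈ P -> subset q p'' -> ~ F p'' r' y).
have dD : dfn (fun e => F (e 0) r x \/ A (e 0) \/ B (e 0)) by rewrite /A /B /in_rel; dfn_tac.
have [|p [/(sepP dD) [pP hp] Gp]] := Ggen (D := sep P (fun p => F p r x \/ A p \/ B p)).
  split; first by move=> z /(sepP dD) [].
  move=> p pP; apply: NNPP => no.
  have no' p' : p' ∈ P -> subset p p' -> ~ A p' /\ ~ B p'.
    by move=> p'P s; split=> h; apply: no; exists p'; split=> //; apply/(sepP dD); auto.
  apply: no; exists p; split; last by [].
  apply/(sepP dD); split=> //; left; apply: forces_intro => //.
    move=> r' q p' h1 h2 h3 h4 h5; apply: NNPP => no; case: (no' p' h3 h4) => nA _; apply: nA.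
    exists r', q; do 3 split=> //; move=> y p'' yx p''P s e; apply: no.
    by exists p''; do 2 split=> //; exists y.
  move=> y p' h1 h2 h3; apply: NNPP => no; case: (no' p' h2 h3) => _ nB; apply: nB.
  exists y; split=> // p'' r' q h4 h5 h6 h7 h8 e; apply: no.
  by exists p''; do 2 split=> //; exists r', q.
case: hp => [h|[[r' [q [h1 [h2 [h3 h4]]]]]|[y [h1 h2]]]].
- by left; exists p.
- by right; left; exists p, r', q; do 3 split=> //; exact: (Gup h2 Gp h3).
- by right; right; exists p, y.
Qed.

End ForcingRelation.

Section NiceNames.

Context {N : zfc_model}.
Variable V : N -> Prop.
Hypothesis hVt : transitive_class V.
Hypothesis hV : ZFC V.

Variables (P G k : N).
Hypothesis VP : V P.
Hypothesis Vk : V k.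
Hypothesis hk : is_ord k.
Hypothesis hG : generic V P G.

Notation M := (inner_model hV).
Notation v := (@emb _ _ hV).

Lemma generic_meets D : V D -> dense P D -> exists p, p ∈ D /\ p ∈ G.
Proof. by move=> VD; exact: (proj2 hG). Qed.

Lemma generic_sub p : p ∈ G -> p ∈ P.
Proof. by have [[h _] _] := hG; exact: h. Qed.

Lemma generic_up p q : p ∈ P -> q ∈ G -> subset p q -> p ∈ G.
Proof. by have [[_ [_ [h _]]] _] := hG; exact: h. Qed.

Lemma generic_dir p q : p ∈ G -> q ∈ G -> exists r, r ∈ G /\ subset p r /\ subset q r.
Proof. by have [[_ [_ [_ h]]] _] := hG; exact: h. Qed.

(** Only ordinals below [k] have to be recognised as values of names: their elements are again below
    [k], so the induction on names stays among them. *)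
Lemma nice_name tau : V tau -> exists t, V t /\ subset t (prod k P) /\
  forall a, a ∈ k -> (a ∈ val G tau <-> exists p, p ∈ G /\ op a p ∈ t).
Proof.
move=> Vtau.
have [P' eP] := emb_lift hV VP; have [k' ek] := emb_lift hV Vk; have [t' et] := emb_lift hV Vtau.
have [T [hT sT]] := transitive_superset (sg t').
pose (G' := fun p : M => v p ∈ G).
have gP p : G' p -> p ∈ P'.
  by move/generic_sub; rewrite -eP.
have gup p q : p ∈ P' -> G' q -> subset p q -> G' p.
  move=> pP Gq /(emb_subset hVt) s; apply: (generic_up _ Gq s); by rewrite -eP.
have gdir p q : G' p -> G' q -> exists r, G' r /\ subset p r /\ subset q r.
  move=> Gp Gq; have [r0 [Gr [s1 s2]]] := generic_dir Gp Gq.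
  have [r er] := emb_lift hV (hVt VP (generic_sub Gr)); subst r0.
  by exists r; split=> //; split; apply/(emb_subset hVt).
have ggen D : dense P' D -> exists p, p ∈ D /\ G' p.
  move=> [/(emb_subset hVt) DP dD].
  have [||p0 [pD pG]] := @generic_meets (v D); first exact: emb_V.
    split; first by rewrite -eP.
    move=> p0; rewrite -eP => /(emb_lift_mem hVt) [p [<- pP]].
    have [q [qD s]] := dD p pP; exists (v q); split=> //; exact/(emb_subset hVt).
  by have [p [e pD']] := emb_lift_mem hVt pD; exists p; split=> //; rewrite /G' e.
have hk' : is_transitive k' by apply/(emb_transitive hVt); rewrite ek; exact: (proj1 hk).
pose (E := v (max_bisimulation P' T k')).
pose (R := fun p r x => op p (op r x) ∈ E).
have RE p r x : R (v p) (v r) (v x) <-> in_rel (max_bisimulation P' T k') p r x.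
  by rewrite /R /E -!(emb_op hVt).
have subT r' q r : r ∈ v T -> op r' q ∈ r -> r' ∈ v T.
  move=> rT rq; have tT : is_transitive (v T) by apply/(emb_transitive hVt).
  apply: (tT (sg r')); last by apply/sgP.
  by apply: (tT (op r' q)); [exact: (tT r)|apply/upP; left].
(* The truth lemma, by induction on names. If the value is [x], the two refuting alternatives of
   [generic_decides] contradict the induction hypothesis. *)
have truth : forall r, r ∈ v T -> forall x, x ∈ k ->
    ((exists p, p ∈ G /\ R p r x) <-> val G r = x).
  apply: (@name_ind _ (fun r => r ∈ v T -> forall x, x ∈ k ->
    ((exists p, p ∈ G /\ R p r x) <-> val G r = x))); first by rewrite /R; dfn_tac.
  move=> r0 IH r0T x0 x0k.
  have [r [er rT]] := emb_lift_mem hVt r0T.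
  have [x [ex xk]] : exists x, v x = x0 /\ x ∈ k' by apply: (emb_lift_mem hVt); rewrite ek.
  subst r0 x0.
  have IH' r' q y : op r' q ∈ r -> y ∈ x -> (exists p, G' p /\ in_rel (max_bisimulation P' T k') p r' y) <-> val G (v r') = v y.
    move=> rq yx; rewrite -(IH (v r') (v q)).
    - split; first by move=> [p [Gp /RE h]]; exists (v p).
      move=> [p0 [pG h]]; have [p e] := emb_lift hV (hVt VP (generic_sub pG)); subst p0.
      by exists p; split=> //; apply/RE.
    - by rewrite -(emb_op hVt).
    - by apply: (subT _ (v q) (v r)) => //; rewrite -(emb_op hVt).
    - exact: (ord_trans hk (y := v x)).
  have lift0 r0 q0 : op r0 q0 ∈ v r -> exists r' q, v r' = r0 /\ v q = q0 /\ op r' q ∈ r.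
    move=> h; have [h1 h2] := V_op_inv hVt (hVt (emb_V r) h).
    have [r' e1] := emb_lift hV h1; have [q e2] := emb_lift hV h2; exists r', q; do 2 split=> //.
    by move: h; rewrite -e1 -e2 -(emb_op hVt).
  split.
    move=> [p0 [pG h]]; have [p e] := emb_lift hV (hVt VP (generic_sub pG)); subst p0.
    move/RE: h => h; apply: set_ext => z; rewrite valP; split.
      move=> [r0 [q0 [qG [rq ->]]]]; have [r' [q [e1 [e2 rq']]]] := lift0 _ _ rq; subst r0 q0.
      have [p'' [y [Gp'' [yx e]]]] := generic_forces_mem gP gdir ggen h pG rq' qG.
      have <- // : v y = val G (v r').
      by symmetry; apply/(IH' r' q y rq' yx); exists p''.
    move/(emb_lift_mem hVt) => [y [<- yx]].
    have [p'' [r' [q [Gp'' [rq [Gq e]]]]]] := generic_forces_onto gP gup gdir ggen h pG yx.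
    exists (v r'), (v q); do 2 split=> //; first by rewrite -(emb_op hVt).
    by symmetry; apply/(IH' r' q y rq yx); exists p''.
  move=> e; case: (generic_decides gup ggen rT xk) => [[p [Gp h]]|[|]].
  - by exists (v p); split=> //; apply/RE.
  - move=> [p [r' [q [Gp [rq [Gq no]]]]]].
    have hz : val G (v r') ∈ v x.
      by rewrite -e; apply/valP; exists (v r'), (v q); do 2 split=> //; rewrite -(emb_op hVt).
    have [y [ey yx]] := emb_lift_mem hVt hz.
    have [p2 [Gp2 h2]] := proj2 (IH' r' q y rq yx) (eq_sym ey).
    have [p3 [Gp3 [s1 s2]]] := gdir _ _ Gp Gp2.
    by case: (no y p3 yx (gP _ Gp3) s1); apply: (forces_strengthen h2) => //; exact: gP.
  - move=> [p [y [Gp [yx no]]]].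
    have : v y ∈ val G (v r) by rewrite e.
    move/valP => [r0 [q0 [qG [rq ey]]]]; have [r' [q [e1 [e2 rq']]]] := lift0 _ _ rq; subst r0 q0.
    have [p2 [Gp2 h2]] := proj2 (IH' r' q y rq' yx) (eq_sym ey).
    have [p3 [Gp3 [s1 s2]]] := gdir _ _ Gp Gp2.
    have [p4 [Gp4 [s3 s4]]] := gdir _ _ Gp3 (qG : G' q).
    case: (no p4 r' q (gP _ Gp4) _ rq' (gP _ qG) s4).
      by move=> z zp; apply: s3; exact: s1.
    by apply: (forces_strengthen h2); [exact: gP|move=> z zp; apply: s3; exact: s2].
have dt : dfn (fun e => exists a p r q, e 0 = op a p /\ op r q ∈ t' /\ q ∈ P' /\ subset q p /\
   op p (op r a) ∈ max_bisimulation P' T k') by dfn_tac.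
pose (t := sep (prod k' P') (fun e => exists a p r q, e = op a p /\ op r q ∈ t' /\ q ∈ P' /\
   subset q p /\ op p (op r a) ∈ max_bisimulation P' T k')).
have t'T : t' ∈ T by apply: sT; apply/sgP.
exists (v t); split; first exact: emb_V.
split.
  move=> z /(emb_lift_mem hVt) [e [<- /(sepP dt) [/prodP [a [p [ak [pP ->]]]] _]]].
  by rewrite (emb_op hVt) op_prod -ek -eP.
move=> a0 ak0; have [a [ea ak]] : exists a, v a = a0 /\ a ∈ k' by apply: (emb_lift_mem hVt); rewrite ek.
subst a0; rewrite valP; split.
  move=> [r0 [q0 [qG [rq ea]]]].
  have [h1 h2] := V_op_inv hVt (hVt Vtau rq).
  have [r e1] := emb_lift hV h1; have [q e2] := emb_lift hV h2; subst r0 q0.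
  have rq' : op r q ∈ t' by move: rq; rewrite -et -(emb_op hVt).
  have rT : v r ∈ v T by apply: (subT _ (v q) (v t')) => //; rewrite et.
  have [p0 [pG h]] := proj2 (truth (v r) rT (v a) ak0) (eq_sym ea).
  have [p3 [p3G [s1 s2]]] := generic_dir pG qG.
  have [p e] := emb_lift hV (hVt VP (generic_sub p3G)); subst p3.
  have [p' e'] := emb_lift hV (hVt VP (generic_sub pG)); subst p0.
  exists (v p); split=> //; rewrite -(emb_op hVt).
  have goal : op a p ∈ t; last by exact: goal.
  apply/(sepP dt); rewrite op_prod; split; first by split=> //; exact: gP.
  exists a, p, r, q; do 2 split=> //; split; first exact: gP.
  split; first exact/(emb_subset hVt).
  move/RE: h => h; apply: (forces_strengthen h); [exact: gP|exact/(emb_subset hVt)].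
move=> [p0 [pG h]]; have [p e] := emb_lift hV (hVt VP (generic_sub pG)); subst p0.
have ht : op a p ∈ t by move: h; rewrite -(emb_op hVt).
move/(sepP dt): ht => [_ [a1 [p1 [r [q [/op_inj [e1 e2] [rq [qP [s h']]]]]]]]]; subst a1 p1.
have rq' : op (v r) (v q) ∈ tau by rewrite -et -(emb_op hVt).
exists (v r), (v q); split; first exact: (gup _ _ qP pG s).
split=> //; symmetry; apply: (proj1 (truth (v r) _ (v a) ak0)).
  by apply: (subT _ (v q) (v t')) => //; rewrite et.
by exists (v p); split=> //; apply/RE.
Qed.

End NiceNames.

(** * The extension *)

Section Bits.

Context {N : zfc_model}.

Definition bit (i : bool) : N := match i with true => sg emp | false => emp end.

Lemma is_empty_emp (x : N) : is_empty x <-> x = emp.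
Proof.
split; last by move=> -> z /empP.
by move=> h; apply: set_ext => z; rewrite empP; split=> // /h.
Qed.

Lemma is_bit_bit i (x : N) : is_bit i x <-> x = bit i.
Proof.
case: i; rewrite /is_bit /bit; last exact: is_empty_emp.
split.
  by move=> h; apply: set_ext => z; rewrite (h z) sgP is_empty_emp.
by move=> -> z; rewrite sgP is_empty_emp.
Qed.

Lemma bit_inj i i' : bit i = bit i' -> i = i'.
Proof.
have ne : emp <> sg emp :> N.
  by move=> e; have /empP : emp ∈ (emp : N) by rewrite {2}e; apply/sgP.
by case: i; case: i' => //= e; case: ne.
Qed.

End Bits.

Section Extension.

Context {N : zfc_model}.
Variable V : N -> Prop.
Hypothesis hVt : transitive_class V.
Hypothesis hV : ZFC V.

Notation M := (inner_model hV).
Notation v := (@emb _ _ hV).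

Implicit Types a b c d f g h j p q r s w x y z A B D E S X Y Z : N.

Variables (k U P G : N).
Hypothesis hU : normal_measure V k U.
Hypothesis hP : is_easton_product V k P.

Lemma V_U : V U.
Proof. by have [_ [[[? _] _] _]] := hU. Qed.

Lemma V_k : V k.
Proof. by have [_ [[[VU [_ [kU _]]] _] _]] := hU; exact: (hVt VU kU). Qed.

Lemma inner_measure : exists k' U' : M, v k' = k /\ v U' = U /\ normal_measure univ k' U'.
Proof.
have [k' ek] := emb_lift hV V_k; have [U' eU] := emb_lift hV V_U.
exists k', U'; do 2 split=> //; apply: (emb_normal_measure hVt); by rewrite ek eU.
Qed.

(** ** Conditions *)

Lemma cond_V p : p ∈ P -> V p.
Proof. by move/(hP p) => []. Qed.

Lemma cond_app p x y : p ∈ P -> app p x y -> x ∈ k /\ inaccessible V x /\ exists i, y = bit i.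
Proof.
move/(hP p) => [_ [X [[Xk _] [hX [pf pb]]]]] a; have xX := app_dom pf a.
split; first exact: Xk; split; first exact: hX.
have [i hi] := pb x y a; exists i; exact/is_bit_bit.
Qed.

Lemma cond_pair p z : p ∈ P -> z ∈ p -> exists x y, z = op x y.
Proof.
move/(hP p) => [_ [X [_ [_ [pf _]]]]] zp; have [x [y [_ +]]] := proj1 pf z zp.
by move/is_opair_op; exists x, y.
Qed.

Lemma cond_fun p x y y' : p ∈ P -> app p x y -> app p x y' -> y = y'.
Proof.
by move/(hP p) => [_ [X [_ [_ [[_ [_ hf]] _]]]]]; exact: hf.
Qed.

Lemma cond_bounded p l : p ∈ P -> (l ∈ k /\ inaccessible V l) \/ l = k ->
  exists c, c ∈ l /\ forall x y, app p x y -> x ∈ l -> x ∈ c.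
Proof.
move/(hP p) => [_ [X [[_ hX] [_ [pf _]]]]] /hX [c [cl hc]].
exists c; split=> // x y a; apply: hc; exact: (app_dom pf a).
Qed.

Definition remove a p := sep p (fun e => ~ exists y, e = op a y).

Lemma removeP a p z : z ∈ remove a p <-> z ∈ p /\ ~ exists y, z = op a y.
Proof. by rewrite sepP //; dfn_tac. Qed.

Lemma dtm_remove (a p : (nat -> N) -> N) : dtm a -> dtm p -> dtm (fun e => remove (a e) (p e)).
Proof. by apply: (dtm_fun2 (F := remove)); rewrite /remove; dfn_tac. Qed.

Lemma remove_app a p x y : app (remove a p) x y <-> app p x y /\ x <> a.
Proof.
rewrite !app_op removeP; split.
  by move=> [h no]; split=> // e; apply: no; exists y; rewrite e.
by move=> [h ne]; split=> // -[y' /op_inj []].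
Qed.

Lemma remove_cond a p : V a -> p ∈ P -> remove a p ∈ P.
Proof.
move=> Va pP; have [a' ea] := emb_lift hV Va; have [p' ep] := emb_lift hV (cond_V pP).
have [_ [X [[Xk hX] [hI [pf pb]]]]] := proj1 (hP p) pP.
have dn : dfn (fun e => e 0 <> a) by dfn_tac.
apply/(hP _); split.
  have dm : dfn (fun e : nat -> M => ~ exists y : M, e 0 = op a' y) by dfn_tac.
  have <- : v (sep p' (fun e : M => ~ exists y : M, e = op a' y)) = remove a p; last exact: emb_V.
  apply: set_ext => z; rewrite removeP -ep; split.
    move/(emb_lift_mem hVt) => [z' [<- /(sepP dm) [zp no]]]; split=> // -[y].
    rewrite -ea => e; have [_ Vy] : V a /\ V y by apply: (V_op_inv hVt); rewrite -ea -e; exact: emb_V.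
    have [y' ey] := emb_lift hV Vy; apply: no; exists y'; apply: emb_inj; by rewrite (emb_op hVt) ey.
  move=> [/(emb_lift_mem hVt) [z' [<- zp]] no].
  have h : z' ∈ sep p' (fun e : M => ~ exists y : M, e = op a' y); last exact: h.
  apply/(sepP dm); split=> // -[y e]; apply: no; exists (v y); by rewrite e (emb_op hVt) ea.
exists (sep X (fun x => x <> a)); split.
  split; first by move=> z /(sepP dn) [/Xk].
  move=> l /hX [b [bl hb]]; exists b; split=> // x /(sepP dn) [xX _]; exact: hb.
split; first by move=> x /(sepP dn) [/hI].
split; last by move=> x y /remove_app [h _]; exact: (pb x y).
split.
  move=> z /removeP [zp no]; have [x [y [xX +]]] := proj1 pf z zp.
  move=> /[dup] /is_opair_op e o; exists x, y; split=> //; apply/(sepP dn); split=> // ex.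
  by apply: no; exists y; rewrite -ex.
split.
  move=> x /(sepP dn) [xX ne]; have [y h] := proj1 (proj2 pf) x xX.
  by exists y; apply/remove_app.
move=> x y y' /remove_app [h _] /remove_app [h' _]; exact: (proj2 (proj2 pf) x y y').
Qed.

(** Regularity applied to a constant function on omega: a bound for its value is an ordinal of [l]
    above [a]. *)
Lemma inaccessible_limit l a : l ∈ k -> inaccessible V l -> a ∈ l -> exists c, c ∈ l /\ a ∈ c.
Proof.
move=> lk [[ol [w [hw wl]]] [hr _]] al.
have Vl := hVt V_k lk.
have [w' ew] := emb_lift hV (hVt Vl wl); have [a' ea] := emb_lift hV (hVt Vl al).
have dc : dtm (fun _ : nat -> M => a') by exact: dtm_const.
pose (f := fn w' (fun _ => a')).
have fm : is_map (v f) w (fun y => y ∈ l).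
  rewrite -ew; split; first by apply/(emb_fun hVt); exact: fn_fun.
  move=> x y /(emb_app_inv hVt) [x' [y' [_ [<- /(fn_app dc) [_ ->]]]]]; by rewrite ea.
have [c [cl hc]] := hr w (v f) wl (emb_V f) fm; exists c; split=> //.
have [[_ [[n nw] _]] _] := hw.
have [n' [en nw']] : exists n', v n' = n /\ n' ∈ w' by apply: (emb_lift_mem hVt); rewrite ew.
apply: (hc n a); rewrite -en -ea; apply/(emb_app hVt); exact/(fn_app dc).
Qed.

Lemma extend_cond a p : is_limit k -> a ∈ k -> inaccessible V a -> p ∈ P ->
  (forall y, ~ app p a y) -> cup p (sg (op a emp)) ∈ P.
Proof.
move=> limk ak ia pP no; have ok := proj1 limk.
have [a' ea] := emb_lift hV (hVt V_k ak); have [p' ep] := emb_lift hV (cond_V pP).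
have [_ [X [[Xk hX] [hI [pf pb]]]]] := proj1 (hP p) pP.
have happ x y : app (cup p (sg (op a emp))) x y <-> app p x y \/ (x = a /\ y = emp).
  by rewrite !app_op cupP sgP op_inj.
apply/(hP _); split.
  have <- : v (cup p' (sg (op a' emp))) = cup p (sg (op a emp)); last exact: emb_V.
  have e0 : v emp = emp.
    by apply: set_ext => z; rewrite empP; split=> // /(emb_lift_mem hVt) [y [_ /empP]].
  apply: set_ext => z; rewrite cupP sgP -ep -ea -e0 -(emb_op hVt); split.
    by move/(emb_lift_mem hVt) => [z' [<- /cupP [h|/sgP ->]]]; [left|right].
  case=> [/(emb_lift_mem hVt) [z' [<- h]]|->].
    have h' : z' ∈ cup p' (sg (op a' emp)) by apply/cupP; left.
    exact: h'.
  have h' : op a' emp ∈ cup p' (sg (op a' emp)) by apply/cupP; right; apply/sgP.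
  exact: h'.
exists (cup X (sg a)); split.
  split; first by move=> z /cupP [/Xk //|/sgP ->].
  move=> l hl; have [b [bl hb]] := hX l hl.
  have ol : is_ord l by case: hl => [[lk _]|->] //; exact: (ord_mem ok lk).
  have lim x : x ∈ l -> exists c, c ∈ l /\ x ∈ c.
    case: hl => [[lk il]|->]; first exact: inaccessible_limit.
    exact: (proj2 (proj2 limk)).
  case: (classic (a ∈ l)) => al; last first.
    exists b; split=> // x /cupP [xX|/sgP ->] // xl; exact: hb.
  have ob := ord_mem ol bl; have oa := ord_mem ol al.
  (* [m] is the larger of the old bound and [a]; since [l] is a limit, some ordinal of [l] above [m]
     bounds the enlarged domain. *)
  have [m [ml [bm am]]] : exists m, m ∈ l /\ subset b (succ m) /\ a ∈ succ m.
    case: (ord_trich ob oa) => [h|[h|h]].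
    - exists a; split=> //; split; last by apply/succP; right.
      by move=> z zb; apply/succP; left; exact: (ord_trans oa zb h).
    - exists a; split=> //; split; last by apply/succP; right.
      by move=> z zb; apply/succP; left; rewrite -h.
    - exists b; split=> //; split; last by apply/succP; left.
      by move=> z zb; apply/succP; left.
  have [c [cl mc]] := lim m ml; exists c; split=> //.
  have sc z : z ∈ succ m -> z ∈ c.
    by move/succP => [zm|->] //; exact: (ord_trans (ord_mem ol cl) zm mc).
  by move=> x /cupP [xX|/sgP ->] xl; apply: sc => //; apply: bm; exact: hb.
split; first by move=> x /cupP [/hI|/sgP ->].
split; last first.
  move=> x y /happ [h|[_ ->]]; first exact: (pb x y).
  by exists false; apply/is_bit_bit.
split.
  move=> z /cupP [zp|/sgP ->].
    have [x [y [xX e]]] := proj1 pf z zp; exists x, y; split=> //; apply/cupP; by left.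
  exists a, emp; split; [apply/cupP; right; exact/sgP|exact/is_opair_op].
split.
  move=> x /cupP [xX|/sgP ->].
    by have [y h] := proj1 (proj2 pf) x xX; exists y; apply/happ; left.
  by exists emp; apply/happ; right.
move=> x y y' /happ [h|[e1 e2]] /happ [h'|[e1' e2']].
- exact: (proj2 (proj2 pf) x y y').
- by subst x; case: (no y).
- by subst x; case: (no y').
- by subst.
Qed.

Hypothesis VP : V P.
Hypothesis hG : generic V P G.

Lemma generic_domain a : is_limit k -> a ∈ k -> inaccessible V a ->
  exists p y, p ∈ G /\ app p a y.
Proof.
move=> limk ak ia; have [a' ea] := emb_lift hV (hVt V_k ak); have [P' eP] := emb_lift hV VP.
have dm : dfn (fun e : nat -> M => exists y : M, app (e 0) a' y) by dfn_tac.
pose (D := sep P' (fun p : M => exists y : M, app p a' y)).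
have DP p : p ∈ v D <-> p ∈ P /\ exists y, app p a y.
  split.
    move/(emb_lift_mem hVt) => [p' [<- /(sepP dm) [pP [y h]]]]; split; first by rewrite -eP.
    by exists (v y); rewrite -ea; apply/(emb_app hVt).
  rewrite -eP => -[/(emb_lift_mem hVt) [p' [<- pP]] [y]].
  rewrite -ea => /(emb_app_inv hVt) [a1 [y' [/emb_inj -> [_ h]]]].
  have h' : p' ∈ D by apply/(sepP dm); split=> //; exists y'.
  exact: h'.
have [|p [/DP [_ [y h]] pG]] := proj2 hG (v D) (emb_V D).
  split; first by move=> p /DP [].
  move=> p pP; case: (classic (exists y, app p a y)) => [[y h]|no].
    by exists p; split=> //; apply/DP; split=> //; exists y.
  exists (cup p (sg (op a emp))); split; last by move=> z zp; apply/cupP; left.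
  apply/DP; split; first by apply: extend_cond => // y h; apply: no; exists y.
  by exists emp; apply/app_op/cupP; right; apply/sgP.
by exists p, y.
Qed.

(** ** The ultrapowers *)

Variables (jP Gs : N) (H meas : bool -> N).
Hypothesis hjP : ult_embedding V k U P jP.
Hypothesis hH : forall i, is_product_filter k jP G i Gs (H i).
Hypothesis hmeas : forall i, normal_measure univ k (meas i).
Hypothesis hmeas_extends : forall i x y, V x ->
  ult_embedding V k U x y -> ult_embedding univ k (meas i) x y.
Hypothesis hmeas_G : forall i, ult_embedding univ k (meas i) G (H i).

Let cl i f := cls k (meas i) f.
Let cst x := const k x.

Lemma dtm_cl i (f : (nat -> N) -> N) : dtm f -> dtm (fun e => cl i (f e)).
Proof. exact: dtm_cls. Qed.

Lemma ult_embedding_V x : V x -> exists y, V y /\ ult_embedding V k U x y.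
Proof.
move=> Vx; have [k' [U' [ek [eU hk']]]] := inner_measure.
have [x' ex] := emb_lift hV Vx; have [w [hw [_ hc]]] := nm_omega hk'.
have [y hy] := ult_value_ex (nm_uf hk') hw hc (const_fun k' x').
exists (v y); split; first exact: emb_V.
exists (v (const k' x')); split; first exact: emb_V.
split; last by rewrite -ek -eU; apply/(emb_ult_value hVt).
have eq_v (z : M) : z = x' <-> v z = v x' by split=> [->|/emb_inj].
rewrite -ek -ex; apply: (proj1 (emb_map hVt (const k' x') k' eq_v)).
split; first exact: const_fun.
have dx : dtm (fun _ : nat -> M => x') by exact: dtm_const.
by move=> i y' /(fn_app dx) [].
Qed.

Lemma embedding_cst x y i : V x -> ult_embedding V k U x y -> y = cl i (cst x).
Proof. by move=> Vx /(hmeas_extends i Vx) /(ult_embedding_E (hmeas i)). Qed.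

Lemma V_cst x i : V x -> V (cl i (cst x)).
Proof. by move=> Vx; have [y [Vy h]] := ult_embedding_V Vx; rewrite -(embedding_cst i Vx h). Qed.

Lemma cst_indep x i i' : V x -> cl i (cst x) = cl i' (cst x).
Proof.
by move=> Vx; have [y [Vy h]] := ult_embedding_V Vx; rewrite -(embedding_cst i Vx h); exact: embedding_cst.
Qed.

Lemma jP_cst i : jP = cl i (cst P).
Proof. exact: embedding_cst. Qed.

Lemma H_cst i : H i = cl i (cst G).
Proof. by apply/(ult_embedding_E (hmeas i)). Qed.

(** In [V] the class of [f] is [j_U(f)] evaluated at [κ], because [κ] is the class of the identity.
    The embedding by [U_i] extends [j_U] and represents [κ] in the same way, so the evaluation gives
    the class modulo [U_i]. *)
Lemma ult_value_V f s i : V f -> is_fun f k -> ult_value V k U f s -> s = cl i f.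
Proof.
move=> Vf ff hs; have [k' [U' [ek [eU hk']]]] := inner_measure.
have [f' ef] := emb_lift hV Vf; have Vs : V s.
  by have [F [c [_ [Vc [_ [_ [_ [_ /app_op h]]]]]]]] := hs; case: (V_op_inv hVt (hVt Vc h)).
have [s' es] := emb_lift hV Vs.
have ff' : is_fun f' k' by apply/(emb_fun hVt); rewrite ef ek.
have es' : s' = cls k' U' f'.
  by apply/(ult_value_E hk') => //; apply/(emb_ult_value hVt); rewrite ek eU ef es.
have dop : dtm (fun e => op (ap (idf k') (e 0)) (ap f' (e 0))) by dfn_tac.
have h : op k' s' ∈ cls k' U' (const k' f').
  rewrite es' -{1}(cls_idf hk') -(cls_op hk') //; last exact: idf_fun.
  apply/(cls_const_mem hk'); first exact: fn_fun.
  apply: (al_all (nm_uf hk')); first by rewrite /idf; dfn_tac.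
  by move=> j jk; rewrite ap_fn // ap_idf //; apply/app_op/(app_ap ff' jk).
have [y [Vy hy]] := ult_embedding_V Vf.
have ey : v (cls k' U' (const k' f')) = y.
  have [g [Vg [gm hg]]] := hy; have [g' eg] := emb_lift hV Vg; have [y' ey] := emb_lift hV Vy.
  rewrite -ey; congr v.
  have gm' : is_map g' k' (fun z : M => z = f').
    have eq_v (z : M) : z = f' <-> v z = f by rewrite -ef; split=> [->|/emb_inj].
    by apply: (proj2 (emb_map hVt g' k' (Q' := fun z : N => z = f) eq_v)); rewrite eg ek.
  move: gm' => /const_map e; subst g'; symmetry; apply/(ult_value_E hk'); first exact: const_fun.
  by apply/(emb_ult_value hVt); rewrite ek eU eg ey.
have h2 : app (cl i (cst f)) k s.
  rewrite app_op -(embedding_cst i Vf hy) -ey -ek -es -(emb_op hVt); exact: h.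
have [g [l [gf [lf [e1 [e2 h3]]]]]] := cls_app_inv (hmeas i) (const_fun k f) h2.
rewrite e2; apply/(cls_eq (hmeas i)) => //.
have eg : al k (meas i) (fun j => ap g j = ap (idf k) j).
  by apply/(cls_eq (hmeas i)) => //; [exact: idf_fun|rewrite -e1 (cls_idf (hmeas i))].
apply: (al_mono2 (nm_uf (hmeas i)) _ h3 eg); first by dfn_tac.
move=> j jk; rewrite ap_const // ap_idf // => a e; rewrite e in a.
by rewrite (ap_app ff a).
Qed.

(** [G] with its value at the coordinate [a] replaced by [i]. *)
Definition flip i a := sep P (fun p => (forall y, app p a y -> is_bit i y) /\
  exists q, q ∈ G /\ forall x y, x <> a -> (app p x y <-> app q x y)).

Lemma flipP i a p : p ∈ flip i a <-> p ∈ P /\ (forall y, app p a y -> is_bit i y) /\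
  exists q, q ∈ G /\ forall x y, x <> a -> (app p x y <-> app q x y).
Proof. by rewrite sepP //; case: i; dfn_tac. Qed.

Lemma dtm_flip i (a : (nat -> N) -> N) : dtm a -> dtm (fun e => flip i (a e)).
Proof. by apply: (dtm_fun1 (F := flip i)); rewrite /flip; case: i; dfn_tac. Qed.

Let dflip i : dtm (fun e => flip i (e 0)).
Proof. exact: dtm_flip (dtm_var 0). Qed.

Lemma fixed_emp i : fixed k (meas i) emp.
Proof.
apply: (small_fixed (hmeas i)); last by move=> y /empP.
by move=> h hf hh; case: (al_contra (nm_uf (hmeas i)) hh) => j _ /empP.
Qed.

Lemma fixed_bit i (b : bool) : fixed k (meas i) (bit b).
Proof.
case: b; last exact: fixed_emp.
by apply: (fixed_up (hmeas i)); exact: fixed_emp.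
Qed.

Lemma restriction_off t u (Q : N -> Prop) g : (forall x, Q x -> x <> k) ->
  (forall z, z ∈ t -> exists x y, z = op x y) -> (forall z, z ∈ u -> exists x y, z = op x y) ->
  (forall x y, x <> k -> (app t x y <-> app u x y)) -> is_restriction t Q g -> is_restriction u Q g.
Proof.
move=> hQ pt pu h hg z; rewrite (hg z); split=> -[zt [x [y [/is_opair_op e Qx]]]]; subst z.
  split; last by exists x, y; split=> //; apply/is_opair_op.
  by apply/app_op/(h _ _ (hQ x Qx))/app_op.
split; last by exists x, y; split=> //; apply/is_opair_op.
by apply/app_op/(h _ _ (hQ x Qx))/app_op.
Qed.

(** The two filters have the same parts below and above [κ], and at [κ] they constrain only a value
    that is present. So a change at [κ] alone moves a condition from one to the other. *)
Lemma H_off i i' t u : t ∈ H i -> u ∈ jP -> (forall x y, x <> k -> (app t x y <-> app u x y)) ->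
  (forall y, app u k y -> is_bit i' y) -> u ∈ H i'.
Proof.
(* Elements of conditions of [jP] are ordered pairs, so conditions can be compared through [app].
   The two coordinates are chosen one after the other, at almost all indices. *)
have pj z t0 : t0 ∈ jP -> z ∈ t0 -> exists x y, z = op x y.
  rewrite (jP_cst i) => /(clsP (hmeas i) _ (const_fun k P)) [h [hf [hh ->]]].
  move/(clsP (hmeas i) _ hf) => [g [gf [hg ->]]].
  have [||x [xf hx]] := @al_choice _ k (meas i) (nm_uf (hmeas i))
    (fun j x => exists y, ap g j = op x y) (Un (Un (Un (Un g)))).
  - by dfn_tac.
  - apply: (al_mono2 (nm_uf (hmeas i)) _ hh hg); first by dfn_tac.
    move=> j jk; rewrite ap_const // => hjP' /(cond_pair hjP') [x [y e]].
    exists x; split; last by exists y.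
    have /app_op/op_mem_Un [_] := app_ap gf jk; rewrite e => e'.
    have h1 : sg x ∈ Un (Un (Un g)) by apply/UnP; exists (op x y); split=> //; apply/upP; left.
    by apply/UnP; exists (sg x); split=> //; apply/sgP.
  have [||y [yf hy]] := @al_choice _ k (meas i) (nm_uf (hmeas i))
    (fun j y => ap g j = op (ap x j) y) (Un (Un (Un (Un g)))).
  - by dfn_tac.
  - apply: (al_mono (nm_uf (hmeas i)) _ _ hx); first by dfn_tac.
    move=> j jk [y e]; exists y; split=> //.
    have /app_op/op_mem_Un [_] := app_ap gf jk; rewrite e => e'.
    have h1 : up (ap x j) y ∈ Un (Un (Un g)) by apply/UnP; exists (op (ap x j) y); split=> //; apply/upP; right.
    by apply/UnP; exists (up (ap x j) y); split=> //; apply/upP; right.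
  exists (cl i x), (cl i y); rewrite /cl -(cls_op (hmeas i)) //; apply/(cls_eq (hmeas i)) => //.
    by apply: fn_fun; dfn_tac.
  apply: (al_mono (nm_uf (hmeas i)) _ _ hy); first by dfn_tac.
  by move=> j jk ->; rewrite ap_fn //; dfn_tac.
move/(hH i t) => [tj [[g1 [r1 G1]] [_ [g2 [r2 G2]]]]] uj off bits.
have ok := nm_ord (hmeas i).
apply/(hH i' u); split=> //; split.
  exists g1; split=> //; apply: (restriction_off _ _ _ off r1).
  - by move=> x xk e; apply: (@mem_irrefl _ k); rewrite -{1}e.
  - by move=> z; exact: pj.
  - by move=> z; exact: pj.
split=> //; exists g2; split=> //; apply: (restriction_off _ _ _ off r2).
- by move=> x xk e; apply: (@mem_irrefl _ k); rewrite -{2}e.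
- by move=> z; exact: pj.
- by move=> z; exact: pj.
Qed.

Lemma cls_off i f g : is_fun f k -> is_fun g k ->
  al k (meas i) (fun a => forall x y, x <> a -> (app (ap f a) x y <-> app (ap g a) x y)) ->
  forall x y, x <> k -> (app (cl i f) x y <-> app (cl i g) x y).
Proof.
have half f' g' : is_fun f' k -> is_fun g' k ->
    al k (meas i) (fun a => forall x y, x <> a -> (app (ap f' a) x y <-> app (ap g' a) x y)) ->
    forall x y, x <> k -> app (cl i f') x y -> app (cl i g') x y.
  move=> ff gf h x y ne /(cls_app_inv (hmeas i) ff) [x' [y' [xf [yf [e1 [e2 h']]]]]].
  subst x y; apply/(cls_app (hmeas i)) => //.
  have ne' : al k (meas i) (fun a => ap x' a <> a).
    have de : dfn (fun e => ap x' (e 0) = e 0) by dfn_tac.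
    apply/(al_not (nm_uf (hmeas i)) de) => e; apply: ne; rewrite -{2}(cls_idf (hmeas i)).
    apply/(cls_eq (hmeas i)) => //; first exact: idf_fun.
    by apply: (al_mono (nm_uf (hmeas i)) _ _ e); [rewrite /idf; dfn_tac|move=> a ak ->; rewrite ap_idf].
  apply: (al_mono2 (nm_uf (hmeas i)) _ h (al_and (nm_uf (hmeas i)) h' ne')); first by dfn_tac.
  by move=> a ak ha [hb hc]; apply/(ha _ _ hc).
move=> ff gf h x y ne; split; apply: half => //.
apply: (al_mono (nm_uf (hmeas i)) _ _ h); first by dfn_tac.
by move=> a ak ha x' y' ne'; rewrite (ha _ _ ne').
Qed.

Lemma cls_app_crit i f y : is_fun f k -> app (cl i f) k y ->
  exists l, is_fun l k /\ y = cl i l /\ al k (meas i) (fun a => app (ap f a) a (ap l a)).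
Proof.
move=> ff /(cls_app_inv (hmeas i) ff) [g [l [gf [lf [e1 [e2 h]]]]]]; exists l; do 2 split=> //.
have eg : al k (meas i) (fun j => ap g j = ap (idf k) j).
  by apply/(cls_eq (hmeas i)) => //; [exact: idf_fun|rewrite -e1 (cls_idf (hmeas i))].
apply: (al_mono2 (nm_uf (hmeas i)) _ h eg); first by dfn_tac.
by move=> j jk + e; rewrite e ap_idf.
Qed.

Lemma cls_app_critE i f l : is_fun f k -> is_fun l k ->
  app (cl i f) k (cl i l) <-> al k (meas i) (fun a => app (ap f a) a (ap l a)).
Proof.
move=> ff lf; have h := cls_app (hmeas i) ff (idf_fun k) lf.
rewrite (cls_idf (hmeas i)) in h; rewrite /cl h.
by apply: al_iff => a ak; rewrite ap_idf.
Qed.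

Lemma cls_bit i l (b : bool) : is_fun l k -> al k (meas i) (fun a => ap l a = bit b) -> cl i l = bit b.
Proof.
move=> lf h; rewrite -(fixed_bit i b); apply/(cls_eq (hmeas i)) => //; first exact: const_fun.
by apply: (al_mono (nm_uf (hmeas i)) _ _ h); [dfn_tac|move=> a ak; rewrite ap_const].
Qed.

(** A member of the class agrees off [κ] with a member of [H i] and has no value other than [i'] at
    [κ]. Conversely, erasing the value at [κ] from a condition of [H i'] leaves a condition of
    [H i], which is represented by conditions in [G]. The case of distinct [i] and [i'] is the
    bridge between the two ultrapowers. *)
Lemma cls_flip i i' : cl i (fn k (flip i')) = H i'.
Proof.
have uf := nm_uf (hmeas i); apply: set_ext => t.
rewrite (clsP (hmeas i)); last exact: fn_fun.
have e h : al k (meas i) (fun a => ap h a ∈ ap (fn k (flip i')) a) <->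
    al k (meas i) (fun a => ap h a ∈ flip i' a).
  by apply: al_iff => a ak; rewrite ap_fn.
split.
  move=> [h [hf [/e hh ->]]].
  have hPa : al k (meas i) (fun a => ap h a ∈ P).
    by apply: (al_mono uf _ _ hh); [dfn_tac|move=> a ak /flipP []].
  have [||q [qf hq]] := @al_choice _ k (meas i) uf (fun a q => q ∈ G /\
    forall x y, x <> a -> (app (ap h a) x y <-> app q x y)) G.
  - by dfn_tac.
  - apply: (al_mono uf _ _ hh); first by dfn_tac.
    by move=> a ak /flipP [_ [_ [q [qG hq]]]]; exists q.
  have qH : cl i q ∈ H i.
    rewrite (H_cst i); apply/(cls_const_mem (hmeas i)) => //.
    by apply: (al_mono uf _ _ hq); [dfn_tac|move=> a ak []].
  apply: (H_off qH).
  - by rewrite (jP_cst i); apply/(cls_const_mem (hmeas i)).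
  - apply: cls_off => //; apply: (al_mono uf _ _ hq); first by dfn_tac.
    by move=> a ak [_ hx] x y ne; rewrite (hx x y ne).
  - move=> y /(cls_app_crit hf) [l [lf [-> hl]]]; apply/is_bit_bit/cls_bit => //.
    apply: (al_mono2 uf _ hh hl); first by dfn_tac.
    by move=> a ak /flipP [_ [hb _]] /hb /is_bit_bit.
move=> tH; have [tj [_ [tb _]]] := proj1 (hH i' t) tH.
move: (tj); rewrite {1}(jP_cst i) => /(clsP (hmeas i) _ (const_fun k P)) [h [hf [hPa et]]].
exists h; split=> //; split=> //; apply/e.
have {}hPa : al k (meas i) (fun a => ap h a ∈ P).
  by apply: (al_mono uf _ _ hPa); [dfn_tac|move=> a ak; rewrite ap_const].
(* Failure would occur almost everywhere; as bits are not moved, the class would then have the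
   opposite bit as its value at [κ]. *)
have hb : al k (meas i) (fun a => forall y, app (ap h a) a y -> y = bit i').
  have db : dfn (fun e => forall y, app (ap h (e 0)) (e 0) y -> y = bit i') by dfn_tac.
  apply: NNPP => /(al_not uf db) nb.
  have [||l [lf hl]] := @al_choice _ k (meas i) uf (fun a y => app (ap h a) a y /\ y = bit (negb i'))
    (sg (bit (negb i'))).
  - by dfn_tac.
  - apply: (al_mono2 uf _ nb hPa); first by dfn_tac.
    move=> a ak no haP; apply: NNPP => no'; apply: no => y ay; apply: NNPP => ne; apply: no'.
    have [_ [_ [b eb]]] := cond_app haP ay; exists y.
    have eb' : y = bit (negb i').
      by rewrite eb; congr bit; case: b eb => eb; move: ne; rewrite eb; case: (i').
    by split; [apply/sgP|].
  have e1 : cl i l = bit (negb i').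
    by apply: cls_bit => //; apply: (al_mono uf _ _ hl); [dfn_tac|move=> a ak []].
  have : is_bit i' (cl i l).
    apply: tb; rewrite et; apply/cls_app_critE => //.
    by apply: (al_mono uf _ _ hl); [dfn_tac|move=> a ak []].
  by rewrite is_bit_bit e1 => /bit_inj; case: (i').
have dr : dtm (fun e => remove (e 0) (ap h (e 0))) by apply: dtm_remove; dfn_tac.
pose (q := fn k (fun a => remove a (ap h a))).
have qf : is_fun q k by exact: fn_fun.
have qP : al k (meas i) (fun a => ap q a ∈ P).
  apply: (al_mono uf _ _ hPa); first by dfn_tac.
  by move=> a ak haP; rewrite ap_fn //; apply: remove_cond => //; exact: (hVt V_k ak).
have qH : cl i q ∈ H i.
  apply: (H_off tH).
  - by rewrite (jP_cst i); apply/(cls_const_mem (hmeas i)).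
  - rewrite et; apply: cls_off => //; apply: (al_all uf); first by dfn_tac.
    move=> a ak x y ne; rewrite ap_fn // remove_app; tauto.
  - move=> y /(cls_app_crit qf) [l [lf [_ hl]]]; case: (al_contra uf hl) => a ak.
    by rewrite ap_fn // remove_app => -[].
have qG : al k (meas i) (fun a => ap q a ∈ G).
  by apply/(cls_const_mem (hmeas i)) => //; rewrite -/(cst G) -/(cl i q) -/(cl i (cst G)) -H_cst.
apply: (al_mono2 uf _ (al_and uf hPa hb) qG); first by repeat first [apply: dtm_flip | dfn_step].
move=> a ak [haP hab] qaG; apply/flipP; split=> //; split.
  by move=> y /hab /is_bit_bit.
exists (ap q a); split=> // x y ne; rewrite ap_fn // remove_app; tauto.
Qed.

(** The right-hand side says that [κ ∈ j(t)], evaluated by the class of [g]. *)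
Lemma cls_evaluation i t g : is_fun g k -> subset t (prod k P) ->
  al k (meas i) (fun a => exists p, p ∈ ap g a /\ op a p ∈ t) <->
  exists p, p ∈ cl i g /\ op k p ∈ cl i (cst t).
Proof.
move=> gf tP; have uf := nm_uf (hmeas i).
have key h : is_fun h k -> op k (cl i h) ∈ cl i (cst t) <-> al k (meas i) (fun a => op a (ap h a) ∈ t).
  move=> hf; rewrite -app_op cls_app_critE //; last exact: const_fun.
  by apply: al_iff => a ak; rewrite ap_const // app_op.
split.
  move=> hal; have [||h [hf hh]] := @al_choice _ k (meas i) uf (fun a p => p ∈ ap g a /\ op a p ∈ t) P.
  - by dfn_tac.
  - apply: (al_mono uf _ _ hal); first by dfn_tac.
    by move=> a ak [p [pg pt]]; exists p; split=> //; have /op_prod [] := tP _ pt.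
  exists (cl i h); split.
    apply/(cls_mem (hmeas i)) => //.
    by apply: (al_mono uf _ _ hh); [dfn_tac|move=> a ak []].
  by apply/key => //; apply: (al_mono uf _ _ hh); [dfn_tac|move=> a ak []].
move=> [p [/(clsP (hmeas i) _ gf) [h [hf [hh ->]]] /(key _ hf) ht]].
apply: (al_mono2 uf _ hh ht); first by dfn_tac.
by move=> a ak h1 h2; exists (ap h a).
Qed.

Lemma evaluation_flip i i' t : V t -> subset t (prod k P) ->
  al k (meas i') (fun a => exists p, p ∈ G /\ op a p ∈ t) <->
  al k (meas i) (fun a => exists p, p ∈ flip i' a /\ op a p ∈ t).
Proof.
move=> Vt tP.
have h1 := cls_evaluation i' (const_fun k G) tP; have h2 := cls_evaluation i (fn_fun k (dflip i')) tP.
have e1 : al k (meas i') (fun a => exists p, p ∈ G /\ op a p ∈ t) <->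
   al k (meas i') (fun a => exists p, p ∈ ap (const k G) a /\ op a p ∈ t).
  by apply: al_iff => a ak; rewrite ap_const.
have e2 : al k (meas i) (fun a => exists p, p ∈ flip i' a /\ op a p ∈ t) <->
   al k (meas i) (fun a => exists p, p ∈ ap (fn k (flip i')) a /\ op a p ∈ t).
  by apply: al_iff => a ak; rewrite ap_fn.
rewrite e1 e2 h1 h2 cls_flip (cst_indep i i' Vt).
by rewrite -/(cst G) -H_cst.
Qed.

(** ** The two measures are distinct *)

Lemma inaccessible_univ_V a : inaccessible univ a -> inaccessible V a.
Proof.
move=> [h1 [h2 h3]]; split=> //; split; first by move=> b f bl _; exact: h2.
by move=> b bl [f [_ hf]]; apply: (h3 b bl); exists f.
Qed.

(** By density [G] has a value at every inaccessible coordinate, and almost all [a] are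
    inaccessible. If the other bit occurred almost everywhere, a choice of witnessing conditions
    would represent a member of [H i] with the wrong value at [κ]. *)
Lemma al_generic_bit i : al k (meas i) (fun a => exists p, p ∈ G /\ app p a (bit i)).
Proof.
have uf := nm_uf (hmeas i); have limk := nm_limit (hmeas i).
have GP p : p ∈ G -> p ∈ P by move=> pG; exact: (generic_sub hG pG).
have h1 : al k (meas i) (fun a => exists p y, p ∈ G /\ app p a y).
  apply: (al_mono uf _ _ (nm_inaccessible (hmeas i))); first by dfn_tac.
  move=> a ak ia; apply: generic_domain => //; exact: inaccessible_univ_V.
have db (j : bool) : dfn (fun e => exists p, p ∈ G /\ app p (e 0) (bit j)) by dfn_tac.
have h2 : al k (meas i) (fun a => (exists p, p ∈ G /\ app p a (bit i)) \/
    exists p, p ∈ G /\ app p a (bit (negb i))).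
  apply: (al_mono uf _ _ h1); first by dfn_tac.
  move=> a ak [p [y [pG ay]]]; have [_ [_ [b eb]]] := cond_app (GP _ pG) ay.
  rewrite eb in ay; have : b = i \/ b = negb i by case: (b); case: (i); auto.
  by case=> e; [left|right]; exists p; rewrite -e.
case: (al_or uf (db i) (db (negb i)) h2) => // h3.
have [||h [hf hh]] := @al_choice _ k (meas i) uf (fun a p => p ∈ G /\ app p a (bit (negb i))) G.
- by dfn_tac.
- by apply: (al_mono uf _ _ h3); [dfn_tac|move=> a ak [p [pG ap']]; exists p].
have hH1 : cl i h ∈ H i.
  rewrite (H_cst i); apply/(cls_const_mem (hmeas i)) => //.
  by apply: (al_mono uf _ _ hh); [dfn_tac|move=> a ak []].
have ha : app (cl i h) k (bit (negb i)).
  have <- : cl i (const k (bit (negb i))) = bit (negb i) by exact: fixed_bit.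
  apply/cls_app_critE => //; first exact: const_fun.
  by apply: (al_mono uf _ _ hh); [dfn_tac|move=> a ak []; rewrite ap_const].
have [_ [_ [/(_ _ ha)]]] := proj1 (hH i _) hH1.
by rewrite is_bit_bit => /bit_inj; case: (i).
Qed.

Lemma meas_distinct : ~ forall X, subset X k -> (X ∈ meas false <-> X ∈ meas true).
Proof.
move=> h; have GP p : p ∈ G -> p ∈ P by move=> pG; exact: (generic_sub hG pG).
have db (j : bool) : dfn (fun e => exists p, p ∈ G /\ app p (e 0) (bit j)) by dfn_tac.
have h0 : al k (meas true) (fun a => exists p, p ∈ G /\ app p a (bit false)).
  apply/(al_sep _ _ (db false)); apply/h; first by move=> z /(sepP (db false)) [].
  by apply/(al_sep _ _ (db false)); exact: al_generic_bit.
apply: (al_contra (nm_uf (hmeas true)) (al_and (nm_uf (hmeas true)) h0 (al_generic_bit true))).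
move=> a ak [[p [pG ap0]] [q [qG aq]]].
have [r [rG [pr qr]]] := generic_dir hG pG qG.
move: ap0 aq; rewrite !app_op => /pr h1 /qr h2.
have : bit false = bit true :> N by apply: (cond_fun (GP _ rG)); apply/app_op; [exact: h1|exact: h2].
by move/bit_inj.
Qed.

(** ** Conditions are not moved *)

(** At an inaccessible [a] the Easton requirement bounds the domain of [ap h a] below [a], and
    normality makes the bound constant. With a fixed bound, fewer than [k] membership questions
    determine the condition, and each is decided for almost all [a]. *)
Lemma cond_regress i h : is_fun h k ->
  al k (meas i) (fun a => ap h a ∈ P /\ forall x y, app (ap h a) x y -> x ∈ a) ->
  exists p, al k (meas i) (fun a => ap h a = p).
Proof.
move=> hf hh; have uf := nm_uf (hmeas i).
have [||c [ck hc]] := @nm_regress _ _ _ (hmeas i) (fun c a => ap h a ∈ P /\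
  forall x y, app (ap h a) x y -> x ∈ c).
- by dfn_tac.
- apply: (al_mono2 uf _ hh (nm_inaccessible (hmeas i))); first by dfn_tac.
  move=> a ak [haP hd] ia.
  have [|c [ca hc]] := cond_bounded (l := a) haP.
    by left; split=> //; exact: inaccessible_univ_V.
  by exists c; split=> //; split=> // x y xy; apply: (hc x y xy); exact: (hd x y).
have dz (z : nat -> N) : dfn (fun e => al k (meas i) (fun a => e 0 ∈ ap h a)) by dfn_tac.
pose (L := sep (prod c (up emp (sg emp))) (fun z => al k (meas i) (fun a => z ∈ ap h a))).
have key z : al k (meas i) (fun a => z ∈ ap h a <-> al k (meas i) (fun a => z ∈ ap h a)).
  have d1 : dfn (fun e => z ∈ ap h (e 0)) by dfn_tac.
  have d2 : dfn (fun e => z ∈ ap h (e 0) <-> al k (meas i) (fun a => z ∈ ap h a)) by dfn_tac.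
  case: (classic (al k (meas i) (fun a => z ∈ ap h a))) => hz.
    by apply: (al_mono uf d2 _ hz) => a ak ?; split.
  by move/(al_not uf d1): (hz); apply: (al_mono uf d2) => a ak ?; split.
have key2 (b : bool) : al k (meas i) (fun a => forall x, x ∈ c ->
    (op x (bit b) ∈ ap h a <-> al k (meas i) (fun a => op x (bit b) ∈ ap h a))).
  apply: (nm_comp (hmeas i) (Q := fun x a => op x (bit b) ∈ ap h a <->
    al k (meas i) (fun a => op x (bit b) ∈ ap h a))) => //; by dfn_tac.
exists L; apply: (al_mono2 uf _ hc (al_and uf (key2 false) (key2 true))); first by dfn_tac.
move=> a ak [haP hd] [k0 k1].
have bits (b : bool) : bit b ∈ up emp (sg emp) :> Prop by apply/upP; case: b; auto.
apply: set_ext => z; rewrite (sepP (dz (fun _ => z))); split.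
  move=> /[dup] hz /(cond_pair haP) [x [y e]]; subst z.
  move/app_op: (hz) => axy; have xc := hd x y axy; have [_ [_ [b eb]]] := cond_app haP axy; subst y.
  split; first by rewrite op_prod.
  by case: b hz {axy} => hz; [apply/(k1 x xc)|apply/(k0 x xc)].
move=> [/prodP [x [y [xc [/upP yb ->]]]] hz].
case: yb hz => -> hz; [exact/(k0 x xc)|exact/(k1 x xc)].
Qed.

(** The domain of [p] is bounded in [k], so completeness leaves no new elements in [j(p)]; the old
    ones are pairs of an ordinal below [k] and a bit, which are fixed. *)
Lemma cond_fixed i p : p ∈ P -> fixed k (meas i) p.
Proof.
move=> pP; have uf := nm_uf (hmeas i); apply: (small_fixed (hmeas i)).
  move=> h hf hh; have [|c [ck hc]] := cond_bounded (l := k) pP; first by right.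
  have [||x [xc hx]] := @nm_regress_c _ _ _ (hmeas i) (fun x a => exists y, op x y ∈ p /\ ap h a = op x y) c _ ck.
  - by dfn_tac.
  - apply: (al_mono uf _ _ hh); first by dfn_tac.
    move=> a ak /[dup] hp /(cond_pair pP) [x [y e]]; rewrite e in hp.
    have axy : app p x y by apply/app_op.
    exists x; split; last by exists y.
    by have [xk _] := cond_app pP axy; exact: (hc x y).
  have [a [ak [y [yp _]]]] := al_ex uf hx.
  exists (op x y); split=> //; apply: (al_mono uf _ _ hx); first by dfn_tac.
  move=> a' _ [y' [y'p ->]]; congr op; apply: (cond_fun pP); apply/app_op; [exact: y'p|exact: yp].
move=> z /[dup] zp /(cond_pair pP) [x [y e]]; subst z.
have axy : app p x y by apply/app_op.
have [xk [_ [b ->]]] := cond_app pP axy.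
apply: (fixed_op (hmeas i)); [exact: (fixed_ord (hmeas i))|exact: fixed_bit].
Qed.

Lemma pair_fixed i z : z ∈ prod k P -> fixed k (meas i) z.
Proof.
move/prodP => [x [p [xk [pP ->]]]].
apply: (fixed_op (hmeas i)); [exact: (fixed_ord (hmeas i))|exact: cond_fixed].
Qed.

(** ** Limits of sequences of sets of pairs *)

Definition names : N := setof (fun c => V c /\ subset c (prod k P)).

Lemma namesP : (forall c, c ∈ names <-> V c /\ subset c (prod k P)) /\ V names.
Proof.
have [k' ek] := emb_lift hV V_k; have [P' eP] := emb_lift hV VP.
have e : is_setof (v (pw (prod k' P'))) (fun c => V c /\ subset c (prod k P)).
  move=> c; split.
    move/(emb_lift_mem hVt) => [c' [<- /pwP h]]; split; first exact: emb_V.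
    move=> z /(emb_lift_mem hVt) [z' [<- /h /prodP [x [p [xk [pP ->]]]]]].
    by rewrite (emb_op hVt) op_prod -ek -eP.
  move=> [Vc h]; have [c' ec] := emb_lift hV Vc; subst c.
  have hc : c' ∈ pw (prod k' P'); last by exact: hc.
  apply/pwP => z zc; have /prodP [x0 [p0 [xk [pP e]]]] : v z ∈ prod k P by apply: h.
  rewrite -ek in xk; rewrite -eP in pP.
  have [x [ex xk']] := emb_lift_mem hVt xk; have [p [ep pP']] := emb_lift_mem hVt pP.
  have -> : z = op x p by apply: emb_inj; rewrite (emb_op hVt) ex ep.
  by rewrite op_prod.
have e' : v (pw (prod k' P')) = names by exact: is_setof_setof.
by rewrite -e'; split; [exact: e|exact: emb_V].
Qed.

Definition limit_name i f := sep (prod k P) (fun z => al k (meas i) (fun b => z ∈ ap f b)).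

Lemma limit_nameP i f z :
  z ∈ limit_name i f <-> z ∈ prod k P /\ al k (meas i) (fun b => z ∈ ap f b).
Proof. by rewrite sepP //; dfn_tac. Qed.

(** The class of [f] belongs to [j(names)], hence to [V]; its trace on [κ × P]
    is the limit since [j] fixes the elements of [κ × P]. *)
Lemma limit_name_V i f : is_fun f k -> al k (meas i) (fun b => ap f b ∈ names) ->
  V (limit_name i f).
Proof.
move=> ff hfn; have [_ Vn] := namesP; have uf := nm_uf (hmeas i).
have Vf : V (cl i f).
  by apply: (hVt (V_cst i Vn)); apply/(cls_const_mem (hmeas i)).
have [k' ek] := emb_lift hV V_k; have [P' eP] := emb_lift hV VP; have [y ey] := emb_lift hV Vf.
have dm : dfn (fun e : nat -> M => e 0 ∈ y) by dfn_tac.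
have <- : v (sep (prod k' P') (fun z : M => z ∈ y)) = limit_name i f; last exact: emb_V.
have memE z : z ∈ prod k P -> z ∈ cl i f <-> al k (meas i) (fun b => z ∈ ap f b).
  move=> zk; rewrite -{1}(pair_fixed i zk) (cls_mem (hmeas i)) //; last exact: const_fun.
  by apply: al_iff => b bk; rewrite ap_const.
apply: set_ext => z; rewrite limit_nameP; split.
  move/(emb_lift_mem hVt) => [z' [<- /(sepP dm) [/prodP [x [p [xk [pP ->]]]] zy]]].
  have h : v (op x p) ∈ prod k P by rewrite (emb_op hVt) op_prod -ek -eP.
  split=> //; apply/memE => //; rewrite -ey; exact: zy.
move=> [zk /(memE z zk)]; rewrite -ey => /(emb_lift_mem hVt) [z' [ez zy]]; subst z.
have h : z' ∈ sep (prod k' P') (fun z : M => z ∈ y); last by exact: h.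
apply/(sepP dm); split=> //; move/prodP: zk => [x0 [p0 [xk [pP e]]]].
rewrite -ek in xk; rewrite -eP in pP.
have [x [ex xk']] := emb_lift_mem hVt xk; have [p [ep pP']] := emb_lift_mem hVt pP.
have -> : z' = op x p by apply: emb_inj; rewrite (emb_op hVt) ex ep.
by rewrite op_prod.
Qed.

Definition below b p := forall x y, app p x y -> x ∈ b.

Lemma dfn_below (b p : (nat -> N) -> N) : dtm b -> dtm p -> dfn (fun e => below (b e) (p e)).
Proof. by apply: (dfn_rel2 (R := below)); rewrite /below; dfn_tac. Qed.

(** For a fixed pair this is the definition of the limit, and normality takes care of [x]. A
    condition witnessing failure at [b] has its domain inside [b], so [cond_regress] makes it
    constant and reduces to a fixed pair. *)
Lemma limit_name_trace i f : is_fun f k ->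
  al k (meas i) (fun b => forall x, x ∈ b -> forall p, p ∈ P -> below b p ->
    (op x p ∈ ap f b <-> op x p ∈ limit_name i f)).
Proof.
move=> ff; have uf := nm_uf (hmeas i).
apply: (nm_normal (hmeas i) (Q := fun x b => forall p, p ∈ P -> below b p ->
    (op x p ∈ ap f b <-> op x p ∈ limit_name i f))); first by rewrite /below; dfn_tac.
move=> x xk; apply: NNPP => no.
have dq : dfn (fun e => forall p, p ∈ P -> below (e 0) p ->
    (op x p ∈ ap f (e 0) <-> op x p ∈ limit_name i f)) by rewrite /below; dfn_tac.
move/(al_not uf dq): no => no.
have [||h [hf hh]] := @al_choice _ k (meas i) uf (fun b p => p ∈ P /\ below b p /\
    ~ (op x p ∈ ap f b <-> op x p ∈ limit_name i f)) P.
- by rewrite /below; dfn_tac.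
- apply: (al_mono uf _ _ no); first by rewrite /below; dfn_tac.
  move=> b bk hb; apply: NNPP => hn; apply: hb => p pP bp; apply: NNPP => hp; apply: hn.
  by exists p.
have [|p hp] := @cond_regress i h hf.
  by apply: (al_mono uf _ _ hh); [dfn_tac|move=> b bk [h1 [h2 _]]].
have [_ [_ [pP _]]] : exists b, b ∈ k /\ p ∈ P /\ True.
  have [b [bk [[h1 _] e]]] := al_ex uf (al_and uf hh hp); exists b; do 2 split=> //.
  by rewrite -e.
have hz : al k (meas i) (fun b => op x p ∈ ap f b <-> op x p ∈ limit_name i f).
  have zk : op x p ∈ prod k P by rewrite op_prod.
  have d1 : dfn (fun e => op x p ∈ ap f (e 0)) by dfn_tac.
  have d2 : dfn (fun e => op x p ∈ ap f (e 0) <-> op x p ∈ limit_name i f) by dfn_tac.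
  case: (classic (al k (meas i) (fun b => op x p ∈ ap f b))) => hz.
    apply: (al_mono uf d2 _ hz) => b _ ?; rewrite limit_nameP; tauto.
  move/(al_not uf d1): (hz); apply: (al_mono uf d2) => b _ ?; rewrite limit_nameP; tauto.
apply: (al_contra uf (al_and uf hh (al_and uf hp hz))) => b bk [[_ [_ h1]] [e h2]].
by apply: h1; rewrite e.
Qed.

(** ** The Lipschitz reduction *)

Hypothesis hVG : forall x, extension V G x.

(** The part of the evaluation of the name [c] by [G] that is decided below [b]. *)
Definition trace c b := sep b (fun x => exists p, p ∈ G /\ below b p /\ op x p ∈ c).

Lemma traceP c b x : x ∈ trace c b <-> x ∈ b /\ exists p, p ∈ G /\ below b p /\ op x p ∈ c.
Proof. by rewrite sepP //; rewrite /below; dfn_tac. Qed.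

Lemma dtm_trace (c b : (nat -> N) -> N) : dtm c -> dtm b -> dtm (fun e => trace (c e) (b e)).
Proof. by apply: (dtm_fun2 (F := trace)); rewrite /trace /below; dfn_tac. Qed.

Definition cap X b := sep X (fun z => z ∈ b).

Lemma capP X b z : z ∈ cap X b <-> z ∈ X /\ z ∈ b.
Proof. by rewrite sepP //; dfn_tac. Qed.

Lemma dtm_cap (c b : (nat -> N) -> N) : dtm c -> dtm b -> dtm (fun e => cap (c e) (b e)).
Proof. by apply: (dtm_fun2 (F := cap)); rewrite /cap; dfn_tac. Qed.

Lemma G_P p : p ∈ G -> p ∈ P.
Proof. exact: (generic_sub hG). Qed.

Lemma below_bound p : p ∈ P -> exists c, c ∈ k /\ forall b, b ∈ k -> c ∈ b -> below b p.
Proof.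
move=> pP; have [|c [ck hc]] := cond_bounded (l := k) pP; first by right.
have ok := nm_ord (hmeas true).
exists c; split=> // b bk cb x y a; have [xk _] := cond_app pP a.
exact: (ord_trans (ord_mem ok bk) (hc x y a xk)).
Qed.

Lemma al_below i p : p ∈ P -> al k (meas i) (fun b => below b p).
Proof.
move=> pP; have [c [ck hc]] := below_bound pP.
apply: (al_mono (nm_uf (hmeas i)) _ _ (nm_tail (hmeas i) ck)); first by rewrite /below; dfn_tac.
by move=> b bk; exact: hc.
Qed.

(** A nice name of [X] works: the condition witnessing a given [x] in [X] has domain inside [b] for
    almost all [b], and normality collects this over the [x] below [b]. *)
Lemma al_trace i X : subset X k -> exists c, c ∈ names /\
  al k (meas i) (fun b => cap X b = trace c b).
Proof.
move=> Xk; have uf := nm_uf (hmeas i).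
have [tau [Vtau /val_name_value eX]] := hVG X.
have [t [Vt [tP ht]]] := nice_name hVt hV VP V_k (nm_ord (hmeas true)) hG Vtau.
exists t; split; first by have [n _] := namesP; apply/n.
have h : al k (meas i) (fun b => forall x, x ∈ b -> x ∈ X ->
    exists p, p ∈ G /\ below b p /\ op x p ∈ t).
  apply: (nm_normal (hmeas i) (Q := fun x b => x ∈ X ->
    exists p, p ∈ G /\ below b p /\ op x p ∈ t)); first by rewrite /below; dfn_tac.
  move=> x xk; case: (classic (x ∈ X)) => [xX|nX]; last first.
    by apply: (al_all uf); [rewrite /below; dfn_tac|].
  rewrite eX in xX; have [p [pG pt]] := proj1 (ht x xk) xX.
  apply: (al_mono uf _ _ (al_below i (G_P pG))); first by rewrite /below; dfn_tac.
  by move=> b bk hb _; exists p.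
apply: (al_mono uf _ _ h); first by apply: dfn_eq; [apply: dtm_cap|apply: dtm_trace]; dfn_tac.
move=> b bk hb; apply: set_ext => x; rewrite capP traceP; split.
  by move=> [xX xb]; split=> //; exact: hb.
move=> [xb [p [pG [_ pt]]]]; split=> //; rewrite eX; apply/ht; last by exists p.
by have /op_prod [] := tP _ pt.
Qed.

(** For a fixed [x], a single [b] above [x] at which [ap f b] and the limit agree settles each
    direction. *)
Lemma evaluation_limit i f X : is_fun f k -> subset X k ->
  al k (meas i) (fun b => cap X b = trace (ap f b) b) ->
  forall x, x ∈ k -> (x ∈ X <-> exists p, p ∈ G /\ op x p ∈ limit_name i f).
Proof.
move=> ff Xk hX x xk; have uf := nm_uf (hmeas i).
have htr := limit_name_trace i ff.
have all := al_and uf hX (al_and uf htr (nm_tail (hmeas i) xk)).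
split.
  move=> xX; have [b [bk [e [h1 xb]]]] := al_ex uf all.
  have : x ∈ trace (ap f b) b by rewrite -e capP.
  move/traceP => [_ [p [pG [bp h]]]]; exists p; split=> //; apply/(h1 x xb) => //; exact: G_P.
move=> [p [pG hp]].
have [b [bk [[e [h1 xb]] bp]]] := al_ex uf (al_and uf all (al_below i (G_P pG))).
have : x ∈ cap X b by rewrite e; apply/traceP; split=> //; exists p; do 2 split=> //; apply/(h1 x xb) => //; exact: G_P.
by move/capP => [].
Qed.

(** This is why [limit_name_trace] compares the names on all conditions with domain inside [b]: the
    flipped filter contains conditions that are not in [G]. *)
Lemma al_flip_limit i f a (j : bool) : is_fun f k -> a ∈ k ->
  al k (meas i) (fun b => exists p, p ∈ flip j a /\ below b p /\ op a p ∈ ap f b) <->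
  exists p, p ∈ flip j a /\ op a p ∈ limit_name i f.
Proof.
move=> ff ak; have uf := nm_uf (hmeas i).
have htr := limit_name_trace i ff; have tl := nm_tail (hmeas i) ak.
split.
  move=> h; have [b [bk [[p [pf [bp hp]]] [h1 ab]]]] := al_ex uf (al_and uf h (al_and uf htr tl)).
  by exists p; split=> //; apply/(h1 a ab) => //; case/flipP: pf.
move=> [p [pf hp]]; have pP : p ∈ P by case/flipP: pf.
apply: (al_mono2 uf _ (al_below i pP) (al_and uf htr tl)).
  by rewrite /below; repeat first [apply: dtm_flip | dfn_unfold; dfn_step].
by move=> b bk bp [h1 ab]; exists p; do 2 split=> //; apply/(h1 a ab).
Qed.

Variable PL : N -> N -> N.
Hypothesis hPL : is_plus k PL.

Variable W : N.
Hypothesis hW : forall X, X ∈ W <-> subset X k /\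
  al k (meas true) (fun a => al k (meas true) (fun b => PL b a ∈ X)).

Lemma lipschitz_reduction : lipschitz k (meas false) W.
Proof.
have ok := nm_ord (hmeas true); have uf1 := nm_uf (hmeas true).
have [namesE Vn] := namesP.
have d1 : dfn (fun e => (exists c, c ∈ names /\ snd (e 0) = trace c (fst (e 0))) ->
   snd (e 0) = trace (e 1) (fst (e 0))).
  by repeat first [apply: dtm_trace | dfn_step].
(* Names are chosen once for all pairs of a [b] and a set, so that the name used at [b] depends on
   [X] only through [X ∩ b]. If the set is no trace, an arbitrary name is taken. *)
have [|T [Tf hT]] := @choice_fn _ (fun e c => (exists c, c ∈ names /\ snd e = trace c (fst e)) ->
   snd e = trace c (fst e)) (prod k (pw k)) names d1.
  move=> e _; case: (classic (exists c, c ∈ names /\ snd e = trace c (fst e))).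
    by move=> [c [cn ec]]; exists c.
  move=> no; have [|c [cn _]] := @al_trace true emp; last by exists c.
  by move=> z /empP.
pose (phi := fun X a b => exists p, p ∈ flip false a /\ below b p /\ op a p ∈ ap T (op b (cap X b))).
(* Requiring [b] to be additively closed makes the decomposition of [x] unique, and almost all [b]
   qualify. *)
pose (R := fun X x => exists b a, b ∈ k /\ a ∈ b /\ additively_closed PL b /\ x = PL b a /\ phi X a b).
have dphi (X a b : (nat -> N) -> N) : dtm X -> dtm a -> dtm b -> dfn (fun e => phi (X e) (a e) (b e)).
  move=> hX ha hb.
  have dX := dtm_subvar S hX; have da := dtm_subvar S ha; have db := dtm_subvar S hb.
  apply: dfn_ex; apply: dfn_and; first by apply: dfn_mem; [exact: dtm_var|exact: dtm_flip].
  apply: dfn_and; first by apply: dfn_below => //; exact: dtm_var.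
  apply: dfn_mem; first by apply: dtm_op => //; exact: dtm_var.
  apply: dtm_ap; first exact: dtm_const.
  by apply: dtm_op => //; exact: dtm_cap.
have dR : dfn (fun e => R (e 1) (e 0)).
  rewrite /R; repeat first [apply: dphi | apply: (dfn_additively_closed hPL) | apply: (dtm_plus hPL) | dfn_step].
have dR1 X : dfn (fun e => R X (e 0)).
  exact: (dfn_fix (Q := fun e x => R (e 0) x) (fun _ => X) dR).
have df : dtm (fun e => sep k (R (e 0))).
  by apply: dtm_sep; [exact: dtm_const|exact: dR].
pose (f := fn (pw k) (fun X => sep k (R X))).
have fP X B : app f X B <-> subset X k /\ B = sep k (R X).
  by rewrite /f (fn_app df) pwP.
exists f; split.
  split.
    exists (pw k); split; first by move=> A; exact: pwP.
    split; first exact: fn_fun.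
    by move=> X B /fP [_ ->] z /(sepP (dR1 X)) [].
  move=> x A A' B B' xk Ak hA' /fP [_ ->] /fP [_ ->] z zx.
  rewrite !(sepP (dR1 _)).
  (* Points of [b] lie below [b + a], hence below [x] even when [b + a] is [x] itself, and there the
     two sets agree. *)
  have e b a : b ∈ k -> a ∈ b -> z = PL b a -> cap A b = cap A' b.
    move=> bk ab ez; apply: set_ext => y; rewrite !capP (hA' y); split; last by tauto.
    move=> [yA yb]; split=> //; split=> //.
    have yz : y ∈ z by rewrite ez; apply/(plusP hPL bk (ord_trans ok ab bk)); left.
    case: zx => [zx|<-] //; exact: (ord_trans (ord_mem ok xk) yz zx).
  split=> -[zk [b [a [bk [ab [cb [ez h]]]]]]]; split=> //; exists b, a; do 4 split=> //;
    by move: h; rewrite /phi (e b a).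
move=> X B Xk /fP [_ ->].
have [c0 [c0n hc0]] := al_trace true Xk.
have dF : dtm (fun e => ap T (op (e 0) (cap X (e 0)))).
  by repeat first [apply: dtm_cap | dfn_step].
pose (F := fn k (fun b => ap T (op b (cap X b)))).
have Ff : is_fun F k by exact: fn_fun.
have arg b : b ∈ k -> op b (cap X b) ∈ prod k (pw k).
  by move=> bk; rewrite op_prod pwP; split=> // z /capP [/Xk].
have Fn : al k (meas true) (fun b => ap F b ∈ names).
  apply: (al_all uf1); first by dfn_tac.
  by move=> b bk; rewrite ap_fn //; have [] := hT _ (arg b bk).
have Ftr : al k (meas true) (fun b => cap X b = trace (ap F b) b).
  apply: (al_mono uf1 _ _ hc0); first by repeat first [apply: dtm_trace | apply: dtm_cap | dfn_step].
  move=> b bk e; rewrite ap_fn //; have [_] := hT _ (arg b bk); rewrite fst_op snd_op; apply.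
  by exists c0.
have limV := limit_name_V Ff Fn.
have limP : subset (limit_name true F) (prod k P) by move=> z /limit_nameP [].
have h1 : X ∈ meas false <-> al k (meas false) (fun a => exists p, p ∈ G /\ op a p ∈ limit_name true F).
  have dX : dfn (fun e => e 0 ∈ X) by dfn_tac.
  have -> : X ∈ meas false <-> al k (meas false) (fun a => a ∈ X).
    rewrite al_sep //; have -> // : sep k (fun a => a ∈ X) = X.
    apply: set_ext => z; rewrite (sepP dX); split; [tauto|by move=> zX; split=> //; exact: Xk].
  apply: al_iff => a ak; exact: (evaluation_limit Ff Xk Ftr ak).
(* The measure changes from [U_0] to [U_1] at the cost of changing [G] at [a]; for this the limit
   name has to be in [V]. *)
rewrite h1 (evaluation_flip true false limV limP).
have h2 : al k (meas true) (fun a => exists p, p ∈ flip false a /\ op a p ∈ limit_name true F) <->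
    al k (meas true) (fun a => al k (meas true) (fun b => phi X a b)).
  apply: al_iff => a ak; rewrite -(al_flip_limit true false Ff ak).
  by apply: al_iff => b bk; rewrite /phi ap_fn.
rewrite h2 hW.
have sub : subset (sep k (R X)) k by move=> z /(sepP (dR1 X)) [].
have h3 : al k (meas true) (fun a => al k (meas true) (fun b => phi X a b)) <->
    al k (meas true) (fun a => al k (meas true) (fun b => PL b a ∈ sep k (R X))).
  apply: al_iff => a ak.
  have good := al_and uf1 (nm_tail (hmeas true) ak) (al_additively_closed (hmeas true) hPL).
  split=> h; apply: (al_mono2 uf1 _ h good).
  - by repeat first [apply: (dtm_plus hPL) | dfn_step].
  - move=> b bk hphi [ab cb]; apply/(sepP (dR1 X)); split; first exact: (plus_closed (hmeas true) hPL).
    by exists b, a.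
  - by repeat first [apply: dphi | dfn_step].
  - move=> b bk /(sepP (dR1 X)) [_ [b' [a' [b'k [ab' [cb' [e hphi]]]]]]] [ab cb].
    have [eb ea] := plus_decomp (hmeas true) hPL bk b'k cb cb' ab ab' e.
    by subst b' a'.
rewrite h3; tauto.
Qed.

(** ** Ketonen incomparability *)

Lemma not_ketonen_above : ~ ketonen k W (meas false).
Proof.
move=> [J [S [JU [Sf [_ hWU]]]]]; have [f [[[Pk [hPk [ff fk]]] lf] hf]] := lipschitz_reduction.
have Jk : subset J k by have [_ [h _]] := nm_uf (hmeas false); exact: h.
pose (K := fun X x => x ∈ J /\ exists D, app S x D /\ large D (fun z => z ∈ X /\ z ∈ x)).
have dK (X x : (nat -> N) -> N) : dtm X -> dtm x -> dfn (fun e => K (X e) (x e)).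
  by apply: (dfn_rel2 (R := K)); rewrite /K; dfn_tac.
apply: (@no_self_reduction _ k (meas false) (fun X x => K (ap f X) x)).
- exact: nm_ord (hmeas false).
- exact: nm_uf (hmeas false).
- by apply: dK; dfn_tac.
- move=> X x Xk xk; have ck : subset (cap X x) k by move=> z /capP [/Xk].
  have a1 : app f X (ap f X) by apply: (app_ap ff); apply/hPk.
  have a2 : app f (cap X x) (ap f (cap X x)) by apply: (app_ap ff); apply/hPk.
  (* The part of [X] below [x] determines [ap f X] below [x], and [K] looks only there. *)
  have e : forall z, z ∈ x -> (z ∈ ap f X <-> z ∈ ap f (cap X x)).
    move=> z zx; apply: (lf x X (cap X x)) => //; last by left.
    by move=> t; exact: capP.
  rewrite /K -/(cap X x); split=> -[xJ [D [SD [A [AD hA]]]]]; split=> //; exists D; split=> //; exists A; split=> // z;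
    rewrite (hA z); split=> -[h1 zx]; split=> //; exact/(e z zx).
- move=> X Xk; have a1 : app f X (ap f X) by apply: (app_ap ff); apply/hPk.
  rewrite (hf X _ Xk a1) (hWU _ (fk _ _ a1)) /al.
  split=> -[A [AD hA]]; exists A; split=> // z; rewrite (hA z) /K;
    split; first [tauto | by move=> h; split; [apply: Jk; tauto|tauto]].
Qed.

Hypothesis hmeas_ult : forall i x,
  ult univ k (meas i) x <-> extension (ult V k U) (H i) x.

(** The class is [j(X) ∩ κ]: a function choosing elements of [X] below [b] is regressive, hence
    constant. *)
Lemma cls_cap i X : subset X k -> cl i (fn k (cap X)) = X.
Proof.
move=> Xk; have uf := nm_uf (hmeas i).
have dc : dtm (fun e => cap X (e 0)) by apply: dtm_cap; dfn_tac.
apply: set_ext => t; rewrite (clsP (hmeas i)); last exact: fn_fun.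
have e h : al k (meas i) (fun b => ap h b ∈ ap (fn k (cap X)) b) <->
    al k (meas i) (fun b => ap h b ∈ X /\ ap h b ∈ b).
  by apply: al_iff => b bk; rewrite ap_fn // capP.
split.
  move=> [h [hf [/e hh ->]]].
  have [||x [xk hx]] := @nm_regress _ _ _ (hmeas i) (fun x b => ap h b ∈ X /\ ap h b = x).
  - by dfn_tac.
  - by apply: (al_mono uf _ _ hh); [dfn_tac|move=> b bk [h1 h2]; exists (ap h b)].
  have -> : cls k (meas i) h = x.
    rewrite -(fixed_ord (hmeas i) xk); apply/(cls_eq (hmeas i)) => //; first exact: const_fun.
    by apply: (al_mono uf _ _ hx); [dfn_tac|move=> b bk [_ ->]; rewrite ap_const].
  by have [b [_ [h1 h2]]] := al_ex uf hx; rewrite -h2.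
move=> tX; have tk := Xk t tX; exists (const k t); split; first exact: const_fun.
split; last by rewrite (fixed_ord (hmeas i) tk).
apply/e; apply: (al_mono uf _ _ (nm_tail (hmeas i) tk)); first by dfn_tac.
by move=> b bk tb; rewrite ap_const.
Qed.

(** Names in [M_U] evaluated by [H_i'] are computed in the ultrapower by [U_i]. *)
Lemma cls_val i i' r g : is_fun g k -> cl i g = r ->
  val (H i') r = cl i (fn k (fun b => val (flip i' b) (ap g b))).
Proof.
have uf := nm_uf (hmeas i); move: r g.
pose (E := fun g => fn k (fun b => val (flip i' b) (ap g b))).
have dE g : dtm (fun e => val (flip i' (e 0)) (ap g (e 0))).
  by apply: dtm_val; [apply: dtm_flip|]; dfn_tac.
have dEt (t : (nat -> N) -> N) : dtm t -> dtm (fun e => E (t e)).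
  apply: (dtm_fun1 (F := E)); apply: dtm_fn; first exact: dtm_const.
  by apply: dtm_val; [apply: dtm_flip|]; dfn_tac.
have Ef g : is_fun (E g) k by exact: fn_fun.
have aE g b : b ∈ k -> ap (E g) b = val (flip i' b) (ap g b) by move=> bk; rewrite ap_fn.
have fl b : b ∈ k -> ap (fn k (flip i')) b = flip i' b.
  by move=> bk; rewrite ap_fn //; exact: dtm_flip (dtm_var 0).
have flf : is_fun (fn k (flip i')) k by apply: fn_fun; exact: dtm_flip (dtm_var 0).
have dfl (t : (nat -> N) -> N) : dtm t -> dtm (fun e => flip i' (t e)) by exact: dtm_flip.
apply: (@name_ind _ (fun r => forall g, is_fun g k -> cl i g = r -> val (H i') r = cl i (E g))).
  by repeat first [apply: dtm_cl | apply: dEt | dfn_unfold; dfn_step].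
move=> r IH g gf er; apply: set_ext => z; rewrite valP (clsP (hmeas i)) //; split.
  move=> [r' [p [pH [rp ->]]]].
  move: (rp); rewrite -er => /(clsP (hmeas i) _ gf) [q [qf [hq eq]]].
  have [g' [p' [g'f [p'f [eg ep]]]]] := cls_op_inv (hmeas i) qf (eq_sym eq).
  exists (E g'); split=> //; split; last by apply: (IH r' p rp).
  have h1 : al k (meas i) (fun b => ap p' b ∈ flip i' b).
    have : cl i p' ∈ cl i (fn k (flip i')) by rewrite cls_flip /cl -ep.
    move/(cls_mem (hmeas i) p'f flf); apply: (al_mono uf); first by apply: dfn_mem; [dfn_tac|apply: dfl; dfn_tac].
    by move=> b bk; rewrite fl.
  have h2 : al k (meas i) (fun b => op (ap g' b) (ap p' b) ∈ ap g b).
    move: rp; rewrite -er -app_op eg ep => /(cls_app (hmeas i) gf g'f p'f).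
    apply: (al_mono uf); first by dfn_tac.
    by move=> b bk; rewrite app_op.
  apply: (al_mono2 uf _ h1 h2); first by apply: dfn_mem; apply: dtm_ap; dfn_tac.
  by move=> b bk hp hg; rewrite !aE //; apply/valP; exists (ap g' b), (ap p' b).
move=> [h [hf [hh ->]]].
have B0 : al k (meas i) (fun b => exists q, q ∈ Un (Un (Un g)) /\ q ∈ ap g b /\
    snd q ∈ flip i' b /\ q = op (fst q) (snd q) /\ ap h b = val (flip i' b) (fst q)).
  apply: (al_mono uf _ _ hh).
    by repeat first [apply: dfl | dfn_step].
  move=> b bk; rewrite aE // => /valP [r' [p [pf [rp e]]]]; exists (op r' p).
  rewrite fst_op snd_op; split; last by [].
  by apply/UnP; exists (ap g b); split=> //; have /app_op/op_mem_Un [] := app_ap gf bk.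
have [|q [qf hq]] := al_choice uf (R := fun b q => q ∈ ap g b /\
    snd q ∈ flip i' b /\ q = op (fst q) (snd q) /\ ap h b = val (flip i' b) (fst q)) _ B0.
  by repeat first [apply: dfl | dfn_step].
pose (g' := fn k (fun b => fst (ap q b))); pose (p' := fn k (fun b => snd (ap q b))).
have d1 : dtm (fun e => fst (ap q (e 0))) by dfn_tac.
have d2 : dtm (fun e => snd (ap q (e 0))) by dfn_tac.
have g'f : is_fun g' k by exact: fn_fun.
have p'f : is_fun p' k by exact: fn_fun.
have a1 b : b ∈ k -> ap g' b = fst (ap q b) by move=> bk; rewrite ap_fn.
have a2 b : b ∈ k -> ap p' b = snd (ap q b) by move=> bk; rewrite ap_fn.
have rp : op (cl i g') (cl i p') ∈ r.
  rewrite -er -app_op; apply/(cls_app (hmeas i)) => //; apply: (al_mono uf _ _ hq); first by dfn_tac.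
  by move=> b bk [h1 [_ [h2 _]]]; rewrite a1 // a2 // app_op -h2.
exists (cl i g'), (cl i p'); split; last split=> //.
  rewrite -(cls_flip i i'); apply/(cls_mem (hmeas i)) => //; apply: (al_mono uf _ _ hq); first by dfn_tac.
  by move=> b bk [_ [h1 _]]; rewrite a2 // fl.
rewrite (IH _ _ rp g') //; apply/(cls_eq (hmeas i)) => //.
apply: (al_mono uf _ _ hq); first by apply: dfn_eq; apply: dtm_ap; dfn_tac.
by move=> b bk [_ [_ [_ ->]]]; rewrite aE // a1.
Qed.

(** [U_0] does not belong to the ultrapower by [U_1], since otherwise it would
    belong to the ultrapower by [U_0], which is the same class. *)
Lemma not_represented (Q : N -> N -> Prop) : dfn (fun e => Q (e 0) (e 1)) ->
  ~ forall X, subset X k -> (X ∈ meas false <-> al k (meas true) (fun b => Q (cap X b) b)).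
Proof.
move=> dQ hQ; have uf1 := nm_uf (hmeas true); have uf0 := nm_uf (hmeas false).
have dQv (t u : (nat -> N) -> N) : dtm t -> dtm u -> dfn (fun e => Q (t e) (u e)).
  exact: (dfn_rel2 (R := Q)).
have dD : dtm (fun e => sep (pw (e 0)) (fun Y => Q Y (e 0))).
  by repeat first [apply: dQv | dfn_step].
pose (D := fn k (fun b => sep (pw b) (fun Y => Q Y b))).
have Df : is_fun D k by exact: fn_fun.
have dQ1 b : dfn (fun e => Q (e 0) b) by apply: dQv; dfn_tac.
have dcap X : dtm (fun e => cap X (e 0)) by apply: dtm_cap; dfn_tac.
have aD b Y : b ∈ k -> Y ∈ ap D b <-> subset Y b /\ Q Y b.
  by move=> bk; rewrite ap_fn // (sepP (dQ1 b)) pwP.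
have eU : cl true D = meas false.
  have memE X : subset X k -> X ∈ cl true D <-> X ∈ meas false.
    move=> Xk; rewrite -{1}(cls_cap true Xk) (hQ X Xk) (cls_mem (hmeas true)) //; last exact: fn_fun.
    apply: al_iff => b bk; rewrite ap_fn // aD //; split; first by case.
    by move=> h; split=> // z /capP [].
  apply: set_ext => X; split=> hX; last first.
    by apply/memE => //; have [_ [h _]] := uf0; exact: h.
  have Xk : subset X k; last by apply/memE.
  move=> z zX; move: hX => /(clsP (hmeas true) _ Df) [h [hf [hh eX]]].
  move: zX; rewrite eX => /(clsP (hmeas true) _ hf) [l [lf [hl ->]]].
  have e1 := cls_mem (hmeas true) lf (idf_fun k); rewrite (cls_idf (hmeas true)) in e1; apply/e1.
  apply: (al_mono2 uf1 _ hh hl); first by rewrite /idf; dfn_tac.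
  by move=> b bk /(aD _ _ bk) [hb _] /hb; rewrite ap_idf.
have hult : ult univ k (meas true) (meas false).
  exists D; split=> //; split=> //; apply/(ult_value_E (hmeas true)) => //.
have [s [[f [Vf [ff hs]]] /val_name_value hval]] := proj1 (hmeas_ult true _) hult.
have es := ult_value_V false Vf ff hs.
(* The name [s] is evaluated by [H true], but inside the ultrapower by [U_0], where the flips to 1
   represent that filter. This exhibits [U_0] as the class of [E] modulo [U_0]. *)
have hv := cls_val true ff (eq_sym es).
set E := fn k _ in hv; rewrite -hval in hv.
have Ef : is_fun E k by apply: fn_fun; apply: dtm_val; [apply: dtm_flip|]; dfn_tac.
apply: (@no_self_reduction _ k (meas false) (fun X b => cap X b ∈ ap E b)).
- exact: nm_ord (hmeas false).
- exact: uf0.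
- by apply: dfn_mem; [apply: dtm_cap|]; dfn_tac.
- move=> X x Xk xk; have -> // : cap (sep X (fun z => z ∈ x)) x = cap X x.
  by apply: set_ext => z; rewrite -/(cap X x) !capP; tauto.
move=> X Xk; rewrite {1}hv -{1}(cls_cap false Xk) (cls_mem (hmeas false)) //; last exact: fn_fun.
by apply: al_iff => b bk; rewrite ap_fn.
Qed.

(** * No Ketonen reduction of [U_0] to [W] *)

Section KetonenBelow.

Variables (J S : N).
Hypothesis JW : J ∈ W.
Hypothesis SJ : is_fun S J.
Hypothesis hS : forall x D, app S x D ->
  exists d, is_ord d /\ ultrafilter univ d D /\ sigma_complete univ d D /\ x ∈ D.
Hypothesis hred : forall X, subset X k -> (X ∈ meas false <->
  large W (fun x => x ∈ J /\ exists D, app S x D /\ large D (fun z => z ∈ X /\ z ∈ x))).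

Let uf := nm_uf (hmeas true).
Let uf0 := nm_uf (hmeas false).
Let ok := nm_ord (hmeas true).

Notation "∀* i , Q" := (al k (meas true) (fun i => Q)) (at level 200, i name).

Definition large_at X x := x ∈ J /\
  exists D, app S x D /\ large D (fun z => z ∈ X /\ z ∈ x).

(** For fixed [a], the sets [X] that satisfy this for almost all [b] play the role of the
    ultrafilter of the [a]-th fiber. *)
Definition fiber X a b := large_at X (PL b a).

Lemma dfn_fiber (X a b : (nat -> N) -> N) : dtm X -> dtm a -> dtm b ->
  dfn (fun e => fiber (X e) (a e) (b e)).
Proof.
move=> hX ha hb; apply: (dfn_rel2 (R := large_at)) => //; last exact: (dtm_plus hPL).
by rewrite /large_at; dfn_tac.
Qed.

(** The ultrafilter attached to [b + a] may live on a larger ordinal [d]; as it concentrates on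
    [b + a], only the parts of the sets below that point count. *)
Lemma fiber_or X Y Z a b : fiber X a b ->
  (forall z, z ∈ PL b a -> z ∈ X -> z ∈ Y \/ z ∈ Z) -> fiber Y a b \/ fiber Z a b.
Proof.
move=> [xJ [D [SD hD]]] h; have [d [od [uD [_ xD]]]] := hS SD.
have xd : subset (PL b a) d by have [_ [h' _]] := uD; exact: h'.
have to_al (X0 : N) : large D (fun z => z ∈ X0 /\ z ∈ PL b a) <-> al d D (fun z => z ∈ X0 /\ z ∈ PL b a).
  split=> -[A [AD hA]]; exists A; split=> // z; rewrite (hA z);
    split; first [tauto | by move=> h0; split; [apply: xd; tauto|tauto]].
move/to_al: hD => hD.
case: (al_or uD (Q := fun z => z ∈ Y /\ z ∈ PL b a) (R := fun z => z ∈ Z /\ z ∈ PL b a)).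
- by dfn_tac.
- by dfn_tac.
- apply: (al_mono uD _ _ hD); first by dfn_tac.
  by move=> z zd [zX zP]; case: (h z zP zX); [left|right].
- by move=> /to_al h0; left; split=> //; exists D.
- by move=> /to_al h0; right; split=> //; exists D.
Qed.

Lemma fiber_ext X Y a b : (forall z, z ∈ PL b a -> z ∈ X -> z ∈ Y) -> fiber X a b -> fiber Y a b.
Proof. by move=> h hX; case: (fiber_or (Y := Y) (Z := Y) hX) => // z zP /(h z zP); auto. Qed.

Lemma fiber_disj X Y a b : fiber X a b -> fiber Y a b ->
  exists z, z ∈ PL b a /\ z ∈ X /\ z ∈ Y.
Proof.
move=> [xJ [D [SD [A [AD hA]]]]] [_ [D' [SD' [B [BD hB]]]]].
have eD : D' = D by rewrite -(ap_app SJ SD) (ap_app SJ SD').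
subst D'; have [d [od [[_ [_ [_ [ne [_ [int _]]]]]] _]]] := hS SD.
have [I0 [ID hI]] := int A B AD BD.
apply: NNPP => no; apply: (ne I0 ID) => z /hI [/hA [zX zP] /hB [zY _]].
by apply: no; exists z.
Qed.

Lemma J_sub : subset J k.
Proof. by move/hW: JW => []. Qed.

Lemma al_J : ∀* a, ∀* b, PL b a ∈ J.
Proof. by move/hW: JW => []. Qed.

Lemma redE X : subset X k -> X ∈ meas false <-> ∀* a, ∀* b, fiber X a b.
Proof.
move=> Xk; rewrite hred //.
pose (Q := fun x => x ∈ J /\ exists D, app S x D /\ large D (fun z => z ∈ X /\ z ∈ x)).
have dQ : dfn (fun e => Q (e 0)) by rewrite /Q; dfn_tac.
split.
  move=> [A [AW hA]]; have [_ h] := proj1 (hW A) AW.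
  apply: (al_mono uf _ _ h).
    by repeat first [apply: dfn_fiber | dfn_step].
  move=> a ak; apply: (al_mono uf); first by apply: dfn_fiber; dfn_tac.
  by move=> b bk /hA.
move=> h; exists (sep J Q); split; last by move=> z; rewrite (sepP dQ) /Q; tauto.
apply/hW; split; first by move=> z /(sepP dQ) [/J_sub].
have dp : dfn (fun e => ∀* b, PL b (e 0) ∈ sep J Q).
  by repeat first [apply: (dtm_plus hPL) | dfn_step].
apply: (al_mono uf dp _ h) => a ak ha; apply: (al_mono uf _ _ ha).
  by repeat first [apply: (dtm_plus hPL) | dfn_step].
by move=> b bk /[dup] hf [xJ _]; apply/(sepP dQ).
Qed.

Let dfib (X : N) a : dfn (fun e => fiber X a (e 0)).
Proof. by apply: dfn_fiber; dfn_tac. Qed.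

Let dE (X a : (nat -> N) -> N) : dtm X -> dtm a -> dfn (fun e => ∀* b, fiber (X e) (a e) b).
Proof.
move=> hX ha; apply: dfn_al; try exact: dtm_const.
apply: dfn_fiber; try exact: dtm_var; [exact: (dtm_subvar Datatypes.S hX)|exact: (dtm_subvar Datatypes.S ha)].
Qed.

(** Otherwise choose [Z_a ∈ U_0] outside the ultrafilter of the [a]-th fibers: the
    diagonal intersection of the [Z_a] is in [U_0] but in almost none of these
    ultrafilters. *)
Lemma unbounded_fibers : (∀* a, ~ ∀* b, fiber (succ a) a b) ->
  ∀* a, forall X, subset X k -> ((∀* b, fiber X a b) <-> X ∈ meas false).
Proof.
move=> hu; apply: NNPP => no.
have dq : dfn (fun e => forall X, subset X k -> ((∀* b, fiber X (e 0) b) <-> X ∈ meas false)).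
  by repeat first [apply: dE | dfn_unfold; dfn_step].
move/(al_not uf dq): no => no.
have hZ : ∀* a, exists Z, Z ∈ pw k /\ Z ∈ meas false /\ ~ ∀* b, fiber Z a b.
  apply: (al_mono2 uf _ no al_J); first by repeat first [apply: dE | dfn_unfold; dfn_step].
  move=> a ak hn hJ; apply: NNPP => hz; apply: hn => X Xk.
  have nz Z : Z ∈ meas false -> ∀* b, fiber Z a b.
    move=> ZU; apply: NNPP => h; apply: hz; exists Z; split=> //.
    by apply/pwP; have [_ [h' _]] := uf0; exact: h'.
  split; last exact: nz.
  move=> hX; have [_ [_ [_ [_ [_ [_ dec]]]]]] := uf0; case: (dec X I Xk) => // -[A [AU hA]].
  have [b [bk [h1 h2]]] := al_ex uf (al_and uf hX (nz A AU)).
  by have [z [_ [zX /hA [_]]]] := fiber_disj h1 h2.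
have [|h [hf hh]] := al_choice uf (R := fun a Z => Z ∈ meas false /\ ~ ∀* b, fiber Z a b) _ hZ.
  by repeat first [apply: dE | dfn_step].
pose (Z := sep k (fun x => forall a, a ∈ x -> ap h a ∈ meas false -> x ∈ ap h a)).
have dZ : dfn (fun e => forall a, a ∈ e 0 -> ap h a ∈ meas false -> e 0 ∈ ap h a) by dfn_tac.
have Zk : subset Z k by move=> z /(sepP dZ) [].
have ZU : Z ∈ meas false.
  apply/(al_sep _ _ dZ).
  apply: (nm_normal (hmeas false) (Q := fun a x => ap h a ∈ meas false -> x ∈ ap h a)); first by dfn_tac.
  move=> a ak; case: (classic (ap h a ∈ meas false)) => hU0; last first.
    by apply: (al_all uf0); [dfn_tac|].
  apply: (al_mono uf0 (Q := fun x => x ∈ ap h a)) => //; first by dfn_tac.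
  exists (ap h a); split=> // z; split; last by case.
  by move=> zh; split=> //; have [_ [h' _]] := uf0; exact: (h' _ hU0).
move/(redE Zk): ZU => hE.
apply: (al_contra uf (al_and uf hE (al_and uf hh hu))) => a ak [h1 [[hU0 h2] h3]].
(* An element of the diagonal intersection [Z] is at most [a] or lies in the [a]-th set.
   Unboundedness excludes the first case, the choice of that set the second. *)
case: (al_or uf (Q := fun b => fiber (succ a) a b) (R := fun b => fiber (ap h a) a b)) => //.
apply: (al_mono uf _ _ h1); first by apply: dfn_or.
move=> b bk hb; apply: (fiber_or hb) => z _ /(sepP dZ) [zk hz].
case: (ord_trich (ord_mem ok zk) (ord_mem ok ak)) => [za|[za|az]].
- by left; apply/succP; left.
- by left; apply/succP; right.
- by right; exact: hz.
Qed.

Lemma meas_false_neq :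
  ~ forall X, subset X k -> (X ∈ meas false <-> ∀* a, a ∈ X).
Proof.
move=> h; apply: meas_distinct => X Xk; rewrite (h X Xk).
have dX : dfn (fun e => e 0 ∈ X) by dfn_tac.
rewrite al_sep //; have -> // : sep k (fun a => a ∈ X) = X.
apply: set_ext => z; rewrite (sepP dX); split; [tauto|by move=> zX; split=> //; exact: Xk].
Qed.

(** The ultrafilter at [b + a] concentrates on the ordinal [a] or on its singleton. In the first
    case only [X ∩ a] matters, so [U_0] is represented in the ultrapower by [U_1]; in the second,
    [U_0] is the [U_1]-limit of principal ultrafilters at [a], which is [U_1]. *)
Lemma bounded_fibers : (∀* a, ∀* b, fiber (succ a) a b) -> False.
Proof.
move=> hb.
have h2 : (∀* a, (∀* b, fiber a a b) \/ ∀* b, fiber (sg a) a b).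
  apply: (al_mono uf _ _ hb); first by apply: dfn_or; apply: dE; dfn_tac.
  move=> a ak ha; apply: (al_or uf) => //.
  apply: (al_mono uf _ _ ha); first by apply: dfn_or.
  by move=> b bk hf; apply: (fiber_or hf) => z _ /succP [|->]; [left|right; apply/sgP].
case: (al_or uf _ _ h2) => [||h|h]; try by apply: dE; dfn_tac.
  apply: (@not_represented (fun Y a => ∀* b, fiber Y a b)); first by apply: dE; dfn_tac.
  move=> X Xk; rewrite redE //.
  have e : ∀* a, forall b, b ∈ k -> fiber a a b -> (fiber X a b <-> fiber (cap X a) a b).
    apply: (al_all uf).
      by repeat first [apply: dfn_fiber | apply: dtm_cap | dfn_step].
    move=> a ak b bk hf; split; last by apply: fiber_ext => z _ /capP [].
    move=> hX; case: (fiber_or (Y := cap X a) (Z := sep k (fun z => ~ z ∈ a)) hX) => //.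
      move=> z zP zX; case: (classic (z ∈ a)) => za; first by left; apply/capP.
      have dn : dfn (fun e => ~ e 0 ∈ a) by dfn_tac.
      by right; apply/(sepP dn); split=> //; exact: Xk.
    move=> hY; have dn : dfn (fun e => ~ e 0 ∈ a) by dfn_tac.
    by have [z [_ [za /(sepP dn) [_ []]]]] := fiber_disj hf hY.
  have dl : dfn (fun e => ∀* b, fiber X (e 0) b) by apply: dE; dfn_tac.
  have dr : dfn (fun e => ∀* b, fiber (cap X (e 0)) (e 0) b) by apply: dE; [apply: dtm_cap|]; dfn_tac.
  split=> hX; apply: (al_mono2 uf _ hX (al_and uf h e)) => // a ak h3 [h4 h5];
    by apply: (al_mono2 uf _ h3 h4) => // b bk h6 h7; apply/(h5 b bk h7).
apply: meas_false_neq => X Xk; rewrite redE //.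
have dl : dfn (fun e => ∀* b, fiber X (e 0) b) by apply: dE; dfn_tac.
split=> hX.
  apply: (al_mono2 uf _ hX h); first by dfn_tac.
  move=> a ak h3 h4; have [b [bk [h5 h6]]] := al_ex uf (al_and uf h3 h4).
  by have [z [_ [zX /sgP e]]] := fiber_disj h5 h6; rewrite -e.
apply: (al_mono2 uf dl hX h) => a ak aX; apply: (al_mono uf) => // b bk.
by apply: fiber_ext => z _ /sgP ->.
Qed.

(** The additively closed ordinals form a set in [U_0], and inside [b + a] they are at most [b], by
    [plus_gap]. So the ultrafilter at [b + a] concentrates on [b] or on its singleton, and the two
    cases end as for bounded fibers, with [b] in place of [a]. *)
Lemma constant_fibers a : a ∈ k ->
  (forall X, subset X k -> ((∀* b, fiber X a b) <-> X ∈ meas false)) -> False.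
Proof.
move=> ak hE.
have dc : dfn (fun e => additively_closed PL (e 0)) by apply: (dfn_additively_closed hPL); dfn_tac.
pose (B := sep k (additively_closed PL)).
have Bk : subset B k by move=> z /(sepP dc) [].
have BU : B ∈ meas false by apply/(al_sep _ _ dc); exact: (al_additively_closed (hmeas false) hPL).
move/(hE B Bk): BU => hB.
have good := al_and uf (nm_tail (hmeas true) ak) hB.
have h2 : ∀* b, fiber b a b \/ fiber (sg b) a b.
  apply: (al_mono uf _ _ good); first by apply: dfn_or; apply: dfn_fiber; dfn_tac.
  move=> b bk [ab hf]; apply: (fiber_or hf) => z zP /(sepP dc) [zk cz].
  case: (plus_gap (hmeas true) hPL bk ab cz zP) => [|->]; first by left.
  by right; apply/sgP.
case: (al_or uf _ _ h2) => [||h|h]; try by apply: dfn_fiber; dfn_tac.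
  apply: (@not_represented (fun Y b => fiber Y a b)); first by apply: dfn_fiber; dfn_tac.
  move=> X Xk; rewrite -(hE X Xk).
  have dr : dfn (fun e => fiber (cap X (e 0)) a (e 0)) by apply: dfn_fiber; [apply: dtm_cap| |]; dfn_tac.
  split=> hX; apply: (al_mono2 uf _ hX h) => // b bk hb hf; last first.
    by apply: fiber_ext hb => z _ /capP [].
  case: (fiber_or (Y := cap X b) (Z := sep k (fun z => ~ z ∈ b)) hb) => //.
    move=> z zP zX; case: (classic (z ∈ b)) => zb; first by left; apply/capP.
    have dn : dfn (fun e => ~ e 0 ∈ b) by dfn_tac.
    by right; apply/(sepP dn); split=> //; exact: Xk.
  move=> hY; have dn : dfn (fun e => ~ e 0 ∈ b) by dfn_tac.
  by have [z [_ [zb /(sepP dn) [_ []]]]] := fiber_disj hf hY.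
apply: meas_false_neq => X Xk; rewrite -(hE X Xk); split=> hX.
  apply: (al_mono2 uf _ hX h); first by dfn_tac.
  by move=> b bk h5 h6; have [z [_ [zX /sgP e]]] := fiber_disj h5 h6; rewrite -e.
apply: (al_mono2 uf _ hX h) => // b bk bX; apply: fiber_ext => z _ /sgP -> //.
Qed.

Lemma ketonen_below_contra : False.
Proof.
have ds : dfn (fun e => ∀* b, fiber (succ (e 0)) (e 0) b) by apply: dE; dfn_tac.
case: (classic (∀* a, ∀* b, fiber (succ a) a b)); first exact: bounded_fibers.
move/(al_not uf ds)/unbounded_fibers/(al_ex uf) => [a [ak h]].
exact: (constant_fibers ak h).
Qed.

End KetonenBelow.

Lemma not_ketonen_below : ~ ketonen k (meas false) W.
Proof. by move=> [J [S [JW [SJ [hS hred]]]]]; exact: (ketonen_below_contra JW SJ hS hred). Qed.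

End Extension.

Section Final.

Context {N : zfc_model}.

Lemma lipschitz_not_ketonen
  (V : N -> Prop) (k U P G jk jP Gs : N) (H meas : bool -> N) (k2 D2 seed W : N) :
  transitive_class V -> ZFC V -> normal_measure V k U ->
  is_easton_product V k P -> generic V P G -> (forall x, extension V G x) ->
  ult_embedding V k U k jk -> ult_embedding V k U P jP ->
  (forall i, is_product_filter k jP G i Gs (H i)) ->
  (forall i, normal_measure univ k (meas i)) ->
  (forall i x, ult univ k (meas i) x <-> extension (ult V k U) (H i) x) ->
  (forall i x y, V x -> ult_embedding V k U x y -> ult_embedding univ k (meas i) x y) ->
  (forall i, ult_embedding univ k (meas i) G (H i)) ->
  is_square k k2 -> is_product_measure k2 (meas true) D2 -> is_ord_sum jk k seed ->
  is_setof W (fun X => subset X k /\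
     exists Y, ult_embedding univ k2 D2 X Y /\ seed ∈ Y) ->
  lipschitz k (meas false) W /\ ~ ketonen k (meas false) W /\ ~ ketonen k W (meas false).
Proof.
move=> hVt hV hU hP hG hVG hjk hjP hH hmeas hult hext hmG hk2 hD2 hseed hW.
(* [P] is a value of the constant function in [V] whose class is [jP]. *)
have VP : V P.
  have [f [Vf [[[_ [tot _]] fP] _]]] := hjP.
  have [[_ [w [_ wk]]] _] := hU; have [y a] := tot w wk.
  have e : y = P by exact: (fP w y a).
  move: a; rewrite e => /app_op h.
  by have [] := V_op_inv hVt (hVt _ _ Vf h).
have [PL hPL] := plus_ex (hmeas true).
have ejk : jk = cls k (meas true) (const k k).
  by eapply embedding_cst; try eassumption; exact: (V_k hVt hU).
rewrite ejk in hseed.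
have hW' := derived_measureE (hmeas true) hk2 hD2 hPL hseed hW.
split; first by eapply lipschitz_reduction; eassumption.
split; first by eapply not_ketonen_below; eassumption.
by eapply not_ketonen_above; eassumption.
Qed.

End Final.

Theorem theorem3p1
  (N : Type) (mem_N : Membership N)
  (V : N -> Prop) (kappa U P G : N)
  (jkappa jP Gstar : N) (H meas : bool -> N)
  (kappa2 D2 seed W : N)
  (* N is V[G], where V = L[U] and G is P-generic over V *)
  (hN : ZFC univ)
  (hV_trans : transitive_class V)
  (hV : ZFC V)
  (hU : normal_measure V kappa U)
  (hkappa : forall l, V l -> measurable V l -> l = kappa)
  (hVL : V_eq_L V U)
  (hP : is_easton_product V kappa P)
  (hG : generic V P G)
  (hVG : forall x, extension V G x)
  (* G^* and the filters H_0, H_1 on j_U(P) *)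
  (hjkappa : ult_embedding V kappa U kappa jkappa)
  (hjP : ult_embedding V kappa U P jP)
  (hGstar : on_tail kappa jP Gstar)
  (hH : forall i, is_product_filter kappa jP G i Gstar (H i))
  (hH_generic : forall i, generic (ult V kappa U) jP (H i))
  (* the normal measures U_0, U_1, whose ultrapower embeddings
     V[G] -> M_U[H_i] extend j_U and map G to H_i *)
  (hmeas : forall i, normal_measure univ kappa (meas i))
  (hmeas_ult : forall i x,
     ult univ kappa (meas i) x <-> extension (ult V kappa U) (H i) x)
  (hmeas_extends : forall i x y, V x ->
     ult_embedding V kappa U x y -> ult_embedding univ kappa (meas i) x y)
  (hmeas_G : forall i, ult_embedding univ kappa (meas i) G (H i))
  (* W is derived from the embedding by (U_1)^2 with seed j_U(kappa) + kappa *)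
  (hkappa2 : is_square kappa kappa2)
  (hD2 : is_product_measure kappa2 (meas true) D2)
  (hseed : is_ord_sum jkappa kappa seed)
  (hW : is_setof W (fun X => subset X kappa /\
     exists Y, ult_embedding univ kappa2 D2 X Y /\ mem seed Y)) :
  lipschitz kappa (meas false) W /\
  ~ ketonen kappa (meas false) W /\
  ~ ketonen kappa W (meas false).
Proof.
exact: (@lipschitz_not_ketonen (ZfcModel hN) V kappa U P G jkappa jP Gstar H meas kappa2 D2 seed W
  hV_trans hV hU hP hG hVG hjkappa hjP hH hmeas hmeas_ult hmeas_extends hmeas_G hkappa2 hD2 hseed hW).
Qed.
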